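(* Let $\nu>0$, $T>0$, and let $\alpha,\beta$ satisfy $\frac12<\beta<\frac54$ and $\alpha+\beta=\frac54$. Let $r>\beta+2$. Given initial conditions $v_{1,0},v_{2,0}\in V^r$ and $\theta_{1,0},\theta_{2,0}\in H^{r-\beta}$, let $(v_i,\theta_i)$, $i=1,2$, be the solutions on $[0,T]$ of the system \[ \partial_t v+B(u,v)+\nu\Lambda^{2\beta}v=\Pi(\theta e_3),\qquad \partial_t\theta+u\cdot\nabla\theta=0,\qquad v=\Lambda^{2\alpha}u, \] with data $(v_{i,0},\theta_{i,0})$ and regularity $v_i\in C([0,T];V^r)\cap L^2(0,T;V^{r+\beta})$, $\theta_i\in C([0,T];H^{r-\beta})$. Then \[ \|v_1-v_2\|_{L^\infty(0,T;V^{r-1})}+\|v_1-v_2\|_{L^2(0,T;V^{r-1+\beta})}+\|\theta_1-\theta_2\|_{L^\infty(0,T;H^{r-\beta-1})} \le C\big(\|v_{1,0}-v_{2,0}\|_{V^{r-1}}+\|\theta_{1,0}-\theta_{2,0}\|_{H^{r-\beta-1}}\big), \] where the constant $C$ depends on $T$, $\|\theta_1\|_{L^\infty(0,T;H^{r-\beta})}$, $\|v_i\|_{L^2(0,T;V^{r+\beta-1})}$ and $\|v_i\|_{L^\infty(0,T;V^r)}$ ($i=1,2$).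
   Context: Let $\mathbb T=[0,2\pi]^3$ with periodic boundary conditions. For $s\in\mathbb R$, $H^s$ is the space of real periodic functions/distributions $f=\sum_{k\in\mathbb Z^3\setminus\{0\}}f_ke^{ik\cdot x}$ (zero mean) with $f_{-k}=\overline{f_k}$ and $\|f\|_{H^s}^2=\sum_k|f_k|^2|k|^{2s}<\infty$. $V^s$ is the analogous space of vector fields $w=\sum_{k\neq0}w_ke^{ik\cdot x}$, $w_k\in\mathbb C^3$, $w_{-k}=\overline{w_k}$, $w_k\cdot k=0$ (divergence free, zero mean), with $\|w\|_{V^s}^2=\sum_k|w_k|^2|k|^{2s}$. $\Lambda^s$ is the Fourier multiplier by $|k|^s$. $\Pi$ is the Leray–Helmholtz projection onto divergence-free fields; $B(u,v)=\Pi((u\cdot\nabla)v)$. $e_3=(0,0,1)$. Solutions are understood in the weak (distributional) sense with $u=\Lambda^{-2\alpha}v$; for such data, solutions with the stated regularity exist and are unique. *)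

(* Defs.v *)
(* concrete reals R, Coquelicot (complex numbers C, Riemann
   integrals, limits).  Everything is expressed through Fourier coefficients
   on the torus [0,2pi]^3, exactly as the spaces H^s, V^s are defined. *)
From Stdlib Require Import Reals ZArith.
From Coquelicot Require Import Coquelicot.
Open Scope R_scope.

Definition Z3 : Type := (Z * Z * Z)%type.
Definition z0 : Z3 := (0%Z, 0%Z, 0%Z).
Definition zneg (k : Z3) : Z3 :=
  let '(a, b, c) := k in ((- a)%Z, (- b)%Z, (- c)%Z).
Definition zsub (k l : Z3) : Z3 :=
  let '(a, b, c) := k in let '(a', b', c') := l in
  ((a - a')%Z, (b - b')%Z, (c - c')%Z).

Inductive ax : Type := A1 | A2 | A3.

Definition kc (k : Z3) (a : ax) : R :=
  let '(k1, k2, k3) := k in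
  IZR (match a with A1 => k1 | A2 => k2 | A3 => k3 end).

Definition knorm2 (k : Z3) : R := kc k A1 ^ 2 + kc k A2 ^ 2 + kc k A3 ^ 2.

(* |k|^s for k <> 0 (the value at k = 0 is irrelevant: all fields have zero mean;
   it is set to 0) *)
Definition kpow (k : Z3) (s : R) : R :=
  if Req_EM_T (knorm2 k) 0 then 0 else Rpower (knorm2 k) (s / 2).

Definition cube_sum {G : AbelianMonoid} (f : Z3 -> G) (N : nat) : G :=
  sum_n (fun i => sum_n (fun j => sum_n (fun l =>
     f ((Z.of_nat i - Z.of_nat N)%Z, (Z.of_nat j - Z.of_nat N)%Z,
        (Z.of_nat l - Z.of_nat N)%Z)) (2 * N)) (2 * N)) (2 * N).

Definition zsum3 (f : Z3 -> R) : Rbar := Lim_seq (cube_sum f).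

Definition is_zsumC (f : Z3 -> C) (l : C) : Prop :=
  filterlim (cube_sum f) eventually (locally l).

(* Scalar fields (Fourier coefficients) and vector fields *)
Definition sfield : Type := Z3 -> C.
Definition vfield : Type := Z3 -> ax -> C.

Definition ssub (f g : sfield) : sfield := fun k => (f k - g k)%C.
Definition vsub (v w : vfield) : vfield := fun k a => (v k a - w k a)%C.

Definition vmod2 (w : ax -> C) : R := Cmod (w A1) ^ 2 + Cmod (w A2) ^ 2 + Cmod (w A3) ^ 2.

Definition hs2 (s : R) (f : sfield) : Rbar :=
  zsum3 (fun k => kpow k (2 * s) * Cmod (f k) ^ 2).
Definition vs2 (s : R) (w : vfield) : Rbar :=
  zsum3 (fun k => kpow k (2 * s) * vmod2 (w k)).

Definition Hnorm (s : R) (f : sfield) : R := sqrt (real (hs2 s f)).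
Definition Vnorm (s : R) (w : vfield) : R := sqrt (real (vs2 s w)).

(* membership in H^s: zero mean, real, finite norm *)
Definition in_H (s : R) (f : sfield) : Prop :=
  f z0 = 0%C /\ (forall k, f (zneg k) = Cconj (f k)) /\ is_finite (hs2 s f).

(* membership in V^s: zero mean, real, divergence free, finite norm *)
Definition in_V (s : R) (w : vfield) : Prop :=
  (forall a, w z0 a = 0%C) /\
  (forall k a, w (zneg k) a = Cconj (w k a)) /\
  (forall k, (RtoC (kc k A1) * w k A1 + RtoC (kc k A2) * w k A2
              + RtoC (kc k A3) * w k A3)%C = 0%C) /\
  is_finite (vs2 s w).

Definition in_CV (T s : R) (v : R -> vfield) : Prop :=
  (forall t, 0 <= t <= T -> in_V s (v t)) /\
  (forall t, 0 <= t <= T -> forall eps, 0 < eps -> exists delta, 0 < delta /\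
     forall t', 0 <= t' <= T -> Rabs (t' - t) < delta ->
       Vnorm s (vsub (v t') (v t)) < eps).

Definition in_CH (T s : R) (th : R -> sfield) : Prop :=
  (forall t, 0 <= t <= T -> in_H s (th t)) /\
  (forall t, 0 <= t <= T -> forall eps, 0 < eps -> exists delta, 0 < delta /\
     forall t', 0 <= t' <= T -> Rabs (t' - t) < delta ->
       Hnorm s (ssub (th t') (th t)) < eps).

(* ||v||_{L^2(0,T;V^s)}^2 = sum_k |k|^{2s} int_0^T |v_k(t)|^2 dt  (Tonelli);
   the integrands are continuous in t for the fields considered *)
Definition L2V2 (T s : R) (v : R -> vfield) : Rbar :=
  zsum3 (fun k => RInt (fun t => kpow k (2 * s) * vmod2 (v t k)) 0 T).
Definition in_L2V (T s : R) (v : R -> vfield) : Prop := is_finite (L2V2 T s v).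
Definition L2Vnorm (T s : R) (v : R -> vfield) : R := sqrt (real (L2V2 T s v)).

(* L^infty(0,T;X) norms (sup over [0,T]; the fields are continuous in time) *)
Definition LinfV (T s : R) (v : R -> vfield) : R :=
  real (Lub_Rbar (fun x => exists t, 0 <= t <= T /\ x = Vnorm s (v t))).
Definition LinfH (T s : R) (th : R -> sfield) : R :=
  real (Lub_Rbar (fun x => exists t, 0 <= t <= T /\ x = Hnorm s (th t))).

Definition uvel (al : R) (v : vfield) : vfield :=
  fun k a => (RtoC (kpow k (- 2 * al)) * v k a)%C.

(* Fourier coefficient factor of (u . grad) at output frequency k, input l:
   sum_a u_{k-l,a} (i l_a) *)
Definition dotgrad (u : vfield) (k l : Z3) : C :=
  (u (zsub k l) A1 * (Ci * RtoC (kc l A1)) +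
   u (zsub k l) A2 * (Ci * RtoC (kc l A2)) +
   u (zsub k l) A3 * (Ci * RtoC (kc l A3)))%C.

Definition leray (k : Z3) (w : ax -> C) : ax -> C :=
  fun a => (w a - RtoC (kc k a / knorm2 k) *
     (RtoC (kc k A1) * w A1 + RtoC (kc k A2) * w A2 + RtoC (kc k A3) * w A3))%C.

Definition e3times (c : C) : ax -> C :=
  fun a => match a with A3 => c | _ => 0%C end.

(* (v, theta) is a weak solution on [0,T] of
     d_t v + B(u,v) + nu Lambda^{2 beta} v = Pi(theta e_3),
     d_t theta + u . grad theta = 0,   v = Lambda^{2 alpha} u,
   with data (v0, th0): each Fourier mode satisfies the equation integrated in
   time, the quadratic terms being the (convergent) convolution sums
   NB = ((u.grad) v)^, NT = (u.grad theta)^. *)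
Definition is_solution (nu al be T : R) (v0 : vfield) (th0 : sfield)
    (v : R -> vfield) (th : R -> sfield) : Prop :=
  (forall k a, v 0 k a = v0 k a) /\ (forall k, th 0 k = th0 k) /\
  exists (NB : R -> vfield) (NT : R -> sfield),
    (forall t, 0 <= t <= T -> forall k a,
       is_zsumC (fun l => (dotgrad (uvel al (v t)) k l * v t l a)%C) (NB t k a)) /\
    (forall t, 0 <= t <= T -> forall k,
       is_zsumC (fun l => (dotgrad (uvel al (v t)) k l * th t l)%C) (NT t k)) /\
    (forall k, k <> z0 -> forall a t, 0 <= t <= T ->
       is_RInt (fun s => (- leray k (NB s k) a
                          - RtoC (nu * kpow k (2 * be)) * v s k a
                          + leray k (e3times (th s k)) a)%C)
               0 t (v t k a - v0 k a)%C) /\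
    (forall k, k <> z0 -> forall t, 0 <= t <= T ->
       is_RInt (fun s => (- NT s k)%C) 0 t (th t k - th0 k)%C).

(* Main.v *)
(* The difference [w = v1 - v2], [eta = th1 - th2] is estimated by an energy
   method at the regularity [s = r - 1] for [w] and [sg = r - be - 1] for [eta].
   The smoothing term controls [|w|_{s+be}], which pays for the loss of
   derivative in [B(u2, w)]: as [be > 1/2], [|w|_{s+1-be}] interpolates between
   [|w|_s] and [|w|_{s+be}].  The transport of [eta] has no smoothing; there
   [u2 . grad] is antisymmetric, only a commutator with the weight remains, and
   it is bounded by [|v2|_r |eta|_sg].  The terms with [u1 - u2] lose a derivative
   of [v1] and [th1] only, which is why the estimate is one derivative below the
   data.  All bilinear bounds are Young's inequality [l^1 * l^2 -> l^2] on Fourier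
   coefficients, with [l^1] norms controlled by Sobolev norms because
   [be + 1 > 3/2].  Gronwall's lemma concludes.

   Sums over modes are handled as bounds on finite partial sums, uniform in the
   finite set of modes; the energy is truncated in frequency so that it can be
   differentiated mode by mode. *)
From Stdlib Require Import Reals ZArith List FinFun Lra Lia Psatz.
From Coquelicot Require Import Coquelicot.
Require Import Defs.
Import ListNotations.
Open Scope R_scope.

(** * Finite sums over lattice points *)

(** Two mismatches shape the truncated argument. The output modes of a convolution can be restricted
    to a cube, but its input modes cannot, so the dissipation on the cube does not control all of
    [w] in B(u2, w). Inputs outside the cube are charged to the bound of [w] in V^r, which has [be]
    > 1/2 derivatives to spare over the norm needed there; this leaves an error of order 1/(N+1).
    For the same reason the rate of the truncated energy is bounded by full norms, and Gronwall's
    lemma cannot be used at fixed N: the inequality is integrated, N tends to infinity, and the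
    resulting integral inequality is iterated. A jump in the weight of the scalar energy would cost
    the derivative that the commutator has to save. Hence the weight decreases to zero linearly,
    with a Lipschitz bound uniform in N. The embedding exponent [be + 1] fits the spaces exactly: (r
    - 1 - be) + (be + 1) = r, both in B(u2, w) and in the commutator, so [v2] can always be the l^1
    factor. In (u1 - u2) . grad th1 the exponents do not fit, and [be] derivatives have to be moved
    between the factors. *)

Definition fsum {A : Type} (L : list A) (f : A -> R) : R :=
  fold_right (fun x s => f x + s) 0 L.

Lemma fsum_ext {A} (L : list A) f g :
  (forall x, In x L -> f x = g x) -> fsum L f = fsum L g.
Proof.
  induction L as [|x L IH]; simpl; intros H; [easy|].
  rewrite H, IH; auto.
Qed.

Lemma fsum_le {A} (L : list A) f g :
  (forall x, In x L -> f x <= g x) -> fsum L f <= fsum L g.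
Proof.
  induction L as [|x L IH]; simpl; intros H; [lra|].
  apply Rplus_le_compat; auto.
Qed.

Lemma fsum_zero {A} (L : list A) : fsum L (fun _ => 0) = 0.
Proof. induction L; simpl; lra. Qed.

Lemma fsum_ge0 {A} (L : list A) f :
  (forall x, In x L -> 0 <= f x) -> 0 <= fsum L f.
Proof. intros H. rewrite <- (fsum_zero L). now apply fsum_le. Qed.

Lemma fsum_plus {A} (L : list A) f g :
  fsum L (fun x => f x + g x) = fsum L f + fsum L g.
Proof. induction L; simpl; lra. Qed.

Lemma fsum_scal {A} (L : list A) c f :
  fsum L (fun x => c * f x) = c * fsum L f.
Proof. induction L; simpl; lra. Qed.

Lemma fsum_opp {A} (L : list A) f : fsum L (fun x => - f x) = - fsum L f.
Proof. induction L; simpl; lra. Qed.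

Lemma fsum_abs {A} (L : list A) f :
  Rabs (fsum L f) <= fsum L (fun x => Rabs (f x)).
Proof.
  induction L; simpl; [rewrite Rabs_R0; lra|].
  eapply Rle_trans; [apply Rabs_triang|lra].
Qed.

Lemma fsum_app {A} (L L' : list A) f : fsum (L ++ L') f = fsum L f + fsum L' f.
Proof. induction L; simpl; lra. Qed.

Lemma fsum_map {A B} (h : A -> B) (L : list A) f :
  fsum (map h L) f = fsum L (fun x => f (h x)).
Proof. induction L as [|x L IH]; [reflexivity|]. cbn. f_equal. exact IH. Qed.

Lemma fsum_prod {A B} (L : list A) (L' : list B) f :
  fsum (list_prod L L') f = fsum L (fun x => fsum L' (fun y => f (x, y))).
Proof.
  induction L as [|x L IH]; [reflexivity|].
  change (list_prod (x :: L) L') with (map (fun y => (x, y)) L' ++ list_prod L L').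
  rewrite fsum_app, fsum_map, IH. reflexivity.
Qed.

Lemma fsum_swap {A B} (L : list A) (L' : list B) f :
  fsum L (fun x => fsum L' (fun y => f x y))
  = fsum L' (fun y => fsum L (fun x => f x y)).
Proof.
  induction L as [|x L IH]; cbn; [now rewrite fsum_zero|].
  rewrite fsum_plus. f_equal. exact IH.
Qed.

Lemma fsum_incl {A} (L L' : list A) f :
  NoDup L -> incl L L' -> (forall x, 0 <= f x) -> fsum L f <= fsum L' f.
Proof.
  intros HL; revert L'; induction HL as [|x L Hx HL IH]; intros L' Hi Hf.
  - now apply fsum_ge0.
  - destruct (in_split x L') as (l1 & l2 & ->); [now apply Hi; left|].
    rewrite fsum_app; simpl.
    enough (fsum L f <= fsum (l1 ++ l2) f) by (rewrite fsum_app in *; lra).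
    apply IH; auto. intros y Hy.
    assert (y <> x) by congruence.
    specialize (Hi y (or_intror Hy)). rewrite in_app_iff in *. simpl in Hi.
    intuition congruence.
Qed.

(** Serves to enlarge the output cube to the input cube where the weight vanishes in between, so
    that antisymmetry in the two frequencies acts on a square index set. *)
Lemma fsum_support {A} (L L' : list A) f :
  NoDup L -> NoDup L' -> incl L L' ->
  (forall x, In x L' -> ~ In x L -> f x = 0) -> fsum L f = fsum L' f.
Proof.
  intros HL; revert L'; induction HL as [|x L Hx HL IH]; intros L' HL' Hi Hf.
  - change (0 = fsum L' f). rewrite <- (fsum_zero L'). apply fsum_ext. intros y Hy. symmetry; auto.
  - destruct (in_split x L') as (l1 & l2 & ->); [now apply Hi; left|].
    assert (Hn := NoDup_remove_1 _ _ _ HL'). assert (Hm := NoDup_remove_2 _ _ _ HL').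
    rewrite fsum_app; simpl.
    enough (fsum L f = fsum (l1 ++ l2) f) by (rewrite fsum_app in *; lra).
    apply IH; auto.
    + intros y Hy.
      assert (y <> x) by congruence.
      specialize (Hi y (or_intror Hy)). rewrite in_app_iff in *. simpl in Hi.
      intuition congruence.
    + intros y Hy Hn'. apply Hf.
      * rewrite in_app_iff in *. simpl. tauto.
      * simpl. intros [<-|?]; tauto.
Qed.

Lemma discriminant_le P Q S :
  0 <= P -> (forall t, 0 <= P * t ^ 2 - 2 * S * t + Q) -> S ^ 2 <= P * Q.
Proof.
  intros HP H. destruct (Req_dec P 0) as [->|HP0].
  - assert (S = 0); [|subst; lra].
    destruct (Req_dec S 0); auto.
    (* For P = 0 the expression is affine in t, and at this t it equals -1. *)
    specialize (H ((Q + 1) / (2 * S))).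
    replace (0 * ((Q + 1) / (2 * S)) ^ 2 - 2 * S * ((Q + 1) / (2 * S)) + Q)
      with (-1) in H by (field; auto). lra.
  - specialize (H (S / P)).
    replace (P * (S / P) ^ 2 - 2 * S * (S / P) + Q) with ((P * Q - S ^ 2) / P) in H
      by (field; auto).
    assert (0 < P) by lra.
    apply (Rmult_le_compat_r P) in H; [|lra].
    replace ((P * Q - S ^ 2) / P * P) with (P * Q - S ^ 2) in H by (field; lra). lra.
Qed.

(** The weight [a] is kept apart from both factors because in Young's inequality it is the
    convolution kernel, of which each factor receives a square root. *)
Lemma fsum_cauchy_schwarz {A} (L : list A) (a b c : A -> R) :
  (forall x, 0 <= a x) ->
  fsum L (fun x => a x * b x * c x) ^ 2
  <= fsum L (fun x => a x * b x ^ 2) * fsum L (fun x => a x * c x ^ 2).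
Proof.
  intros Ha. apply discriminant_le.
  - apply fsum_ge0. intros. apply Rmult_le_pos; auto. apply pow2_ge_0.
  - intros t.
    replace (_ - _ + _) with (fsum L (fun x => a x * (b x * t - c x) ^ 2)).
    + apply fsum_ge0. intros. apply Rmult_le_pos; auto. apply pow2_ge_0.
    + induction L as [|x L IH]; simpl in *; [lra|]. rewrite IH. ring.
Qed.

Lemma fsum_cauchy_schwarz_le {A} (L : list A) (a b c : A -> R) P Q X :
  (forall x, 0 <= a x) -> 0 <= X -> 0 <= P -> 0 <= Q ->
  fsum L (fun x => a x * b x ^ 2) <= X * P ^ 2 ->
  fsum L (fun x => a x * c x ^ 2) <= X * Q ^ 2 ->
  fsum L (fun x => a x * b x * c x) <= X * P * Q.
Proof.
  intros Ha HX HP HQ H1 H2.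
  apply Rle_trans with (sqrt ((X * P * Q) ^ 2)).
  2: { rewrite sqrt_pow2; [lra|]. repeat apply Rmult_le_pos; auto. }
  eapply Rle_trans; [apply Rle_abs|]. rewrite <- sqrt_Rsqr_abs.
  apply sqrt_le_1_alt. rewrite Rsqr_pow2.
  eapply Rle_trans; [apply fsum_cauchy_schwarz; auto|].
  replace ((X * P * Q) ^ 2) with ((X * P ^ 2) * (X * Q ^ 2)) by ring.
  apply Rmult_le_compat; auto; apply fsum_ge0; intros;
    apply Rmult_le_pos; auto; apply pow2_ge_0.
Qed.

(** * Cubes of frequencies as lists, and the sums over them *)

Definition interval (N : nat) : list Z :=
  map (fun i => (Z.of_nat i - Z.of_nat N)%Z) (seq 0 (S (2 * N))).
Definition cube (N : nat) : list Z3 :=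
  list_prod (list_prod (interval N) (interval N)) (interval N).

Lemma in_interval N z : In z (interval N) <-> (Z.abs z <= Z.of_nat N)%Z.
Proof.
  unfold interval. rewrite in_map_iff. split.
  - intros (i & <- & Hi). apply in_seq in Hi. lia.
  - intros H. exists (Z.to_nat (z + Z.of_nat N)). rewrite in_seq. lia.
Qed.

Lemma in_cube N a b c : In (a, b, c) (cube N) <->
  (Z.abs a <= Z.of_nat N /\ Z.abs b <= Z.of_nat N /\ Z.abs c <= Z.of_nat N)%Z.
Proof. unfold cube. rewrite !in_prod_iff, !in_interval. tauto. Qed.

Lemma interval_NoDup N : NoDup (interval N).
Proof. apply Injective_map_NoDup; [intros x y H; lia|apply seq_NoDup]. Qed.

Lemma list_prod_NoDup {A B} (L : list A) (L' : list B) :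
  NoDup L -> NoDup L' -> NoDup (list_prod L L').
Proof.
  intros HL HL'. induction HL as [|x L Hx HL IH]; simpl; [constructor|].
  apply NoDup_app; auto.
  - apply Injective_map_NoDup; auto. intros y z E. congruence.
  - intros [y z] H1 H2. apply in_map_iff in H1. destruct H1 as (? & E & _).
    apply in_prod_iff in H2. inversion E; subst. tauto.
Qed.

Lemma cube_NoDup N : NoDup (cube N).
Proof. repeat apply list_prod_NoDup; apply interval_NoDup. Qed.

Lemma cube_incl N M : (N <= M)%nat -> incl (cube N) (cube M).
Proof. intros H [[a b] c]. rewrite !in_cube. lia. Qed.

Lemma incl_cube (L : list Z3) : exists N, incl L (cube N).
Proof.
  induction L as [|[[a b] c] L [N IH]]; [exists 0%nat; easy|].
  exists (Nat.max N (Z.to_nat (Z.abs a + Z.abs b + Z.abs c))).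
  intros k [<-|Hk].
  - apply in_cube. lia.
  - eapply cube_incl; [|apply IH, Hk]. lia.
Qed.

Lemma fsum_seq (f : nat -> R) n : sum_n f n = fsum (seq 0 (S n)) f.
Proof.
  induction n as [|n IH].
  - rewrite sum_O. simpl. lra.
  - rewrite sum_Sn, IH, (seq_S (S n)), fsum_app. unfold plus; simpl. lra.
Qed.

Lemma cube_sum_fsum (f : Z3 -> R) N : cube_sum f N = fsum (cube N) f.
Proof.
  unfold cube_sum, cube, Z3 in *. rewrite !fsum_prod. unfold interval. rewrite fsum_seq, fsum_map.
  apply fsum_ext. intros i _. rewrite fsum_seq, fsum_map.
  apply fsum_ext. intros j _. rewrite fsum_seq, fsum_map. reflexivity.
Qed.

Lemma sum_n_fst (f : nat -> C) n : fst (sum_n f n) = sum_n (fun i => fst (f i)) n.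
Proof.
  induction n as [|n IH]; [now rewrite !sum_O|].
  rewrite !sum_Sn, <- IH. reflexivity.
Qed.

Lemma sum_n_snd (f : nat -> C) n : snd (sum_n f n) = sum_n (fun i => snd (f i)) n.
Proof.
  induction n as [|n IH]; [now rewrite !sum_O|].
  rewrite !sum_Sn, <- IH. reflexivity.
Qed.

Lemma cube_sum_fst (f : Z3 -> C) N :
  fst (cube_sum f N) = fsum (cube N) (fun k => fst (f k)).
Proof.
  rewrite <- cube_sum_fsum. unfold cube_sum. rewrite sum_n_fst.
  apply sum_n_ext. intros i. rewrite sum_n_fst.
  apply sum_n_ext. intros j. now rewrite sum_n_fst.
Qed.

Lemma cube_sum_snd (f : Z3 -> C) N :
  snd (cube_sum f N) = fsum (cube N) (fun k => snd (f k)).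
Proof.
  rewrite <- cube_sum_fsum. unfold cube_sum. rewrite sum_n_snd.
  apply sum_n_ext. intros i. rewrite sum_n_snd.
  apply sum_n_ext. intros j. now rewrite sum_n_snd.
Qed.

Lemma is_zsumC_fst (f : Z3 -> C) l :
  is_zsumC f l -> is_lim_seq (fun N => fsum (cube N) (fun k => fst (f k))) (fst l).
Proof.
  intros H. apply is_lim_seq_ext with (fun N => fst (cube_sum f N)).
  { intros. apply cube_sum_fst. }
  apply filterlim_locally. intros eps.
  assert (H' := proj1 (filterlim_locally _ _) H eps). revert H'.
  apply filter_imp. intros N [HN _]. exact HN.
Qed.

Lemma is_zsumC_snd (f : Z3 -> C) l :
  is_zsumC f l -> is_lim_seq (fun N => fsum (cube N) (fun k => snd (f k))) (snd l).
Proof.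
  intros H. apply is_lim_seq_ext with (fun N => snd (cube_sum f N)).
  { intros. apply cube_sum_snd. }
  apply filterlim_locally. intros eps.
  assert (H' := proj1 (filterlim_locally _ _) H eps). revert H'.
  apply filter_imp. intros N [_ HN]. exact HN.
Qed.

Definition summable_le {A} (f : A -> R) (B : R) : Prop :=
  forall L, NoDup L -> fsum L f <= B.

Lemma zsum3_bound (f : Z3 -> R) B :
  (forall k, 0 <= f k) -> (forall N, fsum (cube N) f <= B) ->
  is_finite (zsum3 f) /\ real (zsum3 f) <= B.
Proof.
  intros Hf HB. unfold zsum3.
  assert (Hl : ex_finite_lim_seq (cube_sum f)).
  { apply ex_finite_lim_seq_incr with B.
    - intros n. rewrite !cube_sum_fsum. apply fsum_incl; auto using cube_NoDup.
      apply cube_incl. lia.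
    - intros n. now rewrite cube_sum_fsum. }
  apply Lim_seq_correct' in Hl as Hl'.
  split.
  - destruct Hl as [l Hl]. apply is_lim_seq_unique in Hl. rewrite Hl. reflexivity.
  - apply (is_lim_seq_le (cube_sum f) (fun _ => B) (real (Lim_seq (cube_sum f))) B); auto.
    + intros n. now rewrite cube_sum_fsum.
    + apply is_lim_seq_const.
Qed.

Lemma zsum3_summable (f : Z3 -> R) :
  (forall k, 0 <= f k) -> is_finite (zsum3 f) -> summable_le f (real (zsum3 f)).
Proof.
  intros Hf Hfin L HL. destruct (incl_cube L) as [N HN].
  eapply Rle_trans; [apply (fsum_incl _ (cube N)); auto|].
  unfold zsum3 in *.
  assert (Hex : ex_lim_seq (cube_sum f)).
  { apply ex_lim_seq_incr. intros n. rewrite !cube_sum_fsum.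
    apply fsum_incl; auto using cube_NoDup. apply cube_incl. lia. }
  apply Lim_seq_correct in Hex. rewrite <- Hfin in Hex. 
  rewrite <- cube_sum_fsum.
  apply (is_lim_seq_incr_compare (cube_sum f)); auto.
  intros n. rewrite !cube_sum_fsum.
  apply fsum_incl; auto using cube_NoDup. apply cube_incl. lia.
Qed.

(** * Powers of the wave number *)

Lemma Z3_eq_dec (k l : Z3) : {k = l} + {k <> l}.
Proof. repeat decide equality. Qed.

Lemma zsub_inj_l k l m : zsub k m = zsub l m -> k = l.
Proof.
  destruct k as [[a b] c], l as [[d e] f], m as [[g h] i]. unfold zsub. intros E.
  injection E; intros. repeat f_equal; lia.
Qed.

Lemma zsub_inj_r k l m : zsub k l = zsub k m -> l = m.
Proof.
  destruct k as [[a b] c], l as [[d e] f], m as [[g h] i]. unfold zsub. intros E.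
  injection E; intros. repeat f_equal; lia.
Qed.

Lemma zneg_zsub k l : zneg (zsub k l) = zsub l k.
Proof.
  destruct k as [[a b] c], l as [[d e] f]. unfold zneg, zsub. repeat f_equal; lia.
Qed.

Lemma knorm2_zneg k : knorm2 (zneg k) = knorm2 k.
Proof.
  destruct k as [[a b] c]. unfold knorm2, zneg, kc. rewrite !opp_IZR. ring.
Qed.

Lemma knorm2_ge0 k : 0 <= knorm2 k.
Proof.
  assert (H := fun a => pow2_ge_0 (kc k a)).
  unfold knorm2. generalize (H A1) (H A2) (H A3). lra.
Qed.

Lemma knorm2_IZR a b c : knorm2 (a, b, c) = IZR (a * a + b * b + c * c).
Proof. unfold knorm2, kc. rewrite !plus_IZR, !mult_IZR. ring. Qed.

Lemma knorm2_z0 : knorm2 z0 = 0.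
Proof. unfold z0. now rewrite knorm2_IZR. Qed.

Lemma knorm2_ge1 k : k <> z0 -> 1 <= knorm2 k.
Proof.
  destruct k as [[a b] c]. intros H. rewrite knorm2_IZR. apply IZR_le.
  assert (a <> 0 \/ b <> 0 \/ c <> 0)%Z; [|nia].
  destruct (Z.eq_dec a 0), (Z.eq_dec b 0), (Z.eq_dec c 0); subst; auto.
Qed.

Lemma kpow_z0 s : kpow z0 s = 0.
Proof. unfold kpow. rewrite knorm2_z0. destruct (Req_EM_T 0 0); [easy|lra]. Qed.

Lemma kpow_nz k s : k <> z0 -> kpow k s = Rpower (knorm2 k) (s / 2).
Proof.
  intros H. apply knorm2_ge1 in H. unfold kpow. destruct (Req_EM_T _ _); [lra|easy].
Qed.

Lemma kpow_pos k s : k <> z0 -> 0 < kpow k s.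
Proof. intros H. rewrite kpow_nz; auto. apply exp_pos. Qed.

Lemma kpow_ge0 k s : 0 <= kpow k s.
Proof.
  destruct (Z3_eq_dec k z0) as [->|H]; [rewrite kpow_z0; lra|].
  left; now apply kpow_pos.
Qed.

Lemma kpow_zneg k s : kpow (zneg k) s = kpow k s.
Proof. unfold kpow. now rewrite knorm2_zneg. Qed.

Lemma kpow_plus k p q : kpow k (p + q) = kpow k p * kpow k q.
Proof.
  destruct (Z3_eq_dec k z0) as [->|H]; [rewrite !kpow_z0; lra|].
  rewrite !kpow_nz, <- Rpower_plus; auto. f_equal. field.
Qed.

Lemma kpow_double k p : kpow k (2 * p) = kpow k p ^ 2.
Proof. replace (2 * p) with (p + p) by ring. rewrite kpow_plus. ring. Qed.

Lemma kpow_0 k : k <> z0 -> kpow k 0 = 1.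
Proof.
  intros H. rewrite kpow_nz; auto. unfold Rdiv. rewrite Rmult_0_l.
  apply Rpower_O. apply knorm2_ge1 in H. lra.
Qed.

(** Nonzero lattice points satisfy |k| >= 1, so a power grows with its exponent; at k = 0 both sides
    are the default value 0. *)
Lemma kpow_le k p q : p <= q -> kpow k p <= kpow k q.
Proof.
  intros Hpq. destruct (Z3_eq_dec k z0) as [->|H]; [rewrite !kpow_z0; lra|].
  rewrite !kpow_nz; auto. apply knorm2_ge1 in H.
  destruct (Req_dec (knorm2 k) 1) as [E|E].
  - rewrite E. unfold Rpower. rewrite ln_1. rewrite !Rmult_0_r. lra.
  - apply Rle_Rpower; lra.
Qed.

Lemma kpow_le1 k p : p <= 0 -> kpow k p <= 1.
Proof.
  intros Hp. destruct (Z3_eq_dec k z0) as [->|H]; [rewrite !kpow_z0; lra|].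
  rewrite <- (kpow_0 k H). now apply kpow_le.
Qed.

Lemma kpow_ge1 k p : k <> z0 -> 0 <= p -> 1 <= kpow k p.
Proof. intros H Hp. rewrite <- (kpow_0 k H). now apply kpow_le. Qed.

Lemma kpow_1 k : kpow k 1 = sqrt (knorm2 k).
Proof.
  destruct (Z3_eq_dec k z0) as [->|H]; [now rewrite kpow_z0, knorm2_z0, sqrt_0|].
  rewrite kpow_nz; auto. rewrite <- Rpower_sqrt; [f_equal; field|].
  apply knorm2_ge1 in H. lra.
Qed.

Lemma kpow_Rpower k p : k <> z0 -> kpow k p = Rpower (kpow k 1) p.
Proof.
  intros H. rewrite !kpow_nz, Rpower_mult; auto. f_equal. field.
Qed.

Lemma kc_le k a : Rabs (kc k a) <= kpow k 1.
Proof.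
  rewrite kpow_1, <- sqrt_Rsqr_abs. apply sqrt_le_1_alt. unfold knorm2, Rsqr.
  assert (H := fun a => pow2_ge_0 (kc k a)).
  generalize (H A1) (H A2) (H A3). destruct a; simpl; lra.
Qed.

Lemma kpow_triangle k l : kpow k 1 <= kpow (zsub k l) 1 + kpow l 1.
Proof.
  assert (Hl := kpow_ge0 l 1). assert (Hk := kpow_ge0 (zsub k l) 1).
  rewrite !kpow_1 in *.
  apply Rsqr_incr_0_var; [|lra].
  replace (Rsqr (sqrt (knorm2 (zsub k l)) + sqrt (knorm2 l))) with
    (knorm2 (zsub k l) + knorm2 l + 2 * (sqrt (knorm2 (zsub k l)) * sqrt (knorm2 l))).
  2: { generalize (sqrt_sqrt _ (knorm2_ge0 (zsub k l))) (sqrt_sqrt _ (knorm2_ge0 l)).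
       unfold Rsqr. lra. }
  rewrite Rsqr_sqrt by apply knorm2_ge0.
  rewrite <- sqrt_mult by apply knorm2_ge0.
  destruct k as [[k1 k2] k3], l as [[l1 l2] l3].
  unfold knorm2, zsub, kc. rewrite !minus_IZR.
  set (x1 := IZR k1). set (x2 := IZR k2). set (x3 := IZR k3).
  set (y1 := IZR l1). set (y2 := IZR l2). set (y3 := IZR l3).
  set (P := (_ + _ + _) * _).
  enough ((x1 - y1) * y1 + (x2 - y2) * y2 + (x3 - y3) * y3 <= sqrt P) by nra.
  eapply Rle_trans; [apply Rle_abs|]. rewrite <- sqrt_Rsqr_abs.
  apply sqrt_le_1_alt. unfold P, Rsqr.
  (* Lagrange's identity: the product of the squared norms minus the squared inner product is the
     sum of the squares of these three minors. *)
  assert (H1 := pow2_ge_0 ((x1 - y1) * y2 - (x2 - y2) * y1)).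
  assert (H2 := pow2_ge_0 ((x1 - y1) * y3 - (x3 - y3) * y1)).
  assert (H3 := pow2_ge_0 ((x2 - y2) * y3 - (x3 - y3) * y2)).
  nra.
Qed.

Lemma kpow_zsub_sym k l s : kpow (zsub k l) s = kpow (zsub l k) s.
Proof. now rewrite <- zneg_zsub, kpow_zneg. Qed.

Lemma kpow_base_le k l c p : k <> z0 -> l <> z0 -> 0 <= p -> 0 < c ->
  kpow k 1 <= c * kpow l 1 -> kpow k p <= Rpower c p * kpow l p.
Proof.
  intros Hk Hl Hp Hc H. rewrite (kpow_Rpower k), (kpow_Rpower l p); auto.
  rewrite Rpower_mult_distr; auto using kpow_pos.
  apply Rle_Rpower_l; auto. split; auto using kpow_pos.
Qed.

(** One of |k - l| and |l| is at least |k| / 2, whence the factor 2^p. *)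
Lemma kpow_quasi_triangle k l p : 0 <= p ->
  kpow k p <= Rpower 2 p * (kpow (zsub k l) p + kpow l p).
Proof.
  intros Hp. assert (Hc : 0 < Rpower 2 p) by apply exp_pos.
  assert (H1 := kpow_ge0 (zsub k l) p). assert (H2 := kpow_ge0 l p).
  destruct (Z3_eq_dec k z0) as [->|Hk]; [rewrite kpow_z0; nra|].
  assert (Ht := kpow_triangle k l). assert (H0 := kpow_pos k 1 Hk).
  destruct (Rle_dec (kpow (zsub k l) 1) (kpow l 1)) as [H|H].
  - assert (l <> z0) by (intros ->; rewrite kpow_z0 in *; lra).
    assert (kpow k p <= Rpower 2 p * kpow l p) by (apply kpow_base_le; auto; lra). nra.
  - assert (zsub k l <> z0) by (intros E; rewrite E, kpow_z0 in *; assert (Hx := kpow_ge0 l 1); lra).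
    assert (kpow k p <= Rpower 2 p * kpow (zsub k l) p) by (apply kpow_base_le; auto; lra). nra.
Qed.

(* Used when neither factor alone carries the full weight: the lower-frequency
   factor gives up [b] derivatives to the higher one. *)
Lemma kpow_product_split k l p b : 0 <= p -> 0 <= b ->
  zsub k l <> z0 ->
  kpow k p * kpow l 1
  <= Rpower 2 p * (kpow l (p + 1) + kpow (zsub k l) (p + b) * kpow l (1 - b)).
Proof.
  intros Hp Hb Hkl. assert (Hc : 0 < Rpower 2 p) by apply exp_pos.
  assert (H1 := kpow_ge0 (zsub k l) (p + b)). assert (H2 := kpow_ge0 l (1 - b)).
  assert (H3 := kpow_ge0 l (p + 1)). assert (H4 := kpow_ge0 l 1).
  assert (H5 := Rmult_le_pos _ _ H1 H2).
  destruct (Z3_eq_dec k z0) as [->|Hk]; [rewrite kpow_z0; nra|].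
  destruct (Z3_eq_dec l z0) as [->|Hl]; [rewrite !kpow_z0; nra|].
  assert (Ht := kpow_triangle k l). assert (H0 := kpow_pos k 1 Hk).
  destruct (Rle_dec (kpow (zsub k l) 1) (kpow l 1)) as [H|H].
  - assert (kpow k p <= Rpower 2 p * kpow l p) by (apply kpow_base_le; auto; lra).
    rewrite (kpow_plus l).
    apply Rle_trans with (Rpower 2 p * kpow l p * kpow l 1); [now apply Rmult_le_compat_r|].
    apply Rmult_le_compat_l with (r := Rpower 2 p) in H5; lra.
  - assert (kpow k p <= Rpower 2 p * kpow (zsub k l) p) by (apply kpow_base_le; auto; lra).
    assert (E : kpow l 1 = kpow l b * kpow l (1 - b))
      by (rewrite <- kpow_plus; f_equal; ring).
    assert (kpow l b <= Rpower 1 b * kpow (zsub k l) b) as Hlb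
      by (apply kpow_base_le; auto; lra).
    assert (Rpower 1 b = 1) as E1 by (unfold Rpower; rewrite ln_1, Rmult_0_r; apply exp_0).
    rewrite E1, Rmult_1_l in Hlb.
    assert (kpow l 1 <= kpow (zsub k l) b * kpow l (1 - b)) by (rewrite E; apply Rmult_le_compat_r; auto).
    apply Rle_trans with ((Rpower 2 p * kpow (zsub k l) p) * (kpow (zsub k l) b * kpow l (1 - b))).
    + apply Rmult_le_compat; auto using kpow_ge0.
    + rewrite (kpow_plus (zsub k l)). nra.
Qed.

(** * Lipschitz bounds for powers and for the frequency cutoff *)

Lemma Rpower_lipschitz x y s : 0 < x <= y -> 1 <= s ->
  0 <= Rpower y s - Rpower x s <= s * Rpower y (s - 1) * (y - x).
Proof.
  intros [Hx Hxy] Hs. split.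
  { assert (Rpower x s <= Rpower y s) by (apply Rle_Rpower_l; lra). lra. }
  destruct (Req_dec x y) as [->|Hne]; [lra|].
  destruct (MVT_cor2 (fun x => Rpower x s) (fun x => s * Rpower x (s - 1)) x y)
    as (c & E & Hc); [lra| |].
  { intros c Hc. apply derivable_pt_lim_power. lra. }
  rewrite E. apply Rmult_le_compat_r; [lra|]. apply Rmult_le_compat_l; [lra|].
  apply Rle_Rpower_l; lra.
Qed.

(** A product rule for x^s times the cutoff. The slope 1/n of the cutoff matters only for x < n,
    where x^s / n <= x^(s-1); the cutoff thus turns the constant s into s + 1, whatever n is. For x
    >= n both terms vanish. *)
Lemma cutoff_lipschitz x y s n : 0 < x <= y -> 1 <= s -> 0 < n ->
  Rabs (Rpower x s * Rmax 0 (1 - x / n) - Rpower y s * Rmax 0 (1 - y / n))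
  <= (s + 1) * Rpower y (s - 1) * (y - x).
Proof.
  intros Hxy Hs Hn. destruct (Rpower_lipschitz x y s Hxy Hs) as [H1 H2].
  assert (Hy0 : 0 < Rpower y (s - 1)) by apply exp_pos.
  assert (Hx0 : 0 < Rpower x (s - 1)) by apply exp_pos.
  assert (H3 : Rpower x (s - 1) <= Rpower y (s - 1)) by (apply Rle_Rpower_l; lra).
  assert (Ex : Rpower x s = Rpower x (s - 1) * x).
  { rewrite <- (Rpower_1 x) at 3 by lra. rewrite <- Rpower_plus. f_equal. ring. }
  assert (Hd : y / n - x / n = (y - x) / n) by (field; lra).
  assert (Hd0 : 0 <= (y - x) / n) by (apply Rdiv_le_0_compat; lra).
  assert (Hxn : 0 < x / n) by (apply Rdiv_lt_0_compat; lra).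
  set (P := Rpower y (s - 1)) in *. set (Q := Rpower x (s - 1)) in *.
  set (A := Rpower x s) in *. set (B := Rpower y s) in *.
  assert (HA : 0 <= A) by (unfold A; left; apply exp_pos).
  destruct (Rle_dec n x) as [H|H].
  - assert (1 <= x / n) by (apply Rle_div_r; lra).
    rewrite !Rmax_left by lra. replace (A * 0 - B * 0) with 0 by ring. rewrite Rabs_R0.
    repeat apply Rmult_le_pos; lra.
  - assert (x / n < 1) by (apply Rlt_div_l; lra).
    rewrite (Rmax_right 0 (1 - x / n)) by lra.
    set (phi := Rmax 0 (1 - y / n)).
    assert (Hp1 : 1 - x / n - phi <= (y - x) / n) by (unfold phi, Rmax; destruct Rle_dec; lra).
    assert (Hp2 : 0 <= 1 - x / n - phi) by (unfold phi, Rmax; destruct Rle_dec; lra).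
    assert (Hp3 : 0 <= phi <= 1) by (unfold phi, Rmax; destruct Rle_dec; lra).
    replace (A * (1 - x / n) - B * phi) with (A * (1 - x / n - phi) - (B - A) * phi) by ring.
    assert (A * (1 - x / n - phi) <= P * (y - x)).
    { apply Rle_trans with (A * ((y - x) / n)); [apply Rmult_le_compat_l; lra|].
      rewrite Ex. replace (Q * x * ((y - x) / n)) with (Q * (y - x) * (x / n)) by (field; lra).
      apply Rle_trans with (Q * (y - x) * 1); [apply Rmult_le_compat_l; [|lra]|]; nra. }
    assert (0 <= A * (1 - x / n - phi)) by (apply Rmult_le_pos; lra).
    assert (0 <= (B - A) * phi <= s * P * (y - x)).
    { split; [apply Rmult_le_pos; lra|]. apply Rle_trans with ((B - A) * 1); [|lra].
      apply Rmult_le_compat_l; lra. }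
    assert (0 <= P * (y - x)) by (apply Rmult_le_pos; lra).
    apply Rabs_le. nra.
Qed.

Lemma kpow_outside_cube k N : ~ In k (cube N) -> INR N + 1 <= kpow k 1.
Proof.
  intros H. assert (exists a, INR N + 1 <= Rabs (kc k a)) as [a Ha].
  { destruct k as [[a b] c]. rewrite in_cube in H.
    assert (HZ : forall z, ~ (Z.abs z <= Z.of_nat N)%Z -> INR N + 1 <= Rabs (IZR z)).
    { intros z Hz. rewrite <- abs_IZR, INR_IZR_INZ, <- plus_IZR. apply IZR_le. lia. }
    destruct (Z_le_dec (Z.abs a) (Z.of_nat N)); [|exists A1; now apply HZ].
    destruct (Z_le_dec (Z.abs b) (Z.of_nat N)); [|exists A2; now apply HZ].
    exists A3. apply HZ. tauto. }
  assert (Hk := kc_le k a). lra.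
Qed.

(* The weight [|k|^s] with a compactly supported cutoff at scale [N] whose
   Lipschitz constant does not depend on [N]. *)
Definition cutoff (s : R) (N : nat) (k : Z3) : R :=
  kpow k s * Rmax 0 (1 - kpow k 1 / (INR N + 1)).

Lemma cutoff_ge0 s N k : 0 <= cutoff s N k.
Proof. apply Rmult_le_pos; [apply kpow_ge0|apply Rmax_l]. Qed.

Lemma cutoff_le s N k : cutoff s N k <= kpow k s.
Proof.
  unfold cutoff. rewrite <- (Rmult_1_r (kpow k s)) at 2.
  apply Rmult_le_compat_l; [apply kpow_ge0|].
  assert (0 <= kpow k 1 / (INR N + 1)).
  { apply Rdiv_le_0_compat; [apply kpow_ge0|]. assert (H := pos_INR N). lra. }
  apply Rmax_lub; lra.
Qed.

(** The scale N + 1 of the cutoff is the least modulus outside the cube, where some integer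
    coordinate is at least N + 1 in absolute value. *)
Lemma cutoff_support s N k : ~ In k (cube N) -> cutoff s N k = 0.
Proof.
  intros H. apply kpow_outside_cube in H. assert (HN := pos_INR N).
  unfold cutoff. rewrite Rmax_left; [ring|].
  assert (1 <= kpow k 1 / (INR N + 1)) by (apply Rle_div_r; lra). lra.
Qed.
(** The mean value bound yields a factor |k - l| and the power s - 1 of the larger modulus, which is
    then distributed over k - l and l. The derivative saved on l falls on k - l, the frequency of
    the velocity in the commutator. *)
Lemma cutoff_diff s N k l : 1 <= s -> k <> z0 -> l <> z0 ->
  Rabs (cutoff s N k - cutoff s N l)
  <= (s + 1) * Rpower 2 (s - 1) * (kpow (zsub k l) s + kpow (zsub k l) 1 * kpow l (s - 1)).
Proof.
  intros Hs.
  (* The ordered case |k| <= |l|; the other one follows by exchanging k and l. *)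
  assert (Hw : forall k l, k <> z0 -> l <> z0 -> kpow k 1 <= kpow l 1 ->
    Rabs (cutoff s N k - cutoff s N l) <= (s + 1) * kpow l (s - 1) * kpow (zsub k l) 1).
  { clear k l. intros k l Hk Hl H. unfold cutoff.
    rewrite (kpow_Rpower k s), (kpow_Rpower l s), (kpow_Rpower l (s - 1)); auto.
    eapply Rle_trans; [apply cutoff_lipschitz; auto|].
    - split; auto using kpow_pos.
    - assert (HN := pos_INR N). lra.
    - apply Rmult_le_compat_l.
      + apply Rmult_le_pos; [lra|left; apply exp_pos].
      + assert (Ht := kpow_triangle l k). rewrite kpow_zsub_sym in Ht. lra. }
  intros Hk Hl.
  assert (H : Rabs (cutoff s N k - cutoff s N l) <=
    (s + 1) * (Rpower 2 (s - 1) * (kpow (zsub k l) (s - 1) + kpow l (s - 1))) * kpow (zsub k l) 1).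
  { assert (Hz := kpow_ge0 (zsub k l) 1).
    destruct (Rle_dec (kpow k 1) (kpow l 1)) as [H|H].
    - eapply Rle_trans; [apply Hw; auto|]. apply Rmult_le_compat_r; auto.
      apply Rmult_le_compat_l; [lra|].
      assert (1 <= Rpower 2 (s - 1)).
      { apply Rle_trans with (Rpower 2 0); [rewrite Rpower_O; lra|]. apply Rle_Rpower; lra. }
      assert (H1 := kpow_ge0 (zsub k l) (s - 1)). assert (H2 := kpow_ge0 l (s - 1)).
      apply Rle_trans with (1 * (kpow (zsub k l) (s - 1) + kpow l (s - 1))); [lra|].
      apply Rmult_le_compat_r; lra.
    - rewrite Rabs_minus_sym. eapply Rle_trans; [apply Hw; auto; lra|].
      rewrite (kpow_zsub_sym l k). apply Rmult_le_compat_r; auto.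
      apply Rmult_le_compat_l; [lra|]. apply kpow_quasi_triangle. lra. }
  eapply Rle_trans; [apply H|].
  replace (kpow (zsub k l) s) with (kpow (zsub k l) (s - 1) * kpow (zsub k l) 1).
  { right. ring. }
  rewrite <- kpow_plus. f_equal. ring.
Qed.

(** * Convergence of the sum of |k|^(-2q) over the lattice for q > 3/2 *)

Lemma p_series_bound p N : 1 < p ->
  fsum (seq 0 (S N)) (fun n => Rpower (1 + INR n) (- p)) <= 1 + 1 / (p - 1).
Proof.
  intros Hp.
  (* Comparison with the integral of x^(-p). The induction passes for the sharper bound, from which
     the remaining tail of the integral is subtracted. *)
  enough (fsum (seq 0 (S N)) (fun n => Rpower (1 + INR n) (- p))
    <= 1 + 1 / (p - 1) * (1 - Rpower (1 + INR N) (1 - p))).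
  { assert (0 < Rpower (1 + INR N) (1 - p)) by apply exp_pos.
    assert (0 < 1 / (p - 1)) by (apply Rdiv_lt_0_compat; lra).
    eapply Rle_trans; [eassumption|].
    set (c := 1 / (p - 1)) in *. set (X := Rpower _ _) in *.
    assert (0 <= c * X) by (apply Rmult_le_pos; lra). lra. }
  induction N as [|N IH].
  - simpl. rewrite !Rplus_0_r. unfold Rpower. rewrite ln_1, !Rmult_0_r, exp_0. lra.
  - rewrite (seq_S (S N)), fsum_app.
    assert (HN := pos_INR N).
    destruct (MVT_cor2 (fun x => Rpower x (1 - p)) (fun x => (1 - p) * Rpower x (1 - p - 1))
      (1 + INR N) (1 + INR (S N))) as (c & E & Hc).
    + rewrite S_INR. lra.
    + intros c Hc. apply derivable_pt_lim_power. lra.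
    + rewrite S_INR in *. replace (1 + (INR N + 1) - (1 + INR N)) with 1 in E by ring.
      replace (1 - p - 1) with (- p) in E by ring.
      assert (Rpower (1 + (INR N + 1)) (- p) <= Rpower c (- p)).
      { rewrite !Rpower_Ropp. apply Rinv_le_contravar; [apply exp_pos|].
        apply Rle_Rpower_l; lra. }
      replace (fsum [0 + S N]%nat (fun n => Rpower (1 + INR n) (- p)))
        with (Rpower (1 + (INR N + 1)) (- p))
        by (cbn [fsum fold_right]; rewrite Nat.add_0_l, S_INR; ring).
      assert (Ec : Rpower c (- p) = 1 / (p - 1) * (Rpower (1 + INR N) (1 - p) - Rpower (1 + (INR N + 1)) (1 - p))).
      { apply Rmult_eq_reg_l with (p - 1); [|lra]. field_simplify; lra. }
      lra.
Qed.

Lemma interval_series_bound p N : 1 < p ->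
  fsum (interval N) (fun z => Rpower (1 + Rabs (IZR z)) (- p)) <= 2 * (1 + 1 / (p - 1)).
Proof.
  intros Hp.
  apply Rle_trans with (fsum (map Z.of_nat (seq 0 (S N)) ++ map (fun n => (- Z.of_nat n)%Z) (seq 0 (S N)))
    (fun z => Rpower (1 + Rabs (IZR z)) (- p))).
  - apply fsum_incl; [apply interval_NoDup| |intros; left; apply exp_pos].
    intros z Hz. apply in_interval in Hz. apply in_app_iff.
    destruct (Z_le_dec 0 z); [left|right]; apply in_map_iff; exists (Z.abs_nat z);
      rewrite in_seq; lia.
  - rewrite fsum_app, !fsum_map.
    assert (H := p_series_bound p N Hp).
    rewrite (fsum_ext _ _ (fun n => Rpower (1 + INR n) (- p))).
    2: { intros n _. now rewrite <- INR_IZR_INZ, Rabs_pos_eq by apply pos_INR. }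
    rewrite (fsum_ext _ (fun x => Rpower (1 + Rabs (IZR (- Z.of_nat x))) (- p)) (fun n => Rpower (1 + INR n) (- p))).
    2: { intros n _. now rewrite opp_IZR, Rabs_Ropp, <- INR_IZR_INZ, Rabs_pos_eq by apply pos_INR. }
    lra.
Qed.

(** From |k| >= 1 and |k| >= |k_a| follows 1 + |k_a| <= 2 |k|. Each of the three factors |k|^(-p) is
    spent on one coordinate, so that the lattice sum splits into one-dimensional series. *)
Lemma kpow_neg_le k p : 0 <= p ->
  kpow k (- (3 * p)) <= Rpower 2 p ^ 3 *
    (Rpower (1 + Rabs (kc k A1)) (- p) * Rpower (1 + Rabs (kc k A2)) (- p)
     * Rpower (1 + Rabs (kc k A3)) (- p)).
Proof.
  intros Hp.
  destruct (Z3_eq_dec k z0) as [->|H].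
  { rewrite kpow_z0. apply Rmult_le_pos; [apply pow_le; left; apply exp_pos|].
    repeat apply Rmult_le_pos; left; apply exp_pos. }
  assert (Ha : forall a, Rpower (kpow k 1) (- p) <= Rpower 2 p * Rpower (1 + Rabs (kc k a)) (- p)).
  { intros a. assert (H1 := kpow_ge1 k 1 H ltac:(lra)). assert (H2 := kc_le k a).
    assert (H3 := Rabs_pos (kc k a)).
    rewrite !Rpower_Ropp.
    assert (Hx : Rpower (1 + Rabs (kc k a)) p <= Rpower 2 p * Rpower (kpow k 1) p).
    { rewrite Rpower_mult_distr by lra. apply Rle_Rpower_l; lra. }
    assert (0 < Rpower (1 + Rabs (kc k a)) p) by apply exp_pos.
    assert (0 < Rpower (kpow k 1) p) by apply exp_pos.
    apply (Rmult_le_reg_r (Rpower (1 + Rabs (kc k a)) p * Rpower (kpow k 1) p)); [nra|].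
    field_simplify; lra. }
  replace (kpow k (- (3 * p))) with (Rpower (kpow k 1) (- p) * Rpower (kpow k 1) (- p) * Rpower (kpow k 1) (- p)).
  - replace (Rpower 2 p ^ 3 * _) with ((Rpower 2 p * Rpower (1 + Rabs (kc k A1)) (- p)) *
      (Rpower 2 p * Rpower (1 + Rabs (kc k A2)) (- p)) * (Rpower 2 p * Rpower (1 + Rabs (kc k A3)) (- p))) by ring.
    assert (0 < Rpower (kpow k 1) (- p)) by apply exp_pos.
    apply Rmult_le_compat; auto; [nra|lra|]. apply Rmult_le_compat; auto; lra.
  - rewrite <- !kpow_Rpower, <- !kpow_plus by auto. f_equal. ring.
Qed.

Lemma fsum_prod_mult {A B} (L : list A) (L' : list B) f g :
  fsum (list_prod L L') (fun p => f (fst p) * g (snd p)) = fsum L f * fsum L' g.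
Proof.
  rewrite fsum_prod. simpl. rewrite Rmult_comm, <- fsum_scal.
  apply fsum_ext. intros x _. rewrite fsum_scal. ring.
Qed.

Lemma lattice_series q : 3 / 2 < q ->
  exists S, 0 <= S /\ summable_le (fun k => kpow k (- (2 * q))) S.
Proof.
  (* Each coordinate receives a third of the exponent 2q, and p > 1 is exactly q > 3/2. *)
  intros Hq. set (p := 2 * q / 3). assert (Hp : 1 < p) by (unfold p; lra).
  set (b := 2 * (1 + 1 / (p - 1))).
  assert (Hb : 0 <= b).
  { unfold b. assert (0 < 1 / (p - 1)) by (apply Rdiv_lt_0_compat; lra). lra. }
  assert (Hc : 0 <= Rpower 2 p ^ 3) by (apply pow_le; left; apply exp_pos).
  exists (Rpower 2 p ^ 3 * b ^ 3). split.
  { apply Rmult_le_pos; auto. now apply pow_le. }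
  intros L HL. destruct (incl_cube L) as [N HN].
  eapply Rle_trans; [apply (fsum_incl _ (cube N)); auto; intros; apply kpow_ge0|].
  replace (2 * q) with (3 * p) by (unfold p; field).
  eapply Rle_trans; [apply fsum_le; intros k _; apply kpow_neg_le; lra|].
  rewrite fsum_scal. apply Rmult_le_compat_l; auto.
  set (g := fun z => Rpower (1 + Rabs (IZR z)) (- p)).
  assert (Hg : 0 <= fsum (interval N) g) by (apply fsum_ge0; intros; left; apply exp_pos).
  assert (Hgb : fsum (interval N) g <= b) by (apply interval_series_bound; auto).
  apply Rle_trans with (fsum (interval N) g ^ 3); [right|apply pow_incr; lra].
  replace (fsum (interval N) g ^ 3)
    with (fsum (interval N) g * fsum (interval N) g * fsum (interval N) g) by ring.
  rewrite <- !fsum_prod_mult. apply fsum_ext. intros [[x y] z] _. reflexivity.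
Qed.

(** * Young's inequality and trilinear bounds *)

(** An upper bound for the H^p norm of a nonnegative sequence, here the moduli of Fourier
    coefficients. A bound, unlike the norm as a limit, presupposes no convergence and can be uniform
    in time; [0 <= B] allows it to be recovered from its square. *)
Definition sobolev_le (p : R) (f : Z3 -> R) (B : R) : Prop :=
  0 <= B /\ summable_le (fun k => (kpow k p * f k) ^ 2) (B ^ 2).

Lemma sobolev_le_ext p f g B :
  (forall k, f k = g k) -> sobolev_le p f B -> sobolev_le p g B.
Proof.
  intros E [HB H]. split; auto. intros L HL.
  rewrite (fsum_ext _ _ (fun k => (kpow k p * f k) ^ 2)); [now apply H|].
  intros k _. now rewrite E.
Qed.

Lemma sobolev_le_mono p q f g B :
  p <= q -> (forall k, 0 <= f k <= g k) -> sobolev_le q g B -> sobolev_le p f B.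
Proof.
  intros Hpq Hf [HB H]. split; auto. intros L HL.
  eapply Rle_trans; [|now apply (H L)]. apply fsum_le. intros k _.
  apply pow_incr. split; [apply Rmult_le_pos; [apply kpow_ge0|apply Hf]|].
  apply Rmult_le_compat; try apply Hf; auto using kpow_ge0, kpow_le.
Qed.

Lemma sobolev_le_weaken p f A B : A <= B -> sobolev_le p f A -> sobolev_le p f B.
Proof.
  intros HAB [HA H]. split; [lra|]. intros L HL. specialize (H L HL).
  assert (A ^ 2 <= B ^ 2) by (apply pow_incr; lra). lra.
Qed.

Lemma sobolev_le_add p f g h A B :
  (forall k, 0 <= h k <= f k + g k) ->
  sobolev_le p f A -> sobolev_le p g B -> sobolev_le p h (A + B).
Proof.
  intros Hh [HA Hf] [HB Hg]. split; [lra|]. intros L HL.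
  specialize (Hf L HL). specialize (Hg L HL).
  set (x := fun k => kpow k p * f k). set (y := fun k => kpow k p * g k).
  change (fsum L (fun k => x k ^ 2) <= A ^ 2) in Hf.
  change (fsum L (fun k => y k ^ 2) <= B ^ 2) in Hg.
  apply Rle_trans with (fsum L (fun k => x k ^ 2 + (2 * (1 * x k * y k) + y k ^ 2))).
  - apply fsum_le. intros k _.
    replace (x k ^ 2 + _) with ((kpow k p * (f k + g k)) ^ 2) by (unfold x, y; ring).
    assert (H0 := kpow_ge0 k p). destruct (Hh k).
    apply pow_incr. split; [apply Rmult_le_pos; auto|]. now apply Rmult_le_compat_l.
  - rewrite !fsum_plus, fsum_scal.
    assert (fsum L (fun k => 1 * x k * y k) <= 1 * A * B); [|lra].
    apply (fsum_cauchy_schwarz_le L (fun _ => 1)); intros; rewrite ?fsum_scal; lra.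
Qed.

Lemma sobolev_le_point p f B k : sobolev_le p f B -> kpow k p * f k <= B.
Proof.
  intros [HB H]. assert (Hk : (kpow k p * f k) ^ 2 <= B ^ 2).
  { replace (_ ^ 2) with (fsum [k] (fun k => (kpow k p * f k) ^ 2)) by (simpl; ring).
    apply H. repeat constructor. easy. }
  apply Rsqr_incr_0_var; auto. rewrite !Rsqr_pow2. exact Hk.
Qed.

Lemma summable_shift_l (a : Z3 -> R) A l L :
  summable_le a A -> NoDup L -> fsum L (fun k => a (zsub k l)) <= A.
Proof.
  intros H HL. rewrite <- (fsum_map (fun k => zsub k l)). apply H.
  apply Injective_map_NoDup; auto. intros x y. apply zsub_inj_l.
Qed.

Lemma summable_shift_r (a : Z3 -> R) A k L :
  summable_le a A -> NoDup L -> fsum L (fun l => a (zsub k l)) <= A.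
Proof.
  intros H HL. rewrite <- (fsum_map (fun l => zsub k l)). apply H.
  apply Injective_map_NoDup; auto. intros x y. apply zsub_inj_r.
Qed.

Section Young.
Variables (K L : list Z3) (a b c : Z3 -> R) (A B C : R).
Hypotheses (HK : NoDup K) (HL : NoDup L) (Ha : forall k, 0 <= a k).
Hypotheses (HA : summable_le a A) (HA0 : 0 <= A) (HB0 : 0 <= B) (HC0 : 0 <= C).
Hypotheses (HB : summable_le (fun k => b k ^ 2) (B ^ 2)).
Hypotheses (HC : fsum K (fun k => c k ^ 2) <= C ^ 2).

(** Cauchy-Schwarz over the pairs (k, l) with weight a(k - l). In each of the two sums the variable
    missing from [b] or [c] is summed first, and translation bounds that sum of [a] by [A]. *)
Lemma young_difference :
  fsum K (fun k => fsum L (fun l => a (zsub k l) * b l * c k)) <= A * B * C.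
Proof.
  apply Rle_trans with (fsum (list_prod K L) (fun p => a (zsub (fst p) (snd p)) * b (snd p) * c (fst p)));
    [rewrite fsum_prod; right; reflexivity|].
  apply (fsum_cauchy_schwarz_le _ (fun p => a (zsub (fst p) (snd p)))
    (fun p => b (snd p)) (fun p => c (fst p))); auto; rewrite fsum_prod; simpl fst; simpl snd.
  - rewrite fsum_swap. eapply Rle_trans; [apply fsum_le|].
    + intros l _. rewrite (fsum_ext _ _ (fun k => b l ^ 2 * a (zsub k l))) by (intros; ring).
      rewrite fsum_scal. apply Rmult_le_compat_l; [apply pow2_ge_0|].
      now apply (summable_shift_l _ A).
    + rewrite (fsum_ext _ _ (fun l => A * b l ^ 2)) by (intros; ring).
      rewrite fsum_scal. apply Rmult_le_compat_l; auto.
  - eapply Rle_trans; [apply fsum_le|].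
    + intros k _. rewrite (fsum_ext _ _ (fun l => c k ^ 2 * a (zsub k l))) by (intros; ring).
      rewrite fsum_scal. apply Rmult_le_compat_l; [apply pow2_ge_0|].
      now apply (summable_shift_r _ A).
    + rewrite (fsum_ext _ _ (fun l => A * c l ^ 2)) by (intros; ring).
      rewrite fsum_scal. apply Rmult_le_compat_l; auto.
Qed.

(** Here the l^1 sequence sits on the input frequency. It is proved separately because the
    substitution of k - l for l does not preserve the finite set [L]. *)
Lemma young_input :
  fsum K (fun k => fsum L (fun l => a l * b (zsub k l) * c k)) <= A * B * C.
Proof.
  apply Rle_trans with (fsum (list_prod K L) (fun p => a (snd p) * b (zsub (fst p) (snd p)) * c (fst p)));
    [rewrite fsum_prod; right; reflexivity|].
  apply (fsum_cauchy_schwarz_le _ (fun p => a (snd p))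
    (fun p => b (zsub (fst p) (snd p))) (fun p => c (fst p))); auto; rewrite fsum_prod; simpl fst; simpl snd.
  - rewrite fsum_swap. eapply Rle_trans; [apply fsum_le|].
    + intros l _. rewrite fsum_scal. apply Rmult_le_compat_l; [auto|].
      apply (summable_shift_l (fun k => b k ^ 2) (B ^ 2)); auto.
    + rewrite (fsum_ext _ _ (fun l => B ^ 2 * a l)) by (intros; ring).
      rewrite fsum_scal, Rmult_comm. apply Rmult_le_compat_r; [apply pow2_ge_0|auto].
  - eapply Rle_trans; [apply fsum_le|].
    + intros k _. rewrite (fsum_ext _ _ (fun l => c k ^ 2 * a l)) by (intros; ring).
      rewrite fsum_scal. apply Rmult_le_compat_l; [apply pow2_ge_0|].
      now apply HA.
    + rewrite (fsum_ext _ _ (fun l => A * c l ^ 2)) by (intros; ring).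
      rewrite fsum_scal. apply Rmult_le_compat_l; auto.
Qed.
End Young.

Section Trilinear.
Variables (q0 S : R).
Hypotheses (HS0 : 0 <= S) (HS : summable_le (fun k => kpow k (- (2 * q0))) S).

(** Cauchy-Schwarz against |k|^(-q0), whose squares sum to at most [S]: a surplus of [q0]
    derivatives buys absolute summability. *)
Lemma sobolev_l1 p q f B : (forall k, 0 <= f k) -> p + q0 <= q ->
  sobolev_le q f B -> summable_le (fun k => kpow k p * f k) (sqrt S * B).
Proof.
  intros Hf Hpq H L HL.
  apply (sobolev_le_mono (p + q0) q f f) in H; auto; [|intros; split; auto; lra].
  destruct H as [HB H].
  rewrite (fsum_ext _ _ (fun k => 1 * kpow k (- q0) * (kpow k (p + q0) * f k))).
  2: { intros k _. replace p with (- q0 + (p + q0)) at 1 by ring. rewrite kpow_plus. ring. }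
  replace (sqrt S * B) with (1 * sqrt S * B) by ring.
  apply fsum_cauchy_schwarz_le; auto; try (intros; lra).
  - apply sqrt_pos.
  - rewrite fsum_scal. rewrite <- Rsqr_pow2, Rsqr_sqrt, !Rmult_1_l by auto.
    rewrite (fsum_ext _ _ (fun k => kpow k (- (2 * q0)))); [apply (HS L HL)|].
    intros k _. rewrite <- kpow_double. f_equal. ring.
  - rewrite fsum_scal, !Rmult_1_l. apply (H L HL).
Qed.

Section Forms.
Variables (K L : list Z3) (f g h : Z3 -> R) (H : R).
Hypotheses (HK : NoDup K) (HL : NoDup L).
Hypotheses (Hf : forall k, 0 <= f k) (Hg : forall k, 0 <= g k) (Hh : forall k, 0 <= h k).
Hypotheses (HH0 : 0 <= H) (HH : fsum K (fun k => h k ^ 2) <= H ^ 2).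

Lemma trilinear_l1_l2 p q q' F G :
  q + q0 <= q' -> sobolev_le q' f F -> sobolev_le p g G ->
  fsum K (fun k => fsum L (fun l =>
    (kpow (zsub k l) q * f (zsub k l)) * (kpow l p * g l) * h k)) <= sqrt S * F * G * H.
Proof.
  intros Hq HF [HG0 HG]. assert (HF0 := proj1 HF).
  apply (young_difference K L (fun k => kpow k q * f k) (fun l => kpow l p * g l) h); auto.
  - intros. apply Rmult_le_pos; auto using kpow_ge0.
  - eapply sobolev_l1; eauto.
  - apply Rmult_le_pos; auto. apply sqrt_pos.
Qed.

Lemma trilinear_l2_l1 p q q' F G :
  q + q0 <= q' -> sobolev_le p f F -> sobolev_le q' g G ->
  fsum K (fun k => fsum L (fun l =>
    (kpow (zsub k l) p * f (zsub k l)) * (kpow l q * g l) * h k)) <= sqrt S * F * G * H.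
Proof.
  intros Hq [HF0 HF] HG. assert (HG0 := proj1 HG).
  replace (sqrt S * F * G * H) with ((sqrt S * G) * F * H) by ring.
  rewrite (fsum_ext _ _ (fun k => fsum L (fun l =>
    (kpow l q * g l) * (kpow (zsub k l) p * f (zsub k l)) * h k)))
    by (intros; apply fsum_ext; intros; ring).
  apply (young_input K L (fun k => kpow k q * g k) (fun l => kpow l p * f l) h); auto.
  - intros. apply Rmult_le_pos; auto using kpow_ge0.
  - eapply sobolev_l1; eauto.
  - apply Rmult_le_pos; auto. apply sqrt_pos.
Qed.

(** Weights are compared only at nonzero frequencies, because [kpow] has its default value at 0; the
    terms with k - l = 0 or l = 0 vanish through [f] and [g]. *)
Lemma trilinear_dominated (w t1 t2 : Z3 -> Z3 -> R) c X1 X2 : 0 <= c ->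
  f z0 = 0 -> g z0 = 0 ->
  (forall k l, zsub k l <> z0 -> l <> z0 -> w k l <= c * (t1 k l + t2 k l)) ->
  fsum K (fun k => fsum L (fun l => t1 k l * (f (zsub k l) * g l) * h k)) <= X1 ->
  fsum K (fun k => fsum L (fun l => t2 k l * (f (zsub k l) * g l) * h k)) <= X2 ->
  fsum K (fun k => fsum L (fun l => w k l * (f (zsub k l) * g l) * h k)) <= c * (X1 + X2).
Proof.
  intros Hc Hf0 Hg0 Hw H1 H2.
  apply Rle_trans with (fsum K (fun k => fsum L (fun l =>
    c * (t1 k l * (f (zsub k l) * g l) * h k + t2 k l * (f (zsub k l) * g l) * h k)))).
  - apply fsum_le. intros k _. apply fsum_le. intros l _.
    destruct (Z3_eq_dec (zsub k l) z0) as [E|E]; [rewrite E, Hf0; lra|].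
    destruct (Z3_eq_dec l z0) as [->|E']; [rewrite Hg0; lra|].
    replace (c * _) with (c * (t1 k l + t2 k l) * (f (zsub k l) * g l) * h k) by ring.
    apply Rmult_le_compat_r; auto. apply Rmult_le_compat_r; auto.
    apply Rmult_le_pos; auto.
  - rewrite (fsum_ext _ _ (fun k => c * (fsum L (fun l => t1 k l * (f (zsub k l) * g l) * h k)
      + fsum L (fun l => t2 k l * (f (zsub k l) * g l) * h k))))
      by (intros; now rewrite fsum_scal, fsum_plus).
    rewrite fsum_scal, fsum_plus. apply Rmult_le_compat_l; lra.
Qed.

(** For B(u1 - u2, v1): [f] is the difference and [g] is [v1]. Where [g] carries the weight, [f] is
    the l^1 factor; where [f] carries it, the gradient of [g] is, which needs 1 + q0 = be + 2
    derivatives of [v1]. *)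
Lemma transport_bound_high_low s F G G' p' :
  0 <= s -> q0 <= s -> f z0 = 0 -> g z0 = 0 ->
  sobolev_le s f F -> sobolev_le (s + 1) g G -> 1 + q0 <= p' ->
  sobolev_le p' g G' ->
  fsum K (fun k => fsum L (fun l => (kpow k s * kpow l 1) * (f (zsub k l) * g l) * h k))
  <= Rpower 2 s * (sqrt S * F * G * H + sqrt S * F * G' * H).
Proof.
  intros Hs Hqs Hf0 Hg0 HF HG Hp' HG'.
  apply trilinear_dominated with
    (t1 := fun k l => kpow (zsub k l) 0 * kpow l (s + 1))
    (t2 := fun k l => kpow (zsub k l) s * kpow l 1); auto.
  - left; apply exp_pos.
  - intros k l E E'. rewrite kpow_0 by auto.
    rewrite kpow_plus. assert (Hl := kpow_ge0 l 1).
    apply Rle_trans with ((Rpower 2 s * (kpow (zsub k l) s + kpow l s)) * kpow l 1).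
    + apply Rmult_le_compat_r; auto. now apply kpow_quasi_triangle.
    + lra.
  - eapply Rle_trans; [right|apply (trilinear_l1_l2 (s + 1) 0 s F G); auto; lra].
    apply fsum_ext; intros; apply fsum_ext; intros; ring.
  - eapply Rle_trans; [right|apply (trilinear_l2_l1 s 1 p' F G'); auto; lra].
    apply fsum_ext; intros; apply fsum_ext; intros; ring.
Qed.

(** For B(u2, w): the velocity is smooth enough to be the l^1 factor in both pieces, so [g] needs
    only its l^2 norms, at most p + 1 derivatives. In the application p = r - 1 - be, the other [be]
    derivatives being left on [h]. *)
Lemma transport_bound_smooth_velocity p r F G G' :
  0 <= p -> p + q0 <= r -> f z0 = 0 -> g z0 = 0 ->
  sobolev_le r f F -> sobolev_le (p + 1) g G -> sobolev_le 1 g G' ->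
  fsum K (fun k => fsum L (fun l => (kpow k p * kpow l 1) * (f (zsub k l) * g l) * h k))
  <= Rpower 2 p * (sqrt S * F * G * H + sqrt S * F * G' * H).
Proof.
  intros Hp Hr Hf0 Hg0 HF HG HG'.
  apply trilinear_dominated with
    (t1 := fun k l => kpow (zsub k l) 0 * kpow l (p + 1))
    (t2 := fun k l => kpow (zsub k l) p * kpow l 1); auto.
  - left; apply exp_pos.
  - intros k l E E'. rewrite kpow_0 by auto.
    rewrite kpow_plus. assert (Hl := kpow_ge0 l 1).
    apply Rle_trans with ((Rpower 2 p * (kpow (zsub k l) p + kpow l p)) * kpow l 1).
    + apply Rmult_le_compat_r; auto. now apply kpow_quasi_triangle.
    + lra.
  - eapply Rle_trans; [right|apply (trilinear_l1_l2 (p + 1) 0 r F G); auto; lra].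
    apply fsum_ext; intros; apply fsum_ext; intros; ring.
  - eapply Rle_trans; [right|apply (trilinear_l1_l2 1 p r F G'); auto; lra].
    apply fsum_ext; intros; apply fsum_ext; intros; ring.
Qed.

(** For (u1 - u2) . grad th1. With the plain splitting |k - l|^sg |l| the gradient of th1 in l^1
    would need r >= 2 be + 2. Letting the velocity absorb [be] more derivatives lowers the demand to
    1 - be + q0 = 2 <= r - be, which r > be + 2 grants. *)
Lemma transport_bound_rough_scalar sg be F G :
  0 <= sg -> 0 <= be -> 1 - be + q0 <= sg + 1 -> q0 <= sg + be -> f z0 = 0 -> g z0 = 0 ->
  sobolev_le (sg + be) f F -> sobolev_le (sg + 1) g G ->
  fsum K (fun k => fsum L (fun l => (kpow k sg * kpow l 1) * (f (zsub k l) * g l) * h k))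
  <= Rpower 2 sg * (sqrt S * F * G * H + sqrt S * F * G * H).
Proof.
  intros Hs Hb Hq Hq' Hf0 Hg0 HF HG.
  apply trilinear_dominated with
    (t1 := fun k l => kpow (zsub k l) 0 * kpow l (sg + 1))
    (t2 := fun k l => kpow (zsub k l) (sg + be) * kpow l (1 - be)); auto.
  - left; apply exp_pos.
  - intros k l E E'. rewrite kpow_0, Rmult_1_l by auto. now apply kpow_product_split.
  - eapply Rle_trans; [right|apply (trilinear_l1_l2 (sg + 1) 0 (sg + be) F G); auto; lra].
    apply fsum_ext; intros; apply fsum_ext; intros; ring.
  - eapply Rle_trans; [right|apply (trilinear_l2_l1 (sg + be) (1 - be) (sg + 1) F G); auto; lra].
    apply fsum_ext; intros; apply fsum_ext; intros; ring.
Qed.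

(** After [cutoff_diff] at most [sg] derivatives fall on [g], the regularity it has. The velocity is
    the l^1 factor in both pieces, and no constant depends on [N]. *)
Lemma commutator_bound sg r N F G G' :
  1 <= sg -> sg + q0 <= r -> h z0 = 0 -> f z0 = 0 -> g z0 = 0 ->
  sobolev_le r f F -> sobolev_le sg g G -> sobolev_le 1 g G' ->
  fsum K (fun k => fsum L (fun l =>
    (Rabs (cutoff sg N k - cutoff sg N l) * kpow l 1) * (f (zsub k l) * g l) * h k))
  <= (sg + 1) * Rpower 2 (sg - 1) * (sqrt S * F * G * H + sqrt S * F * G' * H).
Proof.
  intros Hs Hr Hh0 Hf0 Hg0 HF HG HG'.
  (* [cutoff_diff] requires k nonzero; at k = 0 the factor [h] vanishes, so the weight may be set to
     0 there. *)
  rewrite (fsum_ext _ _ (fun k => fsum L (fun l =>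
    ((if Z3_eq_dec k z0 then 0 else Rabs (cutoff sg N k - cutoff sg N l)) * kpow l 1)
      * (f (zsub k l) * g l) * h k))).
  2: { intros k _. apply fsum_ext. intros l _.
       destruct (Z3_eq_dec k z0) as [->|]; [rewrite Hh0; ring|ring]. }
  assert (Hc : 0 < Rpower 2 (sg - 1)) by apply exp_pos.
  apply trilinear_dominated with
    (w := fun k l => (if Z3_eq_dec k z0 then 0 else Rabs (cutoff sg N k - cutoff sg N l)) * kpow l 1)
    (t1 := fun k l => kpow (zsub k l) 1 * kpow l sg)
    (t2 := fun k l => kpow (zsub k l) sg * kpow l 1); auto.
  - apply Rmult_le_pos; lra.
  - intros k l E E'. assert (Hl := kpow_ge0 l 1). assert (Hl' := kpow_ge0 l sg).
    assert (Hkl := kpow_ge0 (zsub k l) 1). assert (Hkl' := kpow_ge0 (zsub k l) sg).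
    destruct (Z3_eq_dec k z0) as [->|E''].
    + rewrite Rmult_0_l. repeat apply Rmult_le_pos; try lra.
      apply Rplus_le_le_0_compat; apply Rmult_le_pos; auto.
    + apply Rle_trans with ((sg + 1) * Rpower 2 (sg - 1) *
        (kpow (zsub k l) sg + kpow (zsub k l) 1 * kpow l (sg - 1)) * kpow l 1).
      * apply Rmult_le_compat_r; auto. now apply cutoff_diff.
      * replace (kpow l sg) with (kpow l (sg - 1) * kpow l 1); [lra|].
        rewrite <- kpow_plus. f_equal. ring.
  - eapply Rle_trans; [right|apply (trilinear_l1_l2 sg 1 r F G); auto; lra].
    apply fsum_ext; intros; apply fsum_ext; intros; ring.
  - eapply Rle_trans; [right|apply (trilinear_l1_l2 1 sg r F G'); auto; lra].
    apply fsum_ext; intros; apply fsum_ext; intros; ring.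
Qed.
End Forms.
End Trilinear.

(** * Calculus on [[0, T]] *)

Definition cont_on (T : R) (f : R -> R) : Prop :=
  forall t, 0 <= t <= T -> forall eps, 0 < eps -> exists delta, 0 < delta /\
    forall t', 0 <= t' <= T -> Rabs (t' - t) < delta -> Rabs (f t' - f t) < eps.

(** Composition with this projection onto [0, T] extends a function continuously to the line, so
    that the endpoints become ordinary points. *)
Definition clamp (T t : R) : R := Rmax 0 (Rmin t T).

Lemma clamp_in T t : 0 <= T -> 0 <= clamp T t <= T.
Proof. intros HT. unfold clamp, Rmax, Rmin. repeat destruct Rle_dec; lra. Qed.

Lemma clamp_id T t : 0 <= t <= T -> clamp T t = t.
Proof. intros HT. unfold clamp, Rmax, Rmin. repeat destruct Rle_dec; lra. Qed.

Lemma clamp_lipschitz T s t : Rabs (clamp T s - clamp T t) <= Rabs (s - t).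
Proof.
  unfold clamp, Rmax, Rmin, Rabs.
  repeat destruct Rle_dec; repeat destruct Rcase_abs; lra.
Qed.

Lemma cont_on_clamp T f : 0 <= T -> cont_on T f ->
  forall t, continuous (fun s => f (clamp T s)) t.
Proof.
  intros HT Hf t. apply filterlim_locally. intros eps.
  destruct (Hf (clamp T t) (clamp_in T t HT) eps (cond_pos eps)) as (d & Hd & H).
  exists (mkposreal d Hd). intros s Hs.
  apply H; [now apply clamp_in|].
  eapply Rle_lt_trans; [apply clamp_lipschitz|]. exact Hs.
Qed.

Lemma cont_on_ext T f g : (forall t, 0 <= t <= T -> f t = g t) -> cont_on T f -> cont_on T g.
Proof.
  intros E Hf t Ht eps Heps. destruct (Hf t Ht eps Heps) as (d & Hd & H).
  exists d. split; auto. intros t' Ht' Hd'. rewrite <- !E; auto.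
Qed.

Lemma cont_on_bounded T f : 0 <= T -> cont_on T f ->
  exists B, forall t, 0 <= t <= T -> f t <= B.
Proof.
  intros HT Hf.
  destruct (continuity_ab_maj (fun s => f (clamp T s)) 0 T HT) as (m & Hm & _).
  { intros c _. apply continuity_pt_filterlim. now apply cont_on_clamp. }
  exists (f (clamp T m)). intros t Ht. specialize (Hm t Ht). simpl in Hm.
  now rewrite (clamp_id T t Ht) in Hm.
Qed.

Lemma cont_on_ex_RInt T f t : cont_on T f -> 0 <= t <= T -> ex_RInt f 0 t.
Proof.
  intros Hf Ht. apply ex_RInt_ext with (fun s => f (clamp T s)).
  - rewrite Rmin_left, Rmax_right by lra. intros s Hs. rewrite clamp_id; lra.
  - apply (ex_RInt_continuous (V := R_CompleteNormedModule)).
    intros s _. apply cont_on_clamp; auto. lra.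
Qed.

(* One-sided derivatives at the endpoints are avoided by asking for an
   extension of [x] that is differentiable at every point of [0,T]. *)
Definition deriv_on (T : R) (x g : R -> R) : Prop :=
  exists X, (forall t, 0 <= t <= T -> X t = x t) /\
            (forall t, 0 <= t <= T -> is_derive X t (g t)).

(** The required extension of [x] is the primitive of the clamped integrand, which is continuous on
    the whole line. *)
Lemma deriv_on_is_RInt T x g x0 : cont_on T g ->
  (forall t, 0 <= t <= T -> is_RInt g 0 t (x t - x0)) -> deriv_on T x g.
Proof.
  intros Hg Hx. set (gt := fun s => g (clamp T s)).
  exists (fun t => x0 + RInt gt 0 t). split.
  - intros t Ht. rewrite (RInt_ext gt g).
    + rewrite (is_RInt_unique _ _ _ _ (Hx t Ht)). ring.
    + rewrite Rmin_left, Rmax_right by lra. intros s Hs. unfold gt. rewrite clamp_id; lra.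
  - intros t Ht. replace (g t) with (plus 0 (gt t)).
    2: { unfold gt. rewrite clamp_id by auto. unfold plus; simpl. ring. }
    apply (is_derive_plus (fun _ => x0)); [apply (is_derive_const (V := R_NormedModule))|].
    assert (Hc := cont_on_clamp T g ltac:(lra) Hg).
    apply is_derive_RInt with 0; [|apply Hc].
    apply filter_forall. intros u. apply (RInt_correct (V := R_CompleteNormedModule)).
    apply (ex_RInt_continuous (V := R_CompleteNormedModule)). intros s _. apply Hc.
Qed.

Lemma deriv_on_RInt T f : cont_on T f -> deriv_on T (fun t => RInt f 0 t) f.
Proof.
  intros Hf. apply (deriv_on_is_RInt T _ f 0 Hf). intros t Ht.
  rewrite Rminus_0_r. apply (RInt_correct (V := R_CompleteNormedModule)).
  now apply (cont_on_ex_RInt T).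
Qed.

Lemma deriv_on_ext T x x' g g' :
  (forall t, 0 <= t <= T -> x t = x' t) -> (forall t, 0 <= t <= T -> g t = g' t) ->
  deriv_on T x g -> deriv_on T x' g'.
Proof.
  intros Ex Eg (X & HX & Hd). exists X. split.
  - intros t Ht. rewrite HX; auto.
  - intros t Ht. rewrite <- Eg; auto.
Qed.

Lemma deriv_on_of_is_derive T x g : (forall t, is_derive x t (g t)) -> deriv_on T x g.
Proof. intros H. exists x. auto. Qed.

Lemma deriv_on_plus T x y g h :
  deriv_on T x g -> deriv_on T y h -> deriv_on T (fun t => x t + y t) (fun t => g t + h t).
Proof.
  intros (X & HX & HX') (Y & HY & HY'). exists (fun t => X t + Y t). split.
  - intros t Ht. now rewrite HX, HY.
  - intros t Ht. apply (is_derive_plus X Y); auto.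
Qed.

Lemma deriv_on_mult T x y g h : deriv_on T x g -> deriv_on T y h ->
  deriv_on T (fun t => x t * y t) (fun t => g t * y t + x t * h t).
Proof.
  intros (X & HX & HX') (Y & HY & HY'). exists (fun t => X t * Y t). split.
  - intros t Ht. now rewrite HX, HY.
  - intros t Ht. rewrite <- HX, <- HY by auto. apply (is_derive_mult X Y); auto.
    intros; apply Rmult_comm.
Qed.

Lemma deriv_on_scal T c x g : deriv_on T x g -> deriv_on T (fun t => c * x t) (fun t => c * g t).
Proof.
  intros (X & HX & HX'). exists (fun t => c * X t). split.
  - intros t Ht. now rewrite HX.
  - intros t Ht. apply (is_derive_scal X); auto.
Qed.

Lemma deriv_on_minus T x y g h :
  deriv_on T x g -> deriv_on T y h -> deriv_on T (fun t => x t - y t) (fun t => g t - h t).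
Proof.
  intros Hx Hy. apply (deriv_on_scal T (-1)) in Hy.
  eapply deriv_on_ext; [| |apply (deriv_on_plus _ _ _ _ _ Hx Hy)]; intros; simpl; ring.
Qed.

Lemma deriv_on_fsum {A} T (L : list A) (x g : A -> R -> R) :
  (forall k, In k L -> deriv_on T (x k) (g k)) ->
  deriv_on T (fun t => fsum L (fun k => x k t)) (fun t => fsum L (fun k => g k t)).
Proof.
  induction L as [|k L IH]; intros H.
  - apply (deriv_on_of_is_derive T (fun _ => 0) (fun _ => 0)).
    intros t. apply (is_derive_const (V := R_NormedModule)).
  - apply (deriv_on_plus T (x k) (fun t => fsum L (fun k => x k t))).
    + apply H. now left.
    + apply IH. intros; apply H. now right.
Qed.

Lemma deriv_on_cont T x g : deriv_on T x g -> cont_on T x.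
Proof.
  intros (X & HX & Hd) t Ht eps Heps.
  assert (Hc : continuous X t) by (apply (ex_derive_continuous X); eexists; apply Hd; auto).
  destruct (proj1 (filterlim_locally _ _) Hc (mkposreal eps Heps)) as [d H].
  exists d. split; [apply cond_pos|]. intros t' Ht' Hd'.
  rewrite <- !HX by auto. apply (H t'). exact Hd'.
Qed.

Lemma deriv_on_nonpos T x g : deriv_on T x g -> (forall t, 0 <= t <= T -> g t <= 0) ->
  forall t, 0 <= t <= T -> x t <= x 0.
Proof.
  intros (X & HX & Hd) Hg t Ht. rewrite <- !HX by lra.
  destruct (MVT_gen X 0 t g) as (c & Hc & E).
  - rewrite Rmin_left, Rmax_right by lra. intros s Hs. apply Hd. lra.
  - rewrite Rmin_left, Rmax_right by lra. intros s Hs.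
    apply continuity_pt_filterlim. apply (ex_derive_continuous X). eexists. apply Hd. lra.
  - rewrite Rmin_left, Rmax_right in Hc by lra. specialize (Hg c ltac:(lra)). nra.
Qed.

(** The bound [B] and the value at t = 0 exclude an infinite supremum, which [real] would send to
    0. *)
Lemma sup_on_correct (T : R) (phi : R -> R) B : 0 <= T ->
  (forall t, 0 <= t <= T -> phi t <= B) ->
  let l := real (Lub_Rbar (fun x => exists t, 0 <= t <= T /\ x = phi t)) in
  (forall t, 0 <= t <= T -> phi t <= l) /\ l <= B.
Proof.
  intros HT HB. simpl. destruct (Lub_Rbar_correct (fun x => exists t, 0 <= t <= T /\ x = phi t)) as [H1 H2].
  set (l := Lub_Rbar _) in *.
  assert (HlB : Rbar_le l B). { apply H2. intros x (t & Ht & ->). now apply HB. }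
  assert (Hl : forall t, 0 <= t <= T -> Rbar_le (phi t) l).
  { intros t Ht. apply H1. now exists t. }
  assert (H0 := Hl 0 ltac:(lra)).
  destruct l as [l| |]; simpl in *; auto; contradiction.
Qed.

(* Picard iteration of the integral inequality [Y <= Y0 + K int Y], phrased with
   comparison functions so that [Y] need not be continuous. *)
Lemma gronwall_iterated (Y : R -> R) (Y0 K T B : R) :
  0 <= T -> 0 <= K -> 0 <= B -> 0 <= Y0 ->
  (forall t, 0 <= t <= T -> Y t <= B) ->
  (forall P p, (forall t, is_derive P t (K * p t)) -> Y0 <= P 0 ->
     (forall t, 0 <= t <= T -> Y t <= p t) -> forall t, 0 <= t <= T -> Y t <= P t) ->
  forall t, 0 <= t <= T -> Y t <= Y0 * exp (K * t).
Proof.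
  intros HT HK HB HY0 HYB Hstep t Ht.
  (* The comparison functions are the solution with the error term B (K t)^n / n!, and the
     derivative of the one of index n + 1 is K times the one of index n. The error tends to 0, so
     the size of [B] is immaterial. *)
  assert (Hn : forall n t, 0 <= t <= T ->
    Y t <= Y0 * exp (K * t) + B * ((K * t) ^ n / INR (fact n))).
  { clear t Ht. induction n as [|n IH].
    - intros t Ht. simpl. assert (0 < exp (K * t)) by apply exp_pos.
      specialize (HYB t Ht). assert (0 <= Y0 * exp (K * t)) by (apply Rmult_le_pos; lra). lra.
    - apply (Hstep (fun t => Y0 * exp (K * t) + B * ((K * t) ^ S n / INR (fact (S n))))
        (fun t => Y0 * exp (K * t) + B * ((K * t) ^ n / INR (fact n)))); auto.
      + intros t. auto_derive; auto.
        assert (Hf := INR_fact_neq_0 n). assert (HS : INR n + 1 <> 0) by (assert (H := pos_INR n); lra).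
        change (fact n + n * fact n)%nat with (fact (S n)).
        rewrite fact_simpl, mult_INR.
        change (match n with 0%nat => 1 | S _ => INR n + 1 end) with (INR (S n)).
        rewrite S_INR. simpl pred. field. auto.
      + rewrite Rmult_0_r, exp_0, pow_i by lia. unfold Rdiv. lra. }
  apply le_epsilon. intros eps Heps.
  destruct (cv_speed_pow_fact (K * t) (eps / (B + 1))) as [N HN].
  { apply Rdiv_lt_0_compat; lra. }
  specialize (HN N (le_n N)). specialize (Hn N t Ht).
  unfold R_dist in HN. rewrite Rminus_0_r in HN. apply Rabs_def2 in HN.
  assert (B * ((K * t) ^ N / INR (fact N)) <= eps); [|lra].
  apply Rle_trans with (B * (eps / (B + 1))); [apply Rmult_le_compat_l; lra|].
  apply Rle_trans with ((B + 1) * (eps / (B + 1))).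
  - apply Rmult_le_compat_r; [|lra]. left. apply Rdiv_lt_0_compat; lra.
  - right. field. lra.
Qed.

(** * Vector fields and Sobolev norms *)

(** The inner product of C as a real plane, the real part of x times the conjugate of y: half the
    derivative of |x|^2 is the [cdot] of x with its derivative. *)
Definition cdot (x y : C) : R := fst x * fst y + snd x * snd y.
Definition vdot (x y : ax -> C) : R :=
  cdot (x A1) (y A1) + cdot (x A2) (y A2) + cdot (x A3) (y A3).
Definition vmod (x : ax -> C) : R := sqrt (vmod2 x).

Lemma Cmod_sq z : Cmod z ^ 2 = fst z ^ 2 + snd z ^ 2.
Proof.
  unfold Cmod. rewrite <- Rsqr_pow2, Rsqr_sqrt; auto.
  generalize (pow2_ge_0 (fst z)) (pow2_ge_0 (snd z)). lra.
Qed.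

Lemma cdot_self z : cdot z z = Cmod z ^ 2.
Proof. rewrite Cmod_sq. unfold cdot. ring. Qed.

Lemma cdot_abs x y : Rabs (cdot x y) <= Cmod x * Cmod y.
Proof.
  unfold Cmod. rewrite <- sqrt_mult_alt.
  - rewrite <- sqrt_Rsqr_abs. apply sqrt_le_1_alt. unfold cdot, Rsqr.
    assert (H := pow2_ge_0 (fst x * snd y - snd x * fst y)). nra.
  - generalize (pow2_ge_0 (fst x)) (pow2_ge_0 (snd x)). lra.
Qed.

Lemma vmod2_ge0 x : 0 <= vmod2 x.
Proof.
  unfold vmod2.
  generalize (pow2_ge_0 (Cmod (x A1))) (pow2_ge_0 (Cmod (x A2))) (pow2_ge_0 (Cmod (x A3))). lra.
Qed.

Lemma vmod_sq x : vmod x ^ 2 = vmod2 x.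
Proof. unfold vmod. rewrite <- Rsqr_pow2, Rsqr_sqrt; auto using vmod2_ge0. Qed.

Lemma vmod_ge0 x : 0 <= vmod x.
Proof. apply sqrt_pos. Qed.

Lemma Cmod_le_vmod x a : Cmod (x a) <= vmod x.
Proof.
  apply Rsqr_incr_0_var; [|apply vmod_ge0]. rewrite !Rsqr_pow2, vmod_sq. unfold vmod2.
  generalize (pow2_ge_0 (Cmod (x A1))) (pow2_ge_0 (Cmod (x A2))) (pow2_ge_0 (Cmod (x A3))).
  destruct a; lra.
Qed.

Lemma vmod_add_le x y z : (forall a, Cmod (z a) <= Cmod (x a) + Cmod (y a)) ->
  vmod z <= vmod x + vmod y.
Proof.
  intros H. assert (Hx := vmod_ge0 x). assert (Hy := vmod_ge0 y).
  apply Rsqr_incr_0_var; [|lra]. rewrite !Rsqr_pow2, vmod_sq.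
  replace ((vmod x + vmod y) ^ 2) with (vmod2 x + 2 * (1 * vmod x * vmod y) + vmod2 y)
    by (rewrite <- !vmod_sq; ring).
  assert (Hcs : fsum [A1; A2; A3] (fun a => 1 * Cmod (x a) * Cmod (y a)) <= 1 * vmod x * vmod y).
  { apply fsum_cauchy_schwarz_le; auto; try lra; intros; try lra; rewrite vmod_sq;
      unfold vmod2; simpl; lra. }
  simpl in Hcs.
  assert (Hsq : forall a, Cmod (z a) ^ 2 <= (Cmod (x a) + Cmod (y a)) ^ 2).
  { intros a. apply pow_incr. split; [apply Cmod_ge_0|auto]. }
  unfold vmod2. generalize (Hsq A1) (Hsq A2) (Hsq A3). lra.
Qed.

Lemma Cmod_minus_le x y : Cmod (x - y)%C <= Cmod x + Cmod y.
Proof.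
  unfold Cminus. eapply Rle_trans; [apply Cmod_triangle|]. rewrite Cmod_opp. lra.
Qed.

Lemma vmod_vsub_le v w k : vmod (vsub v w k) <= vmod (v k) + vmod (w k).
Proof. apply vmod_add_le. intros a. apply Cmod_minus_le. Qed.

Lemma vdot_scal_abs z c x : Rabs (vdot z (fun a => (c * x a)%C)) <= 3 * Cmod c * vmod x * vmod z.
Proof.
  unfold vdot.
  assert (H : forall a, Rabs (cdot (z a) (c * x a)%C) <= Cmod c * vmod x * vmod z).
  { intros a. eapply Rle_trans; [apply cdot_abs|]. rewrite Cmod_mult, Rmult_comm.
    assert (H1 := Cmod_le_vmod x a). assert (H2 := Cmod_le_vmod z a).
    apply Rmult_le_compat; auto using Cmod_ge_0.
    - apply Rmult_le_pos; apply Cmod_ge_0.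
    - apply Rmult_le_compat_l; auto using Cmod_ge_0. }
  eapply Rle_trans; [apply Rabs_triang|].
  eapply Rle_trans; [apply Rplus_le_compat_r, Rabs_triang|].
  generalize (H A1) (H A2) (H A3). lra.
Qed.

Lemma cdot_scal_abs z c x : Rabs (cdot z (c * x)%C) <= Cmod c * Cmod x * Cmod z.
Proof. eapply Rle_trans; [apply cdot_abs|]. rewrite Cmod_mult. lra. Qed.

(** For al >= 0 and |k| >= 1 the multiplier |k|^(-2 al) is at most 1, so each mode of u is bounded
    by that of v. The 3 counts the components. *)
Lemma dotgrad_le al v k l : 0 <= al ->
  Cmod (dotgrad (uvel al v) k l) <= 3 * vmod (v (zsub k l)) * kpow l 1.
Proof.
  intros Hal. unfold dotgrad.
  assert (H : forall a, Cmod (uvel al v (zsub k l) a * (Ci * RtoC (kc l a)))%C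
    <= vmod (v (zsub k l)) * kpow l 1).
  { intros a. unfold uvel. rewrite !Cmod_mult, !Cmod_R.
    replace (Cmod Ci) with 1.
    2: { unfold Cmod; simpl. rewrite <- sqrt_1 at 1. f_equal. ring. }
    assert (H1 := Cmod_le_vmod (v (zsub k l)) a). assert (H2 := kc_le l a).
    assert (H3 := kpow_le1 (zsub k l) (- 2 * al) ltac:(lra)).
    rewrite Rabs_pos_eq by apply kpow_ge0. rewrite Rmult_1_l.
    apply Rmult_le_compat; auto using Rabs_pos.
    - apply Rmult_le_pos; auto using kpow_ge0, Cmod_ge_0.
    - rewrite <- (Rmult_1_l (vmod _)). apply Rmult_le_compat; auto using kpow_ge0, Cmod_ge_0. }
  eapply Rle_trans; [apply Cmod_triangle|].
  eapply Rle_trans; [apply Rplus_le_compat_r, Cmod_triangle|].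
  generalize (H A1) (H A2) (H A3). lra.
Qed.

Lemma dotgrad_vsub al v1 v2 k l : dotgrad (uvel al (vsub v1 v2)) k l
  = (dotgrad (uvel al v1) k l - dotgrad (uvel al v2) k l)%C.
Proof. unfold dotgrad, uvel, vsub. ring. Qed.

Lemma dotgrad_mult_diff al v1 v2 k l (x y : C) :
  (dotgrad (uvel al v1) k l * x - dotgrad (uvel al v2) k l * y)%C
  = (dotgrad (uvel al (vsub v1 v2)) k l * x + dotgrad (uvel al v2) k l * (x - y))%C.
Proof. rewrite dotgrad_vsub. ring. Qed.

(** * Cancellations from incompressibility, and pairings with convolution sums *)

Definition divergence_free (v : vfield) : Prop := forall k,
  (RtoC (kc k A1) * v k A1 + RtoC (kc k A2) * v k A2 + RtoC (kc k A3) * v k A3)%C = 0%C.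
Definition real_field (v : vfield) : Prop := forall k a, v (zneg k) a = Cconj (v k a).

Lemma kc_zsub k l a : kc (zsub k l) a = kc k a - kc l a.
Proof. destruct k as [[? ?] ?], l as [[? ?] ?], a; unfold kc, zsub; apply minus_IZR. Qed.

(** Reality turns the coefficient at l - k into the conjugate of the one at k - l, and
    incompressibility, (k - l) . u(k - l) = 0, allows l to be replaced by k in the symbol i u(k - l)
    . l. *)
Lemma dotgrad_antisym al v k l x y :
  real_field v -> divergence_free v ->
  cdot x (dotgrad (uvel al v) k l * y)%C = - cdot y (dotgrad (uvel al v) l k * x)%C.
Proof.
  intros Hr Hd. unfold dotgrad, uvel. rewrite <- (zneg_zsub k l), kpow_zneg, !Hr.
  assert (H := Hd (zsub k l)). rewrite !kc_zsub in H.
  set (p := kpow _ _).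
  destruct (v (zsub k l) A1) as [a1 b1], (v (zsub k l) A2) as [a2 b2],
    (v (zsub k l) A3) as [a3 b3].
  injection H. intros Him Hre.
  destruct x as [x1 x2], y as [y1 y2]. unfold cdot, Cconj; simpl in *.
  set (k1 := kc k A1) in *. set (k2 := kc k A2) in *. set (k3 := kc k A3) in *.
  set (l1 := kc l A1) in *. set (l2 := kc l A2) in *. set (l3 := kc l A3) in *.
  assert (E1 : k1 * a1 + k2 * a2 + k3 * a3 = l1 * a1 + l2 * a2 + l3 * a3) by lra.
  assert (E2 : k1 * b1 + k2 * b2 + k3 * b3 = l1 * b1 + l2 * b2 + l3 * b3) by lra.
  apply Rminus_diag_uniq.
  transitivity (p * ((x1 * y2 - x2 * y1) * ((k1 * a1 + k2 * a2 + k3 * a3) - (l1 * a1 + l2 * a2 + l3 * a3))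
    + (x1 * y1 + x2 * y2) * ((k1 * b1 + k2 * b2 + k3 * b3) - (l1 * b1 + l2 * b2 + l3 * b3)))); [ring|].
  rewrite E1, E2. ring.
Qed.

(** What [leray] removes is parallel to k, while w is orthogonal to k. *)
Lemma vdot_leray k w x :
  (RtoC (kc k A1) * w A1 + RtoC (kc k A2) * w A2 + RtoC (kc k A3) * w A3)%C = 0%C ->
  vdot w (leray k x) = vdot w x.
Proof.
  intros H. unfold vdot, leray, cdot, Rdiv.
  set (n := / knorm2 k).
  destruct (w A1) as [a1 b1], (w A2) as [a2 b2], (w A3) as [a3 b3].
  destruct (x A1) as [x1 y1], (x A2) as [x2 y2], (x A3) as [x3 y3].
  injection H. simpl. intros Him Hre.
  set (k1 := kc k A1) in *. set (k2 := kc k A2) in *. set (k3 := kc k A3) in *.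
  assert (E1 : k1 * a1 + k2 * a2 + k3 * a3 = 0) by lra.
  assert (E2 : k1 * b1 + k2 * b2 + k3 * b3 = 0) by lra.
  apply Rminus_diag_uniq.
  transitivity (- n * ((k1 * a1 + k2 * a2 + k3 * a3) * (k1 * x1 + k2 * x2 + k3 * x3)
    + (k1 * b1 + k2 * b2 + k3 * b3) * (k1 * y1 + k2 * y2 + k3 * y3))); [ring|].
  rewrite E1, E2. ring.
Qed.

Lemma is_lim_seq_fsum {A} (K : list A) (u : A -> nat -> R) (l : A -> R) :
  (forall k, In k K -> is_lim_seq (u k) (l k)) ->
  is_lim_seq (fun n => fsum K (fun k => u k n)) (fsum K l).
Proof.
  induction K as [|k K IH]; intros H; [apply is_lim_seq_const|].
  apply (is_lim_seq_plus' (u k) (fun n => fsum K (fun k => u k n))).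
  - apply H. now left.
  - apply IH. intros; apply H. now right.
Qed.

Lemma zsum_cdot (f : Z3 -> C) l z : is_zsumC f l ->
  is_lim_seq (fun N => fsum (cube N) (fun k => cdot z (f k))) (cdot z l).
Proof.
  intros H. unfold cdot.
  apply is_lim_seq_ext with (fun N => fst z * fsum (cube N) (fun k => fst (f k))
    + snd z * fsum (cube N) (fun k => snd (f k))).
  { intros N. now rewrite fsum_plus, !fsum_scal. }
  apply is_lim_seq_plus'; apply (is_lim_seq_scal_l _ _ (Finite _)).
  - now apply is_zsumC_fst.
  - now apply is_zsumC_snd.
Qed.

Lemma zsum_vdot (f : Z3 -> ax -> C) (x z : ax -> C) : (forall a, is_zsumC (fun l => f l a) (x a)) ->
  is_lim_seq (fun N => fsum (cube N) (fun k => vdot z (f k))) (vdot z x).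
Proof.
  intros H. unfold vdot.
  apply is_lim_seq_ext with (fun N => fsum (cube N) (fun k => cdot (z A1) (f k A1))
    + fsum (cube N) (fun k => cdot (z A2) (f k A2)) + fsum (cube N) (fun k => cdot (z A3) (f k A3))).
  { intros N. now rewrite !fsum_plus. }
  apply is_lim_seq_plus'; [apply is_lim_seq_plus'|].
  - apply (zsum_cdot (fun l => f l A1)), H.
  - apply (zsum_cdot (fun l => f l A2)), H.
  - apply (zsum_cdot (fun l => f l A3)), H.
Qed.

Lemma lim_seq_abs_le (u : nat -> R) l B N0 : is_lim_seq u (Finite l) ->
  (forall n, (N0 <= n)%nat -> Rabs (u n) <= B) -> Rabs l <= B.
Proof.
  intros Hu HB. apply Rabs_le. split.
  - apply (is_lim_seq_le_loc (fun _ => - B) u (- B) l); auto using is_lim_seq_const.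
    exists N0. intros n Hn. specialize (HB n Hn). apply Rabs_le_between in HB. lra.
  - apply (is_lim_seq_le_loc u (fun _ => B) l B); auto using is_lim_seq_const.
    exists N0. intros n Hn. specialize (HB n Hn). apply Rabs_le_between in HB. lra.
Qed.

Lemma Vnorm_ge0 p w : 0 <= Vnorm p w.
Proof. apply sqrt_pos. Qed.

Lemma Hnorm_ge0 p f : 0 <= Hnorm p f.
Proof. apply sqrt_pos. Qed.

Lemma weight_sq k p x : kpow k (2 * p) * x ^ 2 = (kpow k p * x) ^ 2.
Proof. rewrite kpow_double. ring. Qed.

Lemma weighted_norm_correct p (f : Z3 -> R) (g : Z3 -> R) :
  (forall k, g k = (kpow k p * f k) ^ 2) -> is_finite (zsum3 g) ->
  sobolev_le p f (sqrt (real (zsum3 g))).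
Proof.
  intros E Hfin. split; [apply sqrt_pos|].
  assert (Hg : forall k, 0 <= g k) by (intros; rewrite E; apply pow2_ge_0).
  assert (H := zsum3_summable g Hg Hfin).
  assert (0 <= real (zsum3 g)) by (apply (H []); constructor).
  rewrite <- Rsqr_pow2, Rsqr_sqrt by auto. intros L HL.
  rewrite (fsum_ext _ _ g); auto.
Qed.

Lemma weighted_norm_le p (f : Z3 -> R) (g : Z3 -> R) B :
  (forall k, g k = (kpow k p * f k) ^ 2) -> sobolev_le p f B ->
  is_finite (zsum3 g) /\ sqrt (real (zsum3 g)) <= B.
Proof.
  intros E [HB H].
  assert (Hg : forall k, 0 <= g k) by (intros; rewrite E; apply pow2_ge_0).
  destruct (zsum3_bound g (B ^ 2) Hg) as [H1 H2].
  { intros N. rewrite (fsum_ext _ _ (fun k => (kpow k p * f k) ^ 2)) by auto.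
    apply H, cube_NoDup. }
  split; auto. rewrite <- (sqrt_pow2 B) by auto. now apply sqrt_le_1_alt.
Qed.

Lemma Vnorm_weight p (w : vfield) k : kpow k (2 * p) * vmod2 (w k) = (kpow k p * vmod (w k)) ^ 2.
Proof. now rewrite <- vmod_sq, weight_sq. Qed.

Lemma in_V_sobolev p w : in_V p w -> sobolev_le p (fun k => vmod (w k)) (Vnorm p w).
Proof.
  intros (_ & _ & _ & H). apply weighted_norm_correct; auto. intros k. apply Vnorm_weight.
Qed.

Lemma in_H_sobolev p f : in_H p f -> sobolev_le p (fun k => Cmod (f k)) (Hnorm p f).
Proof.
  intros (_ & _ & H). apply weighted_norm_correct; auto. intros k. apply weight_sq.
Qed.

(** [Vnorm] is meaningful only where the underlying sum is finite. Any bound [B] supplies this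
    finiteness, after which the norm is itself a bound and the least one. *)
Lemma Vnorm_sobolev p w B : sobolev_le p (fun k => vmod (w k)) B ->
  sobolev_le p (fun k => vmod (w k)) (Vnorm p w) /\ Vnorm p w <= B.
Proof.
  intros H.
  destruct (weighted_norm_le p _ (fun k => kpow k (2 * p) * vmod2 (w k)) B (Vnorm_weight p w) H).
  split; auto. apply weighted_norm_correct; auto. intros k. apply Vnorm_weight.
Qed.

Lemma Hnorm_sobolev p f B : sobolev_le p (fun k => Cmod (f k)) B ->
  sobolev_le p (fun k => Cmod (f k)) (Hnorm p f) /\ Hnorm p f <= B.
Proof.
  intros H.
  destruct (weighted_norm_le p _ (fun k => kpow k (2 * p) * Cmod (f k) ^ 2) B
    (fun k => weight_sq k p (Cmod (f k))) H).
  split; auto. apply weighted_norm_correct; auto. intros k. apply weight_sq.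
Qed.

Lemma sobolev_vsub p v w A B :
  sobolev_le p (fun k => vmod (v k)) A -> sobolev_le p (fun k => vmod (w k)) B ->
  sobolev_le p (fun k => vmod (vsub v w k)) (A + B).
Proof. apply sobolev_le_add. intros k. split; [apply vmod_ge0|apply vmod_vsub_le]. Qed.

Lemma sobolev_ssub p f g A B :
  sobolev_le p (fun k => Cmod (f k)) A -> sobolev_le p (fun k => Cmod (g k)) B ->
  sobolev_le p (fun k => Cmod (ssub f g k)) (A + B).
Proof. apply sobolev_le_add. intros k. split; [apply Cmod_ge_0|apply Cmod_minus_le]. Qed.

(** * Bounds on the nonlinear terms *)

Lemma vmod_z0 (w : vfield) : (forall a, w z0 a = 0%C) -> vmod (w z0) = 0.
Proof.
  intros H. unfold vmod, vmod2. rewrite !H, Cmod_0.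
  replace (_ + _ + _) with 0 by ring. apply sqrt_0.
Qed.

Lemma vsub_z0 (v w : vfield) : (forall a, v z0 a = 0%C) -> (forall a, w z0 a = 0%C) ->
  forall a, vsub v w z0 a = 0%C.
Proof. intros Hv Hw a. unfold vsub. rewrite Hv, Hw. ring. Qed.

(** The constant is 9 = 3 * 3: three components in the inner product and three in the symbol. *)
Lemma momentum_transport_term al v1 v2 k l : 0 <= al ->
  Rabs (vdot (vsub v1 v2 k) (fun a =>
    (dotgrad (uvel al v1) k l * v1 l a - dotgrad (uvel al v2) k l * v2 l a)%C))
  <= 9 * (kpow l 1 * (vmod (vsub v1 v2 (zsub k l)) * vmod (v1 l)) * vmod (vsub v1 v2 k))
   + 9 * (kpow l 1 * (vmod (v2 (zsub k l)) * vmod (vsub v1 v2 l)) * vmod (vsub v1 v2 k)).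
Proof.
  intros Hal.
  replace (vdot _ _) with
    (vdot (vsub v1 v2 k) (fun a => (dotgrad (uvel al (vsub v1 v2)) k l * v1 l a)%C)
     + vdot (vsub v1 v2 k) (fun a => (dotgrad (uvel al v2) k l * vsub v1 v2 l a)%C)).
  2: { unfold vdot. rewrite !dotgrad_mult_diff. unfold cdot, vsub. simpl. ring. }
  eapply Rle_trans; [apply Rabs_triang|].
  apply Rplus_le_compat; (eapply Rle_trans; [apply vdot_scal_abs|]).
  - assert (H := dotgrad_le al (vsub v1 v2) k l Hal).
    assert (H1 := vmod_ge0 (v1 l)). assert (H2 := vmod_ge0 (vsub v1 v2 k)).
    apply Rle_trans with (3 * (3 * vmod (vsub v1 v2 (zsub k l)) * kpow l 1) * vmod (v1 l) * vmod (vsub v1 v2 k));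
      [|right; ring].
    repeat (apply Rmult_le_compat_r; auto). lra.
  - assert (H := dotgrad_le al v2 k l Hal).
    assert (H1 := vmod_ge0 (vsub v1 v2 l)). assert (H2 := vmod_ge0 (vsub v1 v2 k)).
    apply Rle_trans with (3 * (3 * vmod (v2 (zsub k l)) * kpow l 1) * vmod (vsub v1 v2 l) * vmod (vsub v1 v2 k));
      [|right; ring].
    repeat (apply Rmult_le_compat_r; auto). lra.
Qed.

(** The weight 2(r - 1) is split evenly for the term with u1 - u2, but as (r - 1 - be) + (r - 1 +
    be) for B(u2, w), to make the dissipation [D] its test factor. [D] sees only the output cube,
    whereas [G] must bound [w] at all input frequencies. Both estimates are uniform in the input
    cube and pass to the limit. *)
Lemma momentum_transport_bound al be r S (v1 v2 NB1 NB2 : vfield) a b W G D N :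
  0 <= al -> 1 / 2 < be -> be + 2 < r ->
  0 <= S -> summable_le (fun k => kpow k (- (2 * (be + 1)))) S ->
  (forall a, v1 z0 a = 0%C) -> (forall a, v2 z0 a = 0%C) ->
  sobolev_le r (fun k => vmod (v1 k)) a -> sobolev_le r (fun k => vmod (v2 k)) b ->
  sobolev_le (r - 1) (fun k => vmod (vsub v1 v2 k)) W ->
  sobolev_le (r - be) (fun k => vmod (vsub v1 v2 k)) G ->
  0 <= D -> fsum (cube N) (fun k => (kpow k (r - 1 + be) * vmod (vsub v1 v2 k)) ^ 2) <= D ^ 2 ->
  (forall k a, is_zsumC (fun l => (dotgrad (uvel al v1) k l * v1 l a)%C) (NB1 k a)) ->
  (forall k a, is_zsumC (fun l => (dotgrad (uvel al v2) k l * v2 l a)%C) (NB2 k a)) ->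
  Rabs (fsum (cube N) (fun k => kpow k (2 * (r - 1))
    * vdot (vsub v1 v2 k) (fun a => (NB1 k a - NB2 k a)%C)))
  <= 9 * (Rpower 2 (r - 1) * (sqrt S * W * a * W + sqrt S * W * a * W))
   + 9 * (Rpower 2 (r - 1 - be) * (sqrt S * b * G * D + sqrt S * b * W * D)).
Proof.
  intros Hal Hbe Hr HS0 HS Hz1 Hz2 Ha Hb HW HG HD0 HD HN1 HN2.
  set (w := vsub v1 v2) in *.
  assert (Hlim : is_lim_seq (fun M => fsum (cube N) (fun k => kpow k (2 * (r - 1)) *
      (fsum (cube M) (fun l => vdot (w k) (fun a => (dotgrad (uvel al v1) k l * v1 l a
        - dotgrad (uvel al v2) k l * v2 l a)%C)))))
    (fsum (cube N) (fun k => kpow k (2 * (r - 1)) * vdot (w k) (fun a => (NB1 k a - NB2 k a)%C)))).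
  { apply is_lim_seq_fsum. intros k _. apply (is_lim_seq_scal_l _ _ (Finite _)).
    replace (vdot (w k) (fun a0 => (NB1 k a0 - NB2 k a0)%C))
      with (vdot (w k) (NB1 k) - vdot (w k) (NB2 k)) by (unfold vdot, cdot; simpl; ring).
    apply is_lim_seq_ext with (fun M =>
      fsum (cube M) (fun l => vdot (w k) (fun a => (dotgrad (uvel al v1) k l * v1 l a)%C))
      - fsum (cube M) (fun l => vdot (w k) (fun a => (dotgrad (uvel al v2) k l * v2 l a)%C))).
    { intros M. unfold Rminus. rewrite <- fsum_opp, <- fsum_plus. apply fsum_ext. intros l _.
      unfold vdot, cdot; simpl; ring. }
    apply is_lim_seq_minus'.
    - apply (zsum_vdot (fun l a => (dotgrad (uvel al v1) k l * v1 l a)%C)), HN1.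
    - apply (zsum_vdot (fun l a => (dotgrad (uvel al v2) k l * v2 l a)%C)), HN2. }
  refine (lim_seq_abs_le _ _ _ 0 Hlim _). clear Hlim. intros M _.
  eapply Rle_trans; [apply fsum_abs|].
  apply Rle_trans with (9 * fsum (cube N) (fun k => fsum (cube M) (fun l =>
      (kpow k (r - 1) * kpow l 1) * (vmod (w (zsub k l)) * vmod (v1 l)) * (kpow k (r - 1) * vmod (w k))))
    + 9 * fsum (cube N) (fun k => fsum (cube M) (fun l =>
      (kpow k (r - 1 - be) * kpow l 1) * (vmod (v2 (zsub k l)) * vmod (w l)) * (kpow k (r - 1 + be) * vmod (w k))))).
  - rewrite <- !fsum_scal, <- fsum_plus. apply fsum_le. intros k _.
    rewrite Rabs_mult, (Rabs_pos_eq (kpow _ _)) by apply kpow_ge0.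
    eapply Rle_trans; [apply Rmult_le_compat_l; [apply kpow_ge0|apply fsum_abs]|].
    rewrite <- !fsum_scal, <- fsum_plus. apply fsum_le. intros l _.
    eapply Rle_trans; [apply Rmult_le_compat_l; [apply kpow_ge0|now apply momentum_transport_term]|].
    fold w. right. rewrite Rmult_plus_distr_l. f_equal.
    + rewrite kpow_double. ring.
    + replace (2 * (r - 1)) with ((r - 1 - be) + (r - 1 + be)) by ring. rewrite kpow_plus. ring.
  - assert (Hwz := vmod_z0 w (vsub_z0 v1 v2 Hz1 Hz2)).
    apply Rplus_le_compat; apply Rmult_le_compat_l; try lra.
    + apply (transport_bound_high_low (be + 1) S HS0 HS (cube N) (cube M)
        (fun k => vmod (w k)) (fun k => vmod (v1 k)) (fun k => kpow k (r - 1) * vmod (w k)) W)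
        with (p' := r); auto using cube_NoDup, vmod_ge0, vmod_z0; try lra.
      * intros. apply Rmult_le_pos; auto using vmod_ge0, kpow_ge0.
      * apply HW.
      * apply HW, cube_NoDup.
      * replace (r - 1 + 1) with r by ring. auto.
    + apply (transport_bound_smooth_velocity (be + 1) S HS0 HS (cube N) (cube M)
        (fun k => vmod (v2 k)) (fun k => vmod (w k)) (fun k => kpow k (r - 1 + be) * vmod (w k)) D)
        with (r := r); auto using cube_NoDup, vmod_ge0, vmod_z0; try lra.
      * intros. apply Rmult_le_pos; auto using vmod_ge0, kpow_ge0.
      * replace (r - 1 - be + 1) with (r - be) by ring. auto.
      * apply (sobolev_le_mono 1 (r - 1) _ (fun k => vmod (w k))); auto; try lra.
        intros; split; [apply vmod_ge0|lra].
Qed.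

Lemma fsum_antisymmetric {A} (L : list A) (f : A -> A -> R) :
  (forall k l, f k l = - f l k) -> fsum L (fun k => fsum L (f k)) = 0.
Proof.
  intros H.
  enough (fsum L (fun k => fsum L (f k)) = - fsum L (fun k => fsum L (f k))) by lra.
  rewrite fsum_swap at 1. rewrite <- fsum_opp. apply fsum_ext. intros k _.
  rewrite <- fsum_opp. apply fsum_ext. intros l _. apply H.
Qed.

Lemma scalar_transport_bound al be r S (v1 v2 : vfield) (th1 th2 NT1 NT2 : sfield) m b W H N :
  0 <= al -> 1 / 2 < be -> be + 2 < r ->
  0 <= S -> summable_le (fun k => kpow k (- (2 * (be + 1)))) S ->
  (forall a, v1 z0 a = 0%C) -> (forall a, v2 z0 a = 0%C) -> th1 z0 = 0%C -> th2 z0 = 0%C ->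
  real_field v2 -> divergence_free v2 ->
  sobolev_le (r - be) (fun k => Cmod (th1 k)) m -> sobolev_le r (fun k => vmod (v2 k)) b ->
  sobolev_le (r - 1) (fun k => vmod (vsub v1 v2 k)) W ->
  sobolev_le (r - be - 1) (fun k => Cmod (ssub th1 th2 k)) H ->
  (forall k, is_zsumC (fun l => (dotgrad (uvel al v1) k l * th1 l)%C) (NT1 k)) ->
  (forall k, is_zsumC (fun l => (dotgrad (uvel al v2) k l * th2 l)%C) (NT2 k)) ->
  Rabs (fsum (cube N) (fun k => cutoff (r - be - 1) N k ^ 2
    * cdot (ssub th1 th2 k) (NT1 k - NT2 k)%C))
  <= 3 * (Rpower 2 (r - be - 1) * (sqrt S * W * m * H + sqrt S * W * m * H))
   + 3 * ((r - be - 1 + 1) * Rpower 2 (r - be - 1 - 1) * (sqrt S * b * H * H + sqrt S * b * H * H)).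
Proof.
  intros Hal Hbe Hr HS0 HS Hz1 Hz2 Ht1 Ht2 Hreal Hdiv Hm Hb HW HH HN1 HN2.
  set (w := vsub v1 v2) in *. set (et := ssub th1 th2) in *. set (sg := r - be - 1) in *.
  assert (Hlim : is_lim_seq (fun M => fsum (cube N) (fun k => cutoff sg N k ^ 2 *
      (fsum (cube M) (fun l => cdot (et k) (dotgrad (uvel al v1) k l * th1 l
        - dotgrad (uvel al v2) k l * th2 l)%C))))
    (fsum (cube N) (fun k => cutoff sg N k ^ 2 * cdot (et k) (NT1 k - NT2 k)%C))).
  { apply is_lim_seq_fsum. intros k _. apply (is_lim_seq_scal_l _ _ (Finite _)).
    replace (cdot (et k) (NT1 k - NT2 k)%C)
      with (cdot (et k) (NT1 k) - cdot (et k) (NT2 k)) by (unfold cdot; simpl; ring).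
    apply is_lim_seq_ext with (fun M =>
      fsum (cube M) (fun l => cdot (et k) (dotgrad (uvel al v1) k l * th1 l)%C)
      - fsum (cube M) (fun l => cdot (et k) (dotgrad (uvel al v2) k l * th2 l)%C)).
    { intros M. unfold Rminus. rewrite <- fsum_opp, <- fsum_plus. apply fsum_ext. intros l _.
      unfold cdot; simpl; ring. }
    apply is_lim_seq_minus'.
    - apply (zsum_cdot (fun l => (dotgrad (uvel al v1) k l * th1 l)%C)), HN1.
    - apply (zsum_cdot (fun l => (dotgrad (uvel al v2) k l * th2 l)%C)), HN2. }
  refine (lim_seq_abs_le _ _ _ N Hlim _). clear Hlim. intros M HM.
  (* With c the cutoff, c(k)^2 = c(k) (c(k) - c(l)) + c(k) c(l). [T4] holds the commutator, and [T5]
     a symmetric weight on the antisymmetric form. *)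
  set (T3 := fun k l => cutoff sg N k ^ 2 * cdot (et k) (dotgrad (uvel al w) k l * th1 l)%C).
  set (T4 := fun k l => cutoff sg N k * (cutoff sg N k - cutoff sg N l)
    * cdot (et k) (dotgrad (uvel al v2) k l * et l)%C).
  set (T5 := fun k l => cutoff sg N k * cutoff sg N l
    * cdot (et k) (dotgrad (uvel al v2) k l * et l)%C).
  (* The cutoff vanishes outside [cube N], so for M >= N the outer sum may be extended to [cube M],
     where exchanging k and l cancels the terms. *)
  assert (H5 : fsum (cube N) (fun k => fsum (cube M) (T5 k)) = 0).
  { rewrite (fsum_support (cube N) (cube M)); auto using cube_NoDup, cube_incl.
    - apply fsum_antisymmetric. intros k l. unfold T5.
      rewrite dotgrad_antisym by auto. ring.
    - intros k _ Hk. rewrite <- (fsum_zero (cube M)). apply fsum_ext. intros l _.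
      unfold T5. rewrite (cutoff_support sg N k Hk). ring. }
  replace (fsum (cube N) _) with (fsum (cube N) (fun k => fsum (cube M) (T3 k))
    + fsum (cube N) (fun k => fsum (cube M) (T4 k)) + fsum (cube N) (fun k => fsum (cube M) (T5 k))).
  2: { rewrite <- !fsum_plus. apply fsum_ext. intros k _. rewrite <- !fsum_plus, <- fsum_scal.
       apply fsum_ext. intros l _. unfold T3, T4, T5. rewrite dotgrad_mult_diff. fold w.
       unfold et, ssub, cdot; simpl; ring. }
  rewrite H5, Rplus_0_r.
  set (h := fun k => cutoff sg N k * Cmod (et k)).
  assert (Hh : forall k, 0 <= h k)
    by (intros; apply Rmult_le_pos; auto using cutoff_ge0, Cmod_ge_0).
  assert (HhH : fsum (cube N) (fun k => h k ^ 2) <= H ^ 2).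
  { eapply Rle_trans; [|apply HH, (cube_NoDup N)]. apply fsum_le. intros k _.
    apply pow_incr. split; auto. apply Rmult_le_compat_r; auto using Cmod_ge_0, cutoff_le. }
  assert (Hez : et z0 = 0%C) by (unfold et, ssub; rewrite Ht1, Ht2; ring).
  assert (Hwz := vmod_z0 w (vsub_z0 v1 v2 Hz1 Hz2)).
  eapply Rle_trans; [apply Rabs_triang|]. apply Rplus_le_compat.
  - apply Rle_trans with (3 * fsum (cube N) (fun k => fsum (cube M) (fun l =>
      (kpow k sg * kpow l 1) * (vmod (w (zsub k l)) * Cmod (th1 l)) * h k))).
    + rewrite <- fsum_scal. eapply Rle_trans; [apply fsum_abs|]. apply fsum_le. intros k _.
      rewrite <- fsum_scal. eapply Rle_trans; [apply fsum_abs|]. apply fsum_le. intros l _.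
      unfold T3, h. rewrite Rabs_mult, (Rabs_pos_eq (_ ^ 2)) by apply pow2_ge_0.
      assert (Hc0 := cutoff_ge0 sg N k). assert (Hc := cutoff_le sg N k).
      assert (Hd := dotgrad_le al w k l Hal). assert (He := cdot_scal_abs (et k) (dotgrad (uvel al w) k l) (th1 l)).
      assert (Hp1 := Cmod_ge_0 (th1 l)). assert (Hp2 := Cmod_ge_0 (et k)).
      assert (Hp3 := vmod_ge0 (w (zsub k l))). assert (Hp4 := kpow_ge0 l 1).
      apply Rle_trans with (cutoff sg N k ^ 2 * ((3 * vmod (w (zsub k l)) * kpow l 1) * Cmod (th1 l) * Cmod (et k))).
      * apply Rmult_le_compat_l; [apply pow2_ge_0|]. eapply Rle_trans; [apply He|].
        repeat (apply Rmult_le_compat_r; auto).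
      * apply Rle_trans with (kpow k sg * cutoff sg N k
          * ((3 * vmod (w (zsub k l)) * kpow l 1) * Cmod (th1 l) * Cmod (et k))); [|right; ring].
        apply Rmult_le_compat_r; [repeat apply Rmult_le_pos; auto; lra|].
        simpl. rewrite Rmult_1_r. apply Rmult_le_compat_r; auto.
    + apply Rmult_le_compat_l; [lra|].
      apply (transport_bound_rough_scalar (be + 1) S HS0 HS (cube N) (cube M)
        (fun k => vmod (w k)) (fun k => Cmod (th1 k)) h H) with (be := be);
        auto using cube_NoDup, vmod_ge0, Cmod_ge_0; try (unfold sg; lra).
      * apply HH.
      * rewrite Ht1. apply Cmod_0.
      * replace (sg + be) with (r - 1) by (unfold sg; ring). auto.
      * replace (sg + 1) with (r - be) by (unfold sg; ring). auto.
  - apply Rle_trans with (3 * fsum (cube N) (fun k => fsum (cube M) (fun l =>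
      (Rabs (cutoff sg N k - cutoff sg N l) * kpow l 1) * (vmod (v2 (zsub k l)) * Cmod (et l)) * h k))).
    + rewrite <- fsum_scal. eapply Rle_trans; [apply fsum_abs|]. apply fsum_le. intros k _.
      rewrite <- fsum_scal. eapply Rle_trans; [apply fsum_abs|]. apply fsum_le. intros l _.
      unfold T4, h. rewrite !Rabs_mult, (Rabs_pos_eq (cutoff _ _ k)) by apply cutoff_ge0.
      assert (Hc0 := cutoff_ge0 sg N k).
      assert (Hd := dotgrad_le al v2 k l Hal). assert (He := cdot_scal_abs (et k) (dotgrad (uvel al v2) k l) (et l)).
      assert (Hp1 := Cmod_ge_0 (et l)). assert (Hp2 := Cmod_ge_0 (et k)).
      assert (Hp3 := Rabs_pos (cutoff sg N k - cutoff sg N l)).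
      apply Rle_trans with (cutoff sg N k * Rabs (cutoff sg N k - cutoff sg N l)
        * ((3 * vmod (v2 (zsub k l)) * kpow l 1) * Cmod (et l) * Cmod (et k))).
      * apply Rmult_le_compat_l; [now apply Rmult_le_pos|]. eapply Rle_trans; [apply He|].
        repeat (apply Rmult_le_compat_r; auto).
      * right; ring.
    + apply Rmult_le_compat_l; [lra|].
      apply (commutator_bound (be + 1) S HS0 HS (cube N) (cube M)
        (fun k => vmod (v2 k)) (fun k => Cmod (et k)) h H) with (r := r);
        auto using cube_NoDup, vmod_ge0, Cmod_ge_0, vmod_z0; try (unfold sg; lra).
      * apply HH.
      * unfold h. rewrite Hez, Cmod_0. ring.
      * rewrite Hez. apply Cmod_0.
      * apply (sobolev_le_mono 1 sg _ (fun k => Cmod (et k))); auto; try (unfold sg; lra).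
        intros; split; [apply Cmod_ge_0|lra].
Qed.

(** * Time regularity of the Fourier modes *)

Lemma cont_on_const T c : cont_on T (fun _ => c).
Proof.
  intros t Ht eps Heps. exists 1. split; [lra|]. intros.
  now rewrite Rminus_diag, Rabs_R0.
Qed.

Lemma cont_on_plus T f g : cont_on T f -> cont_on T g -> cont_on T (fun t => f t + g t).
Proof.
  intros Hf Hg t Ht eps Heps.
  destruct (Hf t Ht (eps / 2)) as (d1 & Hd1 & H1); [lra|].
  destruct (Hg t Ht (eps / 2)) as (d2 & Hd2 & H2); [lra|].
  exists (Rmin d1 d2). split; [now apply Rmin_pos|]. intros t' Ht' Hd.
  specialize (H1 t' Ht' (Rlt_le_trans _ _ _ Hd (Rmin_l _ _))).
  specialize (H2 t' Ht' (Rlt_le_trans _ _ _ Hd (Rmin_r _ _))).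
  replace (f t' + g t' - (f t + g t)) with ((f t' - f t) + (g t' - g t)) by ring.
  eapply Rle_lt_trans; [apply Rabs_triang|]. lra.
Qed.

Lemma cont_on_scal T c f : cont_on T f -> cont_on T (fun t => c * f t).
Proof.
  intros Hf t Ht eps Heps. assert (Hc := Rabs_pos c).
  destruct (Hf t Ht (eps / (Rabs c + 1))) as (d & Hd & H).
  { apply Rdiv_lt_0_compat; lra. }
  exists d. split; auto. intros t' Ht' Hdt. specialize (H t' Ht' Hdt).
  rewrite <- Rmult_minus_distr_l, Rabs_mult.
  apply Rle_lt_trans with (Rabs c * (eps / (Rabs c + 1))).
  - apply Rmult_le_compat_l; lra.
  - apply Rlt_le_trans with ((Rabs c + 1) * (eps / (Rabs c + 1))); [|right; field; lra].
    apply Rmult_lt_compat_r; [|lra]. apply Rdiv_lt_0_compat; lra.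
Qed.

Lemma cont_on_dominated T (f : R -> R) (h : R -> R -> R) c :
  0 <= c ->
  (forall t t', 0 <= t <= T -> 0 <= t' <= T -> Rabs (f t' - f t) <= c * h t' t) ->
  (forall t, 0 <= t <= T -> forall eps, 0 < eps -> exists delta, 0 < delta /\
    forall t', 0 <= t' <= T -> Rabs (t' - t) < delta -> h t' t < eps) ->
  cont_on T f.
Proof.
  intros Hc Hf Hh t Ht eps Heps.
  destruct (Hh t Ht (eps / (c + 1))) as (d & Hd & H).
  { apply Rdiv_lt_0_compat; lra. }
  exists d. split; auto. intros t' Ht' Hdt. specialize (H t' Ht' Hdt).
  eapply Rle_lt_trans; [apply Hf; auto|].
  apply Rle_lt_trans with (c * (eps / (c + 1))); [apply Rmult_le_compat_l; lra|].
  apply Rlt_le_trans with ((c + 1) * (eps / (c + 1))); [|right; field; lra].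
  apply Rmult_lt_compat_r; [|lra]. apply Rdiv_lt_0_compat; lra.
Qed.

Definition ccont_on (T : R) (f : R -> C) : Prop :=
  cont_on T (fun t => fst (f t)) /\ cont_on T (fun t => snd (f t)).
Definition cderiv_on (T : R) (x g : R -> C) : Prop :=
  deriv_on T (fun t => fst (x t)) (fun t => fst (g t)) /\
  deriv_on T (fun t => snd (x t)) (fun t => snd (g t)).

Lemma ccont_on_plus T f g : ccont_on T f -> ccont_on T g -> ccont_on T (fun t => (f t + g t)%C).
Proof. intros [? ?] [? ?]. split; simpl; now apply cont_on_plus. Qed.

Lemma ccont_on_scal T c f : ccont_on T f -> ccont_on T (fun t => (RtoC c * f t)%C).
Proof.
  intros [H1 H2]. split.
  - apply cont_on_ext with (fun t => c * fst (f t)); [intros; simpl; ring|now apply cont_on_scal].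
  - apply cont_on_ext with (fun t => c * snd (f t)); [intros; simpl; ring|now apply cont_on_scal].
Qed.

Lemma ccont_on_opp T f : ccont_on T f -> ccont_on T (fun t => (- f t)%C).
Proof.
  intros [H1 H2]. split.
  - apply cont_on_ext with (fun t => -1 * fst (f t)); [intros; simpl; ring|now apply cont_on_scal].
  - apply cont_on_ext with (fun t => -1 * snd (f t)); [intros; simpl; ring|now apply cont_on_scal].
Qed.

Lemma ccont_on_leray T k (f : R -> ax -> C) a :
  (forall b, ccont_on T (fun t => f t b)) -> ccont_on T (fun t => leray k (f t) a).
Proof.
  intros H. unfold leray, Cminus.
  apply ccont_on_plus; auto. apply ccont_on_opp, ccont_on_scal.
  apply ccont_on_plus; [apply ccont_on_plus|]; now apply ccont_on_scal.
Qed.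

Lemma ccont_on_dominated T (f : R -> C) (h : R -> R -> R) c :
  0 <= c ->
  (forall z t t', 0 <= t <= T -> 0 <= t' <= T -> Rabs (cdot z (f t' - f t)%C) <= Cmod z * (c * h t' t)) ->
  (forall t, 0 <= t <= T -> forall eps, 0 < eps -> exists delta, 0 < delta /\
    forall t', 0 <= t' <= T -> Rabs (t' - t) < delta -> h t' t < eps) ->
  ccont_on T f.
Proof.
  intros Hc Hf Hh.
  assert (H : forall z, cont_on T (fun t => cdot z (f t))).
  { intros z. apply (cont_on_dominated T _ h (Cmod z * c)); auto.
    - apply Rmult_le_pos; auto using Cmod_ge_0.
    - intros t t' Ht Ht'. rewrite Rmult_assoc.
      replace (cdot z (f t') - cdot z (f t)) with (cdot z (f t' - f t)%C)
        by (unfold cdot; simpl; ring). auto. }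
  split.
  (* Pairing with 1 and with i recovers the real and the imaginary part. *)
  - apply cont_on_ext with (fun t => cdot 1 (f t)); auto. intros; unfold cdot; simpl; ring.
  - apply cont_on_ext with (fun t => cdot Ci (f t)); auto. intros; unfold cdot; simpl; ring.
Qed.

Lemma cderiv_on_is_RInt T (x g : R -> C) x0 : ccont_on T g ->
  (forall t, 0 <= t <= T -> is_RInt g 0 t (x t - x0)%C) -> cderiv_on T x g.
Proof.
  intros [H1 H2] H. split.
  - apply (deriv_on_is_RInt T _ _ (fst x0)); auto. intros t Ht.
    apply (is_RInt_fct_extend_fst (U := R_NormedModule) (V := R_NormedModule) g 0 t _ (H t Ht)).
  - apply (deriv_on_is_RInt T _ _ (snd x0)); auto. intros t Ht.
    apply (is_RInt_fct_extend_snd (U := R_NormedModule) (V := R_NormedModule) g 0 t _ (H t Ht)).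
Qed.

Lemma cderiv_on_minus T x y g h : cderiv_on T x g -> cderiv_on T y h ->
  cderiv_on T (fun t => (x t - y t)%C) (fun t => (g t - h t)%C).
Proof.
  intros [H1 H2] [H3 H4]. split.
  - eapply deriv_on_ext; [| |apply (deriv_on_minus _ _ _ _ _ H1 H3)]; intros; reflexivity.
  - eapply deriv_on_ext; [| |apply (deriv_on_minus _ _ _ _ _ H2 H4)]; intros; reflexivity.
Qed.

Lemma cderiv_on_Cmod_sq T x g : cderiv_on T x g ->
  deriv_on T (fun t => Cmod (x t) ^ 2) (fun t => 2 * cdot (x t) (g t)).
Proof.
  intros [H1 H2].
  eapply deriv_on_ext; [| |apply (deriv_on_plus _ _ _ _ _
    (deriv_on_mult _ _ _ _ _ H1 H1) (deriv_on_mult _ _ _ _ _ H2 H2))].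
  - intros t _. rewrite Cmod_sq. simpl. ring.
  - intros t _. unfold cdot. simpl. ring.
Qed.

Lemma sobolev_le_lower p q f B : p <= q -> (forall k, 0 <= f k) ->
  sobolev_le q f B -> sobolev_le p f B.
Proof. intros Hpq Hf. apply sobolev_le_mono; auto. intros; split; auto; lra. Qed.

Lemma convolution_mode_bound k f g A B L :
  NoDup L -> (forall m, 0 <= f m) -> (forall m, 0 <= g m) -> f z0 = 0 ->
  sobolev_le 0 f A -> sobolev_le 1 g B ->
  fsum L (fun l => f (zsub k l) * (kpow l 1 * g l)) <= A * B.
Proof.
  intros HL Hf Hg Hf0 [HA Hfs] [HB Hgs].
  apply Rle_trans with (fsum L (fun l => 1 * f (zsub k l) * (kpow l 1 * g l))).
  { right. apply fsum_ext. intros; ring. }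
  replace (A * B) with (1 * A * B) by ring.
  apply fsum_cauchy_schwarz_le; auto; try (intros; lra).
  - rewrite fsum_scal. apply Rmult_le_compat_l; [lra|].
    apply (summable_shift_r (fun m => f m ^ 2)); auto.
    intros L' HL'. rewrite (fsum_ext _ _ (fun m => (kpow m 0 * f m) ^ 2)); [now apply Hfs|].
    (* [kpow z0 0] is 0 and not 1, so the norm does not see the mode 0; there [f] vanishes by
       hypothesis. *)
    intros m _. destruct (Z3_eq_dec m z0) as [->|Hm]; [rewrite Hf0; ring|].
    rewrite kpow_0 by auto. ring.
  - rewrite fsum_scal. apply Rmult_le_compat_l; [lra|]. now apply Hgs.
Qed.

(** Meant for one solution at two times: a Lipschitz bound of the bilinear term, which yields the
    continuity in time of each of its modes. *)
Lemma transport_mode_diff al k (v1 v2 : vfield) (g1 g2 : sfield) N1 N2 z dv dg A B :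
  0 <= al -> (forall a, v1 z0 a = 0%C) -> (forall a, v2 z0 a = 0%C) ->
  sobolev_le 0 (fun k => vmod (vsub v1 v2 k)) dv -> sobolev_le 0 (fun k => vmod (v2 k)) A ->
  sobolev_le 1 (fun k => Cmod (g1 k)) B -> sobolev_le 1 (fun k => Cmod (ssub g1 g2 k)) dg ->
  is_zsumC (fun l => (dotgrad (uvel al v1) k l * g1 l)%C) N1 ->
  is_zsumC (fun l => (dotgrad (uvel al v2) k l * g2 l)%C) N2 ->
  Rabs (cdot z (N1 - N2)%C) <= Cmod z * (3 * (dv * B + A * dg)).
Proof.
  intros Hal Hz1 Hz2 Hdv HA HB Hdg HN1 HN2.
  assert (Hlim : is_lim_seq (fun M => fsum (cube M) (fun l =>
      cdot z (dotgrad (uvel al v1) k l * g1 l)%C + - cdot z (dotgrad (uvel al v2) k l * g2 l)%C))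
    (cdot z (N1 - N2)%C)).
  { apply is_lim_seq_ext with (fun M => fsum (cube M) (fun l => cdot z (dotgrad (uvel al v1) k l * g1 l)%C)
      - fsum (cube M) (fun l => cdot z (dotgrad (uvel al v2) k l * g2 l)%C)).
    { intros M. rewrite fsum_plus, fsum_opp. reflexivity. }
    replace (cdot z (N1 - N2)%C) with (cdot z N1 - cdot z N2) by (unfold cdot; simpl; ring).
    apply is_lim_seq_minus'; now apply (zsum_cdot (fun l => _)). }
  refine (lim_seq_abs_le _ _ _ 0 Hlim _). intros M _.
  eapply Rle_trans; [apply fsum_abs|].
  apply Rle_trans with (Cmod z * (3 * (
    fsum (cube M) (fun l => vmod (vsub v1 v2 (zsub k l)) * (kpow l 1 * Cmod (g1 l)))
    + fsum (cube M) (fun l => vmod (v2 (zsub k l)) * (kpow l 1 * Cmod (ssub g1 g2 l)))))).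
  - rewrite <- fsum_plus, <- !fsum_scal. apply fsum_le. intros l _.
    replace (_ + _) with (cdot z (dotgrad (uvel al (vsub v1 v2)) k l * g1 l)%C
      + cdot z (dotgrad (uvel al v2) k l * ssub g1 g2 l)%C).
    2: { rewrite dotgrad_vsub. unfold cdot, ssub. simpl. ring. }
    eapply Rle_trans; [apply Rabs_triang|].
    assert (H1 := cdot_scal_abs z (dotgrad (uvel al (vsub v1 v2)) k l) (g1 l)).
    assert (H2 := cdot_scal_abs z (dotgrad (uvel al v2) k l) (ssub g1 g2 l)).
    assert (H3 := dotgrad_le al (vsub v1 v2) k l Hal). assert (H4 := dotgrad_le al v2 k l Hal).
    apply (Rmult_le_compat_r (Cmod (g1 l) * Cmod z)) in H3;
      [|apply Rmult_le_pos; apply Cmod_ge_0].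
    apply (Rmult_le_compat_r (Cmod (ssub g1 g2 l) * Cmod z)) in H4;
      [|apply Rmult_le_pos; apply Cmod_ge_0].
    lra.
  - apply Rmult_le_compat_l; [apply Cmod_ge_0|]. apply Rmult_le_compat_l; [lra|].
    apply Rplus_le_compat.
    + apply (convolution_mode_bound k (fun m => vmod (vsub v1 v2 m)) (fun m => Cmod (g1 m)));
        auto using cube_NoDup, vmod_ge0, Cmod_ge_0, vmod_z0, vsub_z0.
    + apply (convolution_mode_bound k (fun m => vmod (v2 m)) (fun m => Cmod (ssub g1 g2 m)));
        auto using cube_NoDup, vmod_ge0, Cmod_ge_0, vmod_z0.
Qed.

Lemma Vnorm_cont T p v : in_CV T p v -> cont_on T (fun t => Vnorm p (v t)).
Proof.
  intros [Hin Hc] t Ht eps Heps. destruct (Hc t Ht eps Heps) as (d & Hd & H).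
  exists d. split; auto. intros t' Ht' Hdt. eapply Rle_lt_trans; [|apply (H t' Ht' Hdt)].
  assert (H1 := in_V_sobolev p _ (Hin t Ht)). assert (H2 := in_V_sobolev p _ (Hin t' Ht')).
  destruct (Vnorm_sobolev p _ _ (sobolev_vsub p _ _ _ _ H2 H1)) as [H3 _].
  destruct (Vnorm_sobolev p (v t') (Vnorm p (v t) + Vnorm p (vsub (v t') (v t)))) as [_ H4].
  { eapply sobolev_le_add; [|apply H1|apply H3]. intros k. split; [apply vmod_ge0|].
    apply vmod_add_le. intros a. unfold vsub.
    replace (v t' k a) with (v t k a + (v t' k a - v t k a))%C at 1 by ring. apply Cmod_triangle. }
  destruct (Vnorm_sobolev p (v t) (Vnorm p (v t') + Vnorm p (vsub (v t') (v t)))) as [_ H5].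
  { eapply sobolev_le_add; [|apply H2|apply H3]. intros k. split; [apply vmod_ge0|].
    apply vmod_add_le. intros a. unfold vsub.
    replace (v t k a) with (v t' k a - (v t' k a - v t k a))%C at 1 by ring. apply Cmod_minus_le. }
  apply Rabs_le. lra.
Qed.

Lemma Hnorm_cont T p th : in_CH T p th -> cont_on T (fun t => Hnorm p (th t)).
Proof.
  intros [Hin Hc] t Ht eps Heps. destruct (Hc t Ht eps Heps) as (d & Hd & H).
  exists d. split; auto. intros t' Ht' Hdt. eapply Rle_lt_trans; [|apply (H t' Ht' Hdt)].
  assert (H1 := in_H_sobolev p _ (Hin t Ht)). assert (H2 := in_H_sobolev p _ (Hin t' Ht')).
  destruct (Hnorm_sobolev p _ _ (sobolev_ssub p _ _ _ _ H2 H1)) as [H3 _].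
  destruct (Hnorm_sobolev p (th t') (Hnorm p (th t) + Hnorm p (ssub (th t') (th t)))) as [_ H4].
  { eapply sobolev_le_add; [|apply H1|apply H3]. intros k. split; [apply Cmod_ge_0|]. unfold ssub.
    replace (th t' k) with (th t k + (th t' k - th t k))%C at 1 by ring. apply Cmod_triangle. }
  destruct (Hnorm_sobolev p (th t) (Hnorm p (th t') + Hnorm p (ssub (th t') (th t)))) as [_ H5].
  { eapply sobolev_le_add; [|apply H2|apply H3]. intros k. split; [apply Cmod_ge_0|]. unfold ssub.
    replace (th t k) with (th t' k - (th t' k - th t k))%C at 1 by ring. apply Cmod_minus_le. }
  apply Rabs_le. lra.
Qed.

Lemma in_CV_bound T p v : 0 <= T -> in_CV T p v ->
  forall t, 0 <= t <= T -> sobolev_le p (fun k => vmod (v t k)) (LinfV T p v).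
Proof.
  intros HT H t Ht. destruct (cont_on_bounded T _ HT (Vnorm_cont T p v H)) as [B HB].
  destruct (sup_on_correct T (fun t => Vnorm p (v t)) B HT HB) as [H1 _].
  eapply sobolev_le_weaken; [apply (H1 t Ht)|]. apply in_V_sobolev, H, Ht.
Qed.

Lemma in_CH_bound T p th : 0 <= T -> in_CH T p th ->
  forall t, 0 <= t <= T -> sobolev_le p (fun k => Cmod (th t k)) (LinfH T p th).
Proof.
  intros HT H t Ht. destruct (cont_on_bounded T _ HT (Hnorm_cont T p th H)) as [B HB].
  destruct (sup_on_correct T (fun t => Hnorm p (th t)) B HT HB) as [H1 _].
  eapply sobolev_le_weaken; [apply (H1 t Ht)|]. apply in_H_sobolev, H, Ht.
Qed.

Lemma in_CV_diff_sobolev T p v t t' : in_CV T p v -> 0 <= t <= T -> 0 <= t' <= T ->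
  sobolev_le p (fun k => vmod (vsub (v t') (v t) k)) (Vnorm p (vsub (v t') (v t))).
Proof.
  intros [Hin _] Ht Ht'.
  apply (Vnorm_sobolev p _ _ (sobolev_vsub p _ _ _ _
    (in_V_sobolev p _ (Hin t' Ht')) (in_V_sobolev p _ (Hin t Ht)))).
Qed.

Lemma in_CH_diff_sobolev T p th t t' : in_CH T p th -> 0 <= t <= T -> 0 <= t' <= T ->
  sobolev_le p (fun k => Cmod (ssub (th t') (th t) k)) (Hnorm p (ssub (th t') (th t))).
Proof.
  intros [Hin _] Ht Ht'.
  apply (Hnorm_sobolev p _ _ (sobolev_ssub p _ _ _ _
    (in_H_sobolev p _ (Hin t' Ht')) (in_H_sobolev p _ (Hin t Ht)))).
Qed.

Lemma sobolev_mode_le p f B k : k <> z0 -> 0 <= p -> 0 <= f k -> sobolev_le p f B -> f k <= B.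
Proof.
  intros Hk Hp Hf H. assert (H1 := sobolev_le_point p f B k H).
  assert (H2 := kpow_ge1 k p Hk Hp). nra.
Qed.

Lemma velocity_mode_cont T p v k a : 0 <= p -> k <> z0 -> in_CV T p v ->
  ccont_on T (fun t => v t k a).
Proof.
  intros Hp Hk H.
  apply (ccont_on_dominated T _ (fun t' t => Vnorm p (vsub (v t') (v t))) 1); try lra; [|apply H].
  intros z t t' Ht Ht'. rewrite Rmult_1_l. eapply Rle_trans; [apply cdot_abs|].
  apply Rmult_le_compat_l; [apply Cmod_ge_0|].
  apply Rle_trans with (vmod (vsub (v t') (v t) k)); [apply (Cmod_le_vmod (vsub (v t') (v t) k) a)|].
  apply (sobolev_mode_le p (fun k => vmod (vsub (v t') (v t) k))); auto using vmod_ge0.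
  now apply (in_CV_diff_sobolev T).
Qed.

Lemma scalar_mode_cont T p th k : 0 <= p -> k <> z0 -> in_CH T p th ->
  ccont_on T (fun t => th t k).
Proof.
  intros Hp Hk H.
  apply (ccont_on_dominated T _ (fun t' t => Hnorm p (ssub (th t') (th t))) 1); try lra; [|apply H].
  intros z t t' Ht Ht'. rewrite Rmult_1_l. eapply Rle_trans; [apply cdot_abs|].
  apply Rmult_le_compat_l; [apply Cmod_ge_0|].
  apply (sobolev_mode_le p (fun k => Cmod (ssub (th t') (th t) k))); auto using Cmod_ge_0.
  now apply (in_CH_diff_sobolev T).
Qed.

(** The transported field [g] and its modulus of continuity [h] are abstract so as to cover both a
    component of v and theta. *)
Lemma transport_mode_cont T al p v (g : R -> sfield) (h : R -> R -> R) B k (Nf : R -> C) :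
  0 <= T -> 0 <= al -> 0 <= p -> in_CV T p v ->
  (forall t, 0 <= t <= T -> sobolev_le 1 (fun k => Cmod (g t k)) B) ->
  (forall t t', 0 <= t <= T -> 0 <= t' <= T ->
    sobolev_le 1 (fun k => Cmod (ssub (g t') (g t) k)) (h t' t)) ->
  (forall t, 0 <= t <= T -> forall eps, 0 < eps -> exists delta, 0 < delta /\
    forall t', 0 <= t' <= T -> Rabs (t' - t) < delta -> h t' t < eps) ->
  (forall t, 0 <= t <= T ->
    is_zsumC (fun l => (dotgrad (uvel al (v t)) k l * g t l)%C) (Nf t)) ->
  ccont_on T Nf.
Proof.
  intros HT Hal Hp Hv HB Hh Hhc HN.
  assert (HB0 : 0 <= B) by (apply (HB 0); lra).
  assert (HA0 : 0 <= LinfV T p v) by (apply (in_CV_bound T p v HT Hv 0); lra).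
  set (A := LinfV T p v) in *.
  apply (ccont_on_dominated T _ (fun t' t => Vnorm p (vsub (v t') (v t)) + h t' t) (3 * (A + B))).
  - lra.
  - intros z t t' Ht Ht'. eapply Rle_trans.
    + apply (transport_mode_diff al k (v t') (v t) (g t') (g t) (Nf t') (Nf t) z
        (Vnorm p (vsub (v t') (v t))) (h t' t) A B); auto.
      * apply Hv; auto.
      * apply Hv; auto.
      * apply (sobolev_le_lower 0 p); auto using vmod_ge0. now apply (in_CV_diff_sobolev T).
      * apply (sobolev_le_lower 0 p); auto using vmod_ge0. now apply in_CV_bound.
    + apply Rmult_le_compat_l; [apply Cmod_ge_0|].
      assert (H1 := Vnorm_ge0 p (vsub (v t') (v t))).
      assert (H2 : 0 <= h t' t) by (apply (Hh t t'); auto).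
      assert (H3 := Rmult_le_pos _ _ HA0 H1). assert (H4 := Rmult_le_pos _ _ HB0 H2). lra.
  - intros t Ht eps Heps.
    destruct (proj2 Hv t Ht (eps / 2)) as (d1 & Hd1 & H1); [lra|].
    destruct (Hhc t Ht (eps / 2)) as (d2 & Hd2 & H2); [lra|].
    exists (Rmin d1 d2). split; [now apply Rmin_pos|]. intros t' Ht' Hd.
    specialize (H1 t' Ht' (Rlt_le_trans _ _ _ Hd (Rmin_l _ _))).
    specialize (H2 t' Ht' (Rlt_le_trans _ _ _ Hd (Rmin_r _ _))). lra.
Qed.

(** Continuity of the integrands turns the equations integrated in time into derivatives of single
    modes, as the energy computation needs. *)
Lemma solution_modes nu al be r T v0 th0 v th :
  0 <= T -> 0 <= al -> 1 <= r - be -> 1 <= r ->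
  is_solution nu al be T v0 th0 v th -> in_CV T r v -> in_CH T (r - be) th ->
  exists (NB : R -> vfield) (NT : R -> sfield),
    (forall t, 0 <= t <= T -> forall k a,
       is_zsumC (fun l => (dotgrad (uvel al (v t)) k l * v t l a)%C) (NB t k a)) /\
    (forall t, 0 <= t <= T -> forall k,
       is_zsumC (fun l => (dotgrad (uvel al (v t)) k l * th t l)%C) (NT t k)) /\
    (forall k a, k <> z0 -> cderiv_on T (fun t => v t k a)
       (fun s => (- leray k (NB s k) a - RtoC (nu * kpow k (2 * be)) * v s k a
                  + leray k (e3times (th s k)) a)%C)) /\
    (forall k, k <> z0 -> cderiv_on T (fun t => th t k) (fun s => (- NT s k)%C)).
Proof.
  intros HT Hal Hr1 Hr2 (_ & _ & NB & NT & HNB & HNT & Hv & Ht) Hcv Hch.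
  exists NB, NT. split; [exact HNB|split; [exact HNT|split]].
  - intros k a Hk. apply (cderiv_on_is_RInt T _ _ (v0 k a)); [|intros t Ht'; now apply Hv].
    unfold Cminus. apply ccont_on_plus; [apply ccont_on_plus|].
    + apply ccont_on_opp, ccont_on_leray. intros b.
      apply (transport_mode_cont T al r v (fun t l => v t l b)
        (fun t' t => Vnorm r (vsub (v t') (v t))) (LinfV T r v) k); auto; try lra.
      * intros t Ht'. apply (sobolev_le_mono 1 r _ (fun k => vmod (v t k))); auto.
        -- intros m. split; [apply Cmod_ge_0|apply (Cmod_le_vmod (v t m) b)].
        -- now apply in_CV_bound.
      * intros t t' Ht1 Ht2. apply (sobolev_le_mono 1 r _ (fun k => vmod (vsub (v t') (v t) k))); auto.
        -- intros m. split; [apply Cmod_ge_0|apply (Cmod_le_vmod (vsub (v t') (v t) m) b)].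
        -- now apply (in_CV_diff_sobolev T).
      * apply Hcv.
    + apply ccont_on_opp, ccont_on_scal. apply (velocity_mode_cont T r); auto; lra.
    + apply ccont_on_leray. intros b. destruct b; simpl;
        try (split; apply cont_on_const). apply (scalar_mode_cont T (r - be)); auto; lra.
  - intros k Hk. apply (cderiv_on_is_RInt T _ _ (th0 k)); [|intros t Ht'; now apply Ht].
    apply ccont_on_opp.
    apply (transport_mode_cont T al r v th
      (fun t' t => Hnorm (r - be) (ssub (th t') (th t))) (LinfH T (r - be) th) k); auto; try lra.
    + intros t Ht'. apply (sobolev_le_lower 1 (r - be)); auto using Cmod_ge_0. now apply in_CH_bound.
    + intros t t' Ht1 Ht2. apply (sobolev_le_lower 1 (r - be)); auto using Cmod_ge_0.
      now apply (in_CH_diff_sobolev T).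
    + apply Hch.
Qed.

(** * Interpolation and absorption *)

Lemma fsum_filter {A} (b : A -> bool) (L : list A) f :
  fsum (filter b L) f = fsum L (fun k => if b k then f k else 0).
Proof.
  induction L as [|k L IH]; [reflexivity|].
  cbn [filter]. destruct (b k) eqn:E; cbn; rewrite E; [f_equal; exact IH|].
  rewrite Rplus_0_l. exact IH.
Qed.

(** High frequencies, where eps |k|^(2(2 be - 1)) >= 1, are bounded by the first term. At the
    remaining ones |k|^2 is at most the constant, and 2(1 - be) <= 2. Here be > 1/2 makes the
    exponent 2 be - 1 positive. *)
Lemma kpow_interpolation k be eps : 1 / 2 < be -> 0 < eps -> k <> z0 ->
  kpow k (2 * (1 - be)) <= eps * kpow k (2 * be) + Rpower (1 / eps) (1 / (2 * be - 1)).
Proof.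
  intros Hbe He Hk. assert (Hx := kpow_pos k (2 * be) Hk).
  assert (HC : 0 < Rpower (1 / eps) (1 / (2 * be - 1))) by apply exp_pos.
  assert (Hy := kpow_pos k (2 * (2 * be - 1)) Hk).
  assert (Hz := kpow_pos k (2 * (1 - be)) Hk).
  destruct (Rle_dec 1 (eps * kpow k (2 * (2 * be - 1)))) as [H|H].
  - apply Rle_trans with (eps * kpow k (2 * be)); [|lra].
    replace (2 * be) with (2 * (2 * be - 1) + 2 * (1 - be)) by ring.
    rewrite kpow_plus. rewrite <- Rmult_assoc.
    rewrite <- (Rmult_1_l (kpow k (2 * (1 - be)))) at 1. apply Rmult_le_compat_r; lra.
  - apply Rle_trans with (Rpower (1 / eps) (1 / (2 * be - 1))).
    2: { assert (0 <= eps * kpow k (2 * be)) by (apply Rmult_le_pos; lra). lra. }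
    apply Rle_trans with (kpow k 2); [apply kpow_le; lra|].
    replace (kpow k 2) with (Rpower (kpow k (2 * (2 * be - 1))) (1 / (2 * be - 1))).
    + apply Rle_Rpower_l.
      * left. apply Rdiv_lt_0_compat; lra.
      * split; auto. apply Rle_div_r; lra.
    + rewrite (kpow_Rpower k 2), (kpow_Rpower k (2 * (2 * be - 1))), Rpower_mult by auto.
      f_equal. field. lra.
Qed.

(** Inside the cube the frequencies are interpolated between [W] and [D]. Outside, 2(r - be) <= 2r -
    1 leaves one power of |k| >= N + 1 to spare against the bound [M] in V^r, whence M^2 / (N +
    1). *)
Lemma sobolev_interpolation be r N f W M D eps :
  1 / 2 < be -> 0 < eps ->
  sobolev_le (r - 1) f W -> sobolev_le r f M ->
  fsum (cube N) (fun k => (kpow k (r - 1 + be) * f k) ^ 2) <= D ^ 2 ->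
  sobolev_le (r - be) f
    (sqrt (eps * D ^ 2 + Rpower (1 / eps) (1 / (2 * be - 1)) * W ^ 2 + M ^ 2 / (INR N + 1))).
Proof.
  intros Hbe He [HW0 HW] [HM0 HM] HD.
  set (C := Rpower _ _). assert (HC : 0 < C) by apply exp_pos.
  assert (HN := pos_INR N).
  assert (HMN : 0 <= M ^ 2 / (INR N + 1)) by (apply Rdiv_le_0_compat; [apply pow2_ge_0|lra]).
  assert (HD2 := pow2_ge_0 D). assert (HW2 := pow2_ge_0 W).
  assert (HeD : 0 <= eps * D ^ 2) by (apply Rmult_le_pos; lra).
  assert (HCW : 0 <= C * W ^ 2) by (apply Rmult_le_pos; lra).
  split; [apply sqrt_pos|]. rewrite <- (Rsqr_pow2 (sqrt _)), Rsqr_sqrt by lra.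
  intros L HL.
  set (inN := fun k => if In_dec Z3_eq_dec k (cube N) then true else false).
  apply Rle_trans with (fsum L (fun k =>
    eps * (if inN k then (kpow k (r - 1 + be) * f k) ^ 2 else 0)
    + C * (kpow k (r - 1) * f k) ^ 2 + / (INR N + 1) * (kpow k r * f k) ^ 2)).
  - apply fsum_le. intros k _.
    destruct (Z3_eq_dec k z0) as [->|Hk].
    { rewrite !kpow_z0, !Rmult_0_l. destruct (inN z0); simpl; lra. }
    assert (Hf := pow2_ge_0 (f k)).
    rewrite <- !weight_sq.
    assert (H1 := pow2_ge_0 (kpow k (r - 1) * f k)). rewrite <- weight_sq in H1.
    assert (H2 := pow2_ge_0 (kpow k r * f k)). rewrite <- weight_sq in H2.
    assert (H3 := pow2_ge_0 (kpow k (r - 1 + be) * f k)). rewrite <- weight_sq in H3.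
    assert (Hi : 0 < / (INR N + 1)) by (apply Rinv_0_lt_compat; lra).
    unfold inN. destruct (In_dec Z3_eq_dec k (cube N)) as [Hin|Hin].
    + assert (Hint := kpow_interpolation k be eps Hbe He Hk). fold C in Hint.
      apply (Rmult_le_compat_l (kpow k (2 * (r - 1)))) in Hint; [|apply kpow_ge0].
      apply (Rmult_le_compat_r (f k ^ 2)) in Hint; [|lra].
      rewrite <- kpow_plus in Hint.
      replace (2 * (r - 1) + 2 * (1 - be)) with (2 * (r - be)) in Hint by ring.
      replace (2 * (r - 1 + be)) with (2 * (r - 1) + 2 * be) by ring.
      rewrite kpow_plus.
      assert (0 <= / (INR N + 1) * (kpow k (2 * r) * f k ^ 2)) by (apply Rmult_le_pos; lra).
      lra.
    + assert (Hout := kpow_outside_cube k N Hin).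
      assert (Hle : kpow k (2 * (r - be)) <= / (INR N + 1) * kpow k (2 * r)).
      { replace (kpow k (2 * r)) with (kpow k 1 * kpow k (2 * r - 1))
          by (rewrite <- kpow_plus; f_equal; ring).
        apply Rle_trans with (kpow k (2 * r - 1)); [apply kpow_le; lra|].
        rewrite <- Rmult_assoc. rewrite <- (Rmult_1_l (kpow k (2 * r - 1))) at 1.
        apply Rmult_le_compat_r; [apply kpow_ge0|].
        apply (Rmult_le_compat_l (/ (INR N + 1))) in Hout; [|lra].
        rewrite Rinv_l in Hout; lra. }
      apply (Rmult_le_compat_r (f k ^ 2)) in Hle; [|lra].
      assert (0 <= C * (kpow k (2 * (r - 1)) * f k ^ 2)) by (apply Rmult_le_pos; lra).
      lra.
  - rewrite !fsum_plus, !fsum_scal, <- fsum_filter.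
    apply Rplus_le_compat; [apply Rplus_le_compat|].
    + apply Rmult_le_compat_l; [lra|]. eapply Rle_trans; [|apply HD].
      apply fsum_incl; [now apply NoDup_filter| |intros; apply pow2_ge_0].
      intros k Hk. apply filter_In in Hk. destruct Hk as [_ Hk]. unfold inN in Hk.
      destruct (In_dec Z3_eq_dec k (cube N)); easy.
    + apply Rmult_le_compat_l; [lra|]. now apply HW.
    + unfold Rdiv. rewrite Rmult_comm. apply Rmult_le_compat_r; [|now apply HM].
      left. apply Rinv_0_lt_compat. lra.
Qed.

(** Three products with [D], namely those of B G, B W and H, each cost nu D^2 / 8, and the
    interpolated G^2 costs the same once more. These four make nu D^2 / 2, so half of the
    dissipation survives. *)
Lemma absorption (nu c1 c2 c3 c4 a b m W H D C delta eps G X1 X3 X4 : R) :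
  0 < nu -> 0 <= c1 -> 0 <= c2 -> 0 <= c3 -> 0 <= c4 -> 0 <= a -> 0 <= b -> 0 <= m ->
  0 <= W -> 0 <= H -> 0 <= D -> 0 <= C -> 0 <= delta ->
  eps = nu ^ 2 / (16 * ((c2 * b) ^ 2 + 1)) ->
  G ^ 2 = eps * D ^ 2 + C * W ^ 2 + delta ->
  X1 <= c1 * a * W ^ 2 + c2 * b * (G + W) * D ->
  X3 <= H * D -> X4 <= c3 * m * W * H + c4 * b * H ^ 2 ->
  2 * (X1 - nu * D ^ 2 + X3 + X4) <= - nu * D ^ 2
    + 2 * (c1 * a + 2 / nu * (c2 * b) ^ 2 * (C + 1) + 2 / nu + c3 * m + c4 * b) * (W ^ 2 + H ^ 2)
    + 4 / nu * (c2 * b) ^ 2 * delta.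
Proof.
  intros Hnu Hc1 Hc2 Hc3 Hc4 Ha Hb Hm HW HH HD HC Hdl Heps HG H1 H3 H4.
  set (B := c2 * b) in *. assert (HB : 0 <= B) by (apply Rmult_le_pos; auto).
  (* AM-GM: [x D <= nu D^2 / 8 + 2 x^2 / nu] *)
  assert (Hy : forall x, x * D <= nu / 8 * D ^ 2 + 2 / nu * x ^ 2).
  { intros x. assert (Hs := pow2_ge_0 (nu * D - 4 * x)).
    apply Rmult_le_reg_l with (8 * nu); [lra|].
    replace (8 * nu * (nu / 8 * D ^ 2 + 2 / nu * x ^ 2)) with (nu ^ 2 * D ^ 2 + 16 * x ^ 2) by (field; lra).
    lra. }
  assert (HyG := Hy (B * G)). assert (HyW := Hy (B * W)). assert (HyH := Hy H).
  assert (HGe : 2 / nu * (B * G) ^ 2 <= nu / 8 * D ^ 2 + 2 / nu * B ^ 2 * (C * W ^ 2 + delta)).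
  { replace ((B * G) ^ 2) with (B ^ 2 * G ^ 2) by ring. rewrite HG.
    (* The value of [eps] is chosen for this inequality; the + 1 in its denominator keeps it defined
       for B = 0. *)
    assert (He : 2 / nu * B ^ 2 * eps <= nu / 8).
    { rewrite Heps. assert (HB2 := pow2_ge_0 B).
      apply Rmult_le_reg_r with (8 * (B ^ 2 + 1) / nu).
      { apply Rdiv_lt_0_compat; lra. }
      field_simplify; try lra. }
    assert (HD2 := pow2_ge_0 D).
    apply (Rmult_le_compat_r (D ^ 2)) in He; lra. }
  assert (Hn2 : 0 < 2 / nu) by (apply Rdiv_lt_0_compat; lra).
  assert (HWH : W * H <= W ^ 2 + H ^ 2) by (assert (Hs := pow2_ge_0 (W - H)); assert (Hs' := pow2_ge_0 (W + H)); nra).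
  assert (Hc3m : 0 <= c3 * m) by (apply Rmult_le_pos; auto).
  assert (Hc4b : 0 <= c4 * b) by (apply Rmult_le_pos; auto).
  assert (Hc1a : 0 <= c1 * a) by (apply Rmult_le_pos; auto).
  assert (HW2 := pow2_ge_0 W). assert (HH2 := pow2_ge_0 H). assert (HB2 := pow2_ge_0 B).
  apply (Rmult_le_compat_l (c3 * m)) in HWH; auto.
  set (q := 2 / nu) in *.
  replace (4 / nu) with (2 * q) by (unfold q; field; lra).
  assert (P1 := Rmult_le_pos _ _ Hc1a HH2). assert (P2 := Rmult_le_pos _ _ Hc4b HW2).
  assert (P3 := Rmult_le_pos _ _ (Rlt_le _ _ Hn2) HW2).
  assert (P4 := Rmult_le_pos _ _ (Rlt_le _ _ Hn2) HB2).
  assert (HC1 : 0 <= C + 1) by lra.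
  assert (P5 := Rmult_le_pos _ _ (Rmult_le_pos _ _ P4 HC1) HH2).
  assert (P6 := Rmult_le_pos _ _ P4 HW2).
  lra.
Qed.

Lemma weighted_norm_lim p (f g : Z3 -> R) B :
  (forall k, g k = (kpow k p * f k) ^ 2) -> sobolev_le p f B ->
  is_lim_seq (fun N => fsum (cube N) (fun k => (kpow k p * f k) ^ 2)) (sqrt (real (zsum3 g)) ^ 2).
Proof.
  intros E [HB H].
  assert (Hg : forall k, 0 <= g k) by (intros; rewrite E; apply pow2_ge_0).
  destruct (zsum3_bound g (B ^ 2) Hg) as [H1 _].
  { intros N. rewrite (fsum_ext _ _ (fun k => (kpow k p * f k) ^ 2)) by auto.
    apply H, cube_NoDup. }
  assert (0 <= real (zsum3 g)) by (apply (zsum3_summable g Hg H1 []); constructor).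
  rewrite <- Rsqr_pow2, Rsqr_sqrt, H1 by auto.
  apply is_lim_seq_ext with (cube_sum g).
  { intros N. rewrite cube_sum_fsum. apply fsum_ext. auto. }
  apply Lim_seq_correct, ex_lim_seq_incr. intros n. rewrite !cube_sum_fsum.
  apply fsum_incl; auto using cube_NoDup. apply cube_incl. lia.
Qed.

Lemma lim_over_INR c : is_lim_seq (fun n => c / (INR n + 1)) 0.
Proof.
  replace (Finite 0) with (Rbar_mult c (Rbar_inv p_infty)) by (simpl; f_equal; ring).
  apply (is_lim_seq_scal_l (fun n => / (INR n + 1))).
  apply is_lim_seq_inv; [|easy].
  apply is_lim_seq_ext with (fun n => INR (S n)); [intros; apply S_INR|].
  apply is_lim_seq_incr_1 with (u := INR), is_lim_seq_INR.
Qed.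

Lemma cutoff_lim s k : is_lim_seq (fun N => cutoff s N k) (kpow k s).
Proof.
  unfold cutoff. replace (Finite (kpow k s)) with (Rbar_mult (kpow k s) (1 - 0)).
  2: { simpl. f_equal. ring. }
  apply (is_lim_seq_scal_l (fun N => Rmax 0 (1 - kpow k 1 / (INR N + 1)))).
  assert (H : is_lim_seq (fun N => 1 - kpow k 1 / (INR N + 1)) (1 - 0)).
  { apply is_lim_seq_minus'; [apply is_lim_seq_const|apply lim_over_INR]. }
  apply is_lim_seq_ext_loc with (2 := H).
  destruct (nfloor_ex (kpow k 1) (kpow_ge0 k 1)) as [n [_ Hn]].
  exists n. intros N HN. apply le_INR in HN.
  rewrite Rmax_right; auto.
  assert (kpow k 1 / (INR N + 1) <= 1); [|lra].
  apply Rle_div_l; [assert (H0 := kpow_ge0 k 1)|]; lra.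
Qed.

(** * Energy estimate for the difference of two solutions *)

Lemma deriv_on_zero T x g : (forall t, x t = 0) -> (forall t, g t = 0) -> deriv_on T x g.
Proof.
  intros Hx Hg. eapply deriv_on_ext; [| |apply (deriv_on_of_is_derive T (fun _ => 0) (fun _ => 0))].
  - intros; now rewrite Hx.
  - intros; now rewrite Hg.
  - intros t. apply (is_derive_const (V := R_NormedModule)).
Qed.

Lemma fsum_combination {A} (L : list A) c (x y z : A -> R) :
  fsum L (fun k => 2 * (- x k - c * y k + z k))
  = 2 * (- fsum L x - c * fsum L y + fsum L z).
Proof.
  induction L as [|k L IH]; [cbn; ring|].
  change (2 * (- x k - c * y k + z k) + fsum L (fun k => 2 * (- x k - c * y k + z k))
    = 2 * (- (x k + fsum L x) - c * (y k + fsum L y) + (z k + fsum L z))).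
  rewrite IH. ring.
Qed.

(** Pairing with the divergence-free difference removes both Leray projections. The last hypothesis
    ranges over the two solutions in order to state their common equation once. *)
Lemma momentum_mode_energy T nu be r k (v1 v2 : R -> vfield) (th1 th2 : R -> sfield)
    (NB1 NB2 : R -> vfield) :
  (forall t, 0 <= t <= T -> divergence_free (v1 t)) ->
  (forall t, 0 <= t <= T -> divergence_free (v2 t)) ->
  (forall (v NB : R -> vfield) (th : R -> sfield),
    (v = v1 /\ th = th1 /\ NB = NB1) \/ (v = v2 /\ th = th2 /\ NB = NB2) ->
    forall a, k <> z0 -> cderiv_on T (fun t => v t k a)
       (fun s => (- leray k (NB s k) a - RtoC (nu * kpow k (2 * be)) * v s k a
                  + leray k (e3times (th s k)) a)%C)) ->
  deriv_on T (fun t => kpow k (2 * (r - 1)) * vmod2 (vsub (v1 t) (v2 t) k))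
    (fun t => 2 * (- (kpow k (2 * (r - 1)) * vdot (vsub (v1 t) (v2 t) k) (fun a => (NB1 t k a - NB2 t k a)%C))
      - nu * (kpow k (r - 1 + be) * vmod (vsub (v1 t) (v2 t) k)) ^ 2
      + kpow k (2 * (r - 1)) * cdot (vsub (v1 t) (v2 t) k A3) (ssub (th1 t) (th2 t) k))).
Proof.
  intros Hd1 Hd2 H.
  destruct (Z3_eq_dec k z0) as [->|Hk].
  { apply deriv_on_zero; intros t; rewrite !kpow_z0; ring. }
  set (R1 := fun s a => (- leray k (NB1 s k) a - RtoC (nu * kpow k (2 * be)) * v1 s k a
                  + leray k (e3times (th1 s k)) a)%C).
  set (R2 := fun s a => (- leray k (NB2 s k) a - RtoC (nu * kpow k (2 * be)) * v2 s k a
                  + leray k (e3times (th2 s k)) a)%C).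
  assert (Hc : forall a, deriv_on T (fun t => Cmod (vsub (v1 t) (v2 t) k a) ^ 2)
    (fun t => 2 * cdot (vsub (v1 t) (v2 t) k a) (R1 t a - R2 t a)%C)).
  { intros a. apply (cderiv_on_Cmod_sq T (fun t => vsub (v1 t) (v2 t) k a)).
    apply (cderiv_on_minus T (fun t => v1 t k a) (fun t => v2 t k a) (fun t => R1 t a) (fun t => R2 t a)).
    - apply (H v1 NB1 th1); auto.
    - apply (H v2 NB2 th2); auto. }
  eapply deriv_on_ext; [| |apply (deriv_on_scal T (kpow k (2 * (r - 1)))),
    (deriv_on_plus _ _ _ _ _ (deriv_on_plus _ _ _ _ _ (Hc A1) (Hc A2)) (Hc A3))].
  { intros t _. reflexivity. }
  intros t Ht. cbv beta. set (w := vsub (v1 t) (v2 t) k).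
  assert (Hw : (RtoC (kc k A1) * w A1 + RtoC (kc k A2) * w A2 + RtoC (kc k A3) * w A3)%C = 0%C).
  { assert (E1 := Hd1 t Ht k). assert (E2 := Hd2 t Ht k). unfold w, vsub.
    transitivity ((RtoC (kc k A1) * v1 t k A1 + RtoC (kc k A2) * v1 t k A2 + RtoC (kc k A3) * v1 t k A3)
      - (RtoC (kc k A1) * v2 t k A1 + RtoC (kc k A2) * v2 t k A2 + RtoC (kc k A3) * v2 t k A3))%C; [ring|].
    rewrite E1, E2. ring. }
  assert (L1 := vdot_leray k w (NB1 t k) Hw). assert (L2 := vdot_leray k w (NB2 t k) Hw).
  assert (L3 := vdot_leray k w (e3times (th1 t k)) Hw). assert (L4 := vdot_leray k w (e3times (th2 t k)) Hw).
  transitivity (kpow k (2 * (r - 1)) * (2 * (- (vdot w (leray k (NB1 t k)) - vdot w (leray k (NB2 t k)))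
    - nu * kpow k (2 * be) * vmod2 w
    + (vdot w (leray k (e3times (th1 t k))) - vdot w (leray k (e3times (th2 t k))))))).
  - unfold vmod2. rewrite <- !cdot_self. unfold R1, R2, w, vsub, vdot, cdot. simpl. ring.
  - rewrite L1, L2, L3, L4, <- weight_sq, vmod_sq.
    replace (2 * (r - 1 + be)) with (2 * (r - 1) + 2 * be) by ring. rewrite (kpow_plus k (2 * (r - 1))).
    fold w. unfold vdot, cdot, ssub, e3times. simpl. ring.
Qed.

Lemma scalar_mode_energy T be r N k (th1 th2 NT1 NT2 : R -> sfield) :
  (k <> z0 -> cderiv_on T (fun t => th1 t k) (fun s => (- NT1 s k)%C)) ->
  (k <> z0 -> cderiv_on T (fun t => th2 t k) (fun s => (- NT2 s k)%C)) ->
  deriv_on T (fun t => cutoff (r - be - 1) N k ^ 2 * Cmod (ssub (th1 t) (th2 t) k) ^ 2)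
    (fun t => 2 * - (cutoff (r - be - 1) N k ^ 2 * cdot (ssub (th1 t) (th2 t) k) (NT1 t k - NT2 t k)%C)).
Proof.
  intros H1 H2.
  destruct (Z3_eq_dec k z0) as [->|Hk].
  { apply deriv_on_zero; intros t; unfold cutoff; rewrite !kpow_z0; ring. }
  eapply deriv_on_ext; [| |apply (deriv_on_scal T (cutoff (r - be - 1) N k ^ 2)), cderiv_on_Cmod_sq,
    (cderiv_on_minus T _ _ _ _ (H1 Hk) (H2 Hk))].
  - intros t _. reflexivity.
  - intros t _. unfold cdot, ssub. simpl. ring.
Qed.

(** The coefficient of W^2 + H^2 in [absorption]. The constants [c1] and [c2] come from the two
    momentum terms, [c3] and [c4] from the two scalar terms, and [Ce] from interpolation. *)
Definition growth_rate (nu be r S a b m : R) : R :=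
  let c1 := 9 * (Rpower 2 (r - 1) * (2 * sqrt S)) in
  let c2 := 9 * (Rpower 2 (r - 1 - be) * sqrt S) in
  let c3 := 3 * (Rpower 2 (r - be - 1) * (2 * sqrt S)) in
  let c4 := 3 * ((r - be - 1 + 1) * Rpower 2 (r - be - 1 - 1) * (2 * sqrt S)) in
  let eps := nu ^ 2 / (16 * ((c2 * b) ^ 2 + 1)) in
  let Ce := Rpower (1 / eps) (1 / (2 * be - 1)) in
  2 * (c1 * a + 2 / nu * (c2 * b) ^ 2 * (Ce + 1) + 2 / nu + c3 * m + c4 * b).

Lemma growth_rate_ge0 nu be r S a b m :
  0 < nu -> be + 2 < r -> 0 <= a -> 0 <= b -> 0 <= m -> 0 <= growth_rate nu be r S a b m.
Proof.
  intros Hnu Hr Ha Hb Hm. unfold growth_rate. assert (Hs := sqrt_pos S).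
  set (c2 := 9 * (Rpower 2 (r - 1 - be) * sqrt S)).
  assert (H2 : 0 < 2 / nu) by (apply Rdiv_lt_0_compat; lra).
  assert (Hx := pow2_ge_0 (c2 * b)).
  assert (Hp' : forall x y, 0 <= Rpower x y) by (intros; left; apply exp_pos).
  assert (Hp := Hp' 2).
  apply Rmult_le_pos; [lra|]. repeat apply Rplus_le_le_0_compat.
  - repeat apply Rmult_le_pos; auto; lra.
  - apply Rmult_le_pos; [apply Rmult_le_pos; lra|]. cbv zeta.
    apply Rplus_le_le_0_compat; [apply Hp'|lra].
  - lra.
  - repeat apply Rmult_le_pos; auto; lra.
  - repeat apply Rmult_le_pos; auto; lra.
Qed.

Lemma dissipation_cont T nu be r k (v1 v2 : R -> vfield) (th1 th2 : R -> sfield)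
    (NB1 NB2 : R -> vfield) :
  (forall t, 0 <= t <= T -> divergence_free (v1 t)) ->
  (forall t, 0 <= t <= T -> divergence_free (v2 t)) ->
  (forall k a, k <> z0 -> cderiv_on T (fun t => v1 t k a)
    (fun s => (- leray k (NB1 s k) a - RtoC (nu * kpow k (2 * be)) * v1 s k a
               + leray k (e3times (th1 s k)) a)%C)) ->
  (forall k a, k <> z0 -> cderiv_on T (fun t => v2 t k a)
    (fun s => (- leray k (NB2 s k) a - RtoC (nu * kpow k (2 * be)) * v2 s k a
               + leray k (e3times (th2 s k)) a)%C)) ->
  cont_on T (fun t => kpow k (2 * (r - 1 + be)) * vmod2 (vsub (v1 t) (v2 t) k)).
Proof.
  intros Hd1 Hd2 Hv1 Hv2.
  (* The dissipation of a mode is its energy with r + be in place of r, so it is continuous because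
     that energy is differentiable. *)
  apply cont_on_ext with (fun t => kpow k (2 * (r + be - 1)) * vmod2 (vsub (v1 t) (v2 t) k)).
  { intros t _. f_equal. f_equal. ring. }
  eapply deriv_on_cont, (momentum_mode_energy T nu be (r + be) k v1 v2 th1 th2 NB1 NB2); auto.
  intros v NB th [(-> & -> & ->)|(-> & -> & ->)] c Hk; auto.
Qed.

Section Difference.
Variables (nu al be r T S : R) (v1 v2 : R -> vfield) (th1 th2 : R -> sfield).
Variables (NB1 NB2 : R -> vfield) (NT1 NT2 : R -> sfield) (a b m m2 : R).
Hypotheses (Hnu : 0 < nu) (Hal : 0 <= al) (Hbe : 1 / 2 < be) (Hr : be + 2 < r) (HT : 0 <= T).
Hypotheses (HS0 : 0 <= S) (HS : summable_le (fun k => kpow k (- (2 * (be + 1)))) S).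
Hypotheses (Hin1 : forall t, 0 <= t <= T -> in_V r (v1 t)).
Hypotheses (Hin2 : forall t, 0 <= t <= T -> in_V r (v2 t)).
Hypotheses (Hth1 : forall t, 0 <= t <= T -> th1 t z0 = 0%C).
Hypotheses (Hth2 : forall t, 0 <= t <= T -> th2 t z0 = 0%C).
Hypotheses (Ha : forall t, 0 <= t <= T -> sobolev_le r (fun k => vmod (v1 t k)) a).
Hypotheses (Hb : forall t, 0 <= t <= T -> sobolev_le r (fun k => vmod (v2 t k)) b).
Hypotheses (Hm : forall t, 0 <= t <= T -> sobolev_le (r - be) (fun k => Cmod (th1 t k)) m).
Hypotheses (Hm2 : forall t, 0 <= t <= T -> sobolev_le (r - be) (fun k => Cmod (th2 t k)) m2).
Hypotheses (HNB1 : forall t, 0 <= t <= T -> forall k a,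
  is_zsumC (fun l => (dotgrad (uvel al (v1 t)) k l * v1 t l a)%C) (NB1 t k a)).
Hypotheses (HNB2 : forall t, 0 <= t <= T -> forall k a,
  is_zsumC (fun l => (dotgrad (uvel al (v2 t)) k l * v2 t l a)%C) (NB2 t k a)).
Hypotheses (HNT1 : forall t, 0 <= t <= T -> forall k,
  is_zsumC (fun l => (dotgrad (uvel al (v1 t)) k l * th1 t l)%C) (NT1 t k)).
Hypotheses (HNT2 : forall t, 0 <= t <= T -> forall k,
  is_zsumC (fun l => (dotgrad (uvel al (v2 t)) k l * th2 t l)%C) (NT2 t k)).
Hypotheses (Hv1 : forall k a, k <> z0 -> cderiv_on T (fun t => v1 t k a)
  (fun s => (- leray k (NB1 s k) a - RtoC (nu * kpow k (2 * be)) * v1 s k a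
             + leray k (e3times (th1 s k)) a)%C)).
Hypotheses (Hv2 : forall k a, k <> z0 -> cderiv_on T (fun t => v2 t k a)
  (fun s => (- leray k (NB2 s k) a - RtoC (nu * kpow k (2 * be)) * v2 s k a
             + leray k (e3times (th2 s k)) a)%C)).
Hypotheses (Ht1 : forall k, k <> z0 -> cderiv_on T (fun t => th1 t k) (fun s => (- NT1 s k)%C)).
Hypotheses (Ht2 : forall k, k <> z0 -> cderiv_on T (fun t => th2 t k) (fun s => (- NT2 s k)%C)).

Let w t := vsub (v1 t) (v2 t).
Let et t := ssub (th1 t) (th2 t).
Let W t := Vnorm (r - 1) (w t).
Let H t := Hnorm (r - be - 1) (et t).
Let vterm k t := kpow k (2 * (r - 1)) * vmod2 (w t k).
Let tterm N k t := cutoff (r - be - 1) N k ^ 2 * Cmod (et t k) ^ 2.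
Let dterm k t := kpow k (2 * (r - 1 + be)) * vmod2 (w t k).

Let c1 := 9 * (Rpower 2 (r - 1) * (2 * sqrt S)).
Let c2 := 9 * (Rpower 2 (r - 1 - be) * sqrt S).
Let c3 := 3 * (Rpower 2 (r - be - 1) * (2 * sqrt S)).
Let c4 := 3 * ((r - be - 1 + 1) * Rpower 2 (r - be - 1 - 1) * (2 * sqrt S)).
Let eps := nu ^ 2 / (16 * ((c2 * b) ^ 2 + 1)).
Let Ce := Rpower (1 / eps) (1 / (2 * be - 1)).
Let K := growth_rate nu be r S a b m.
(** The truncation error times N + 1; (a + b)^2 bounds the squared V^r norm of the difference in the
    tail of the interpolation. *)
Let kap := 4 / nu * (c2 * b) ^ 2 * (a + b) ^ 2.

Let Hw_r t : 0 <= t <= T -> sobolev_le r (fun k => vmod (w t k)) (a + b).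
Proof. intros Ht. apply sobolev_vsub; auto. Qed.

Let HW t : 0 <= t <= T -> sobolev_le (r - 1) (fun k => vmod (w t k)) (W t).
Proof.
  intros Ht. apply (Vnorm_sobolev (r - 1) (w t) (a + b)).
  apply (sobolev_le_lower (r - 1) r); auto using vmod_ge0. lra.
Qed.

Let HH t : 0 <= t <= T -> sobolev_le (r - be - 1) (fun k => Cmod (et t k)) (H t).
Proof.
  intros Ht. apply (Hnorm_sobolev (r - be - 1) (et t) (m + m2)).
  apply (sobolev_le_lower (r - be - 1) (r - be)); auto using Cmod_ge_0; [lra|].
  apply sobolev_ssub; auto.
Qed.

Let a_ge0 : 0 <= a. Proof. apply (Ha 0). lra. Qed.
Let b_ge0 : 0 <= b. Proof. apply (Hb 0). lra. Qed.
Let m_ge0 : 0 <= m. Proof. apply (Hm 0). lra. Qed.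
Let m2_ge0 : 0 <= m2. Proof. apply (Hm2 0). lra. Qed.
Let c1_ge0 : 0 <= c1.
Proof. unfold c1. assert (Hs := sqrt_pos S). assert (0 < Rpower 2 (r - 1)) by apply exp_pos. nra. Qed.
Let c2_ge0 : 0 <= c2.
Proof. unfold c2. assert (Hs := sqrt_pos S). assert (0 < Rpower 2 (r - 1 - be)) by apply exp_pos. nra. Qed.
Let c3_ge0 : 0 <= c3.
Proof. unfold c3. assert (Hs := sqrt_pos S). assert (0 < Rpower 2 (r - be - 1)) by apply exp_pos. nra. Qed.
Let c4_ge0 : 0 <= c4.
Proof.
  unfold c4. assert (Hs := sqrt_pos S). assert (0 < Rpower 2 (r - be - 1 - 1)) by apply exp_pos.
  repeat apply Rmult_le_pos; lra.
Qed.
Let eps_gt0 : 0 < eps.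
Proof.
  unfold eps. assert (Hx := pow2_ge_0 (c2 * b)). apply Rdiv_lt_0_compat; [|lra]. now apply pow_lt.
Qed.
Let Ce_ge0 : 0 <= Ce. Proof. left. apply exp_pos. Qed.
Let K_ge0 : 0 <= K.
Proof. now apply growth_rate_ge0. Qed.

Let energy_rate N t := fsum (cube N) (fun k =>
  2 * (- (kpow k (2 * (r - 1)) * vdot (w t k) (fun a => (NB1 t k a - NB2 t k a)%C))
      - nu * (kpow k (r - 1 + be) * vmod (w t k)) ^ 2
      + kpow k (2 * (r - 1)) * cdot (w t k A3) (et t k)))
  + fsum (cube N) (fun k =>
  2 * - (cutoff (r - be - 1) N k ^ 2 * cdot (et t k) (NT1 t k - NT2 t k)%C)).

Let energy_deriv N : deriv_on T
  (fun t => fsum (cube N) (fun k => vterm k t) + fsum (cube N) (fun k => tterm N k t)) (energy_rate N).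
Proof.
  apply deriv_on_plus.
  - apply (deriv_on_fsum T (cube N) vterm). intros k _. apply momentum_mode_energy.
    + intros t Ht. exact (proj1 (proj2 (proj2 (Hin1 t Ht)))).
    + intros t Ht. exact (proj1 (proj2 (proj2 (Hin2 t Ht)))).
    + intros v NB th [(-> & -> & ->)|(-> & -> & ->)] c Hk; auto.
  - apply (deriv_on_fsum T (cube N) (tterm N)). intros k _. apply scalar_mode_energy; auto.
Qed.

(** The norms [W] and [H] on the right are not truncated, since low outputs receive all input
    frequencies. This is why Gronwall's lemma has to wait for the limit in N. *)
Let energy_rate_le N t : 0 <= t <= T ->
  energy_rate N t <= - nu * fsum (cube N) (fun k => dterm k t)
    + K * (W t ^ 2 + H t ^ 2) + kap / (INR N + 1).
Proof.
  intros Ht. assert (HN := pos_INR N).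
  set (D2 := fsum (cube N) (fun k => (kpow k (r - 1 + be) * vmod (w t k)) ^ 2)).
  assert (HD2 : 0 <= D2) by (apply fsum_ge0; intros; apply pow2_ge_0).
  set (D := sqrt D2). assert (HD : D ^ 2 = D2) by (unfold D; rewrite <- Rsqr_pow2; now apply Rsqr_sqrt).
  assert (HD0 : 0 <= D) by apply sqrt_pos.
  assert (HW0 : 0 <= W t) by apply (HW t Ht). assert (HH0 : 0 <= H t) by apply (HH t Ht).
  set (delta := (a + b) ^ 2 / (INR N + 1)).
  assert (Hdelta : 0 <= delta) by (apply Rdiv_le_0_compat; [apply pow2_ge_0|lra]).
  set (G := sqrt (eps * D ^ 2 + Ce * W t ^ 2 + delta)).
  assert (HG : sobolev_le (r - be) (fun k => vmod (w t k)) G).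
  { apply sobolev_interpolation; auto. fold D2. lra. }
  assert (HG2 : G ^ 2 = eps * D ^ 2 + Ce * W t ^ 2 + delta).
  { unfold G. rewrite <- Rsqr_pow2. apply Rsqr_sqrt.
    assert (0 <= eps * D ^ 2) by (apply Rmult_le_pos; [lra|apply pow2_ge_0]).
    assert (0 <= Ce * W t ^ 2) by (apply Rmult_le_pos; [auto|apply pow2_ge_0]). lra. }
  destruct (Hin1 t Ht) as (Hz1 & _ & _ & _). destruct (Hin2 t Ht) as (Hz2 & Hre2 & Hdv2 & _).
  assert (B1 := momentum_transport_bound al be r S (v1 t) (v2 t) (NB1 t) (NB2 t) a b (W t) G D N
    Hal Hbe Hr HS0 HS Hz1 Hz2 (Ha t Ht) (Hb t Ht) (HW t Ht) HG HD0 (Req_le _ _ (eq_sym HD))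
    (HNB1 t Ht) (HNB2 t Ht)).
  assert (B4 := scalar_transport_bound al be r S (v1 t) (v2 t) (th1 t) (th2 t) (NT1 t) (NT2 t) m b (W t) (H t) N
    Hal Hbe Hr HS0 HS Hz1 Hz2 (Hth1 t Ht) (Hth2 t Ht) Hre2 Hdv2 (Hm t Ht) (Hb t Ht) (HW t Ht) (HH t Ht)
    (HNT1 t Ht) (HNT2 t Ht)).
  fold (w t) in B1. fold (et t) in B4.
  set (X1 := fsum (cube N) (fun k => kpow k (2 * (r - 1)) * vdot (w t k) (fun a => (NB1 t k a - NB2 t k a)%C))) in *.
  set (X4 := fsum (cube N) (fun k => cutoff (r - be - 1) N k ^ 2 * cdot (et t k) (NT1 t k - NT2 t k)%C)) in *.
  set (X3 := fsum (cube N) (fun k => kpow k (2 * (r - 1)) * cdot (w t k A3) (et t k))).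
  (* Buoyancy: 2(r - 1) = (r - be - 1) + (r - 1 + be) gives the scalar exactly its own regularity
     and leaves the rest to the dissipation. *)
  assert (B3 : X3 <= H t * D).
  { replace (H t * D) with (1 * H t * D) by ring.
    apply Rle_trans with (fsum (cube N) (fun k => 1 * (kpow k (r - be - 1) * Cmod (et t k))
      * (kpow k (r - 1 + be) * vmod (w t k)))).
    - apply fsum_le. intros k _.
      replace (2 * (r - 1)) with ((r - be - 1) + (r - 1 + be)) by ring. rewrite kpow_plus.
      replace (1 * _ * _) with ((kpow k (r - be - 1) * kpow k (r - 1 + be)) * (vmod (w t k) * Cmod (et t k))) by ring.
      apply Rmult_le_compat_l; [apply Rmult_le_pos; apply kpow_ge0|].
      eapply Rle_trans; [apply Rle_abs|]. eapply Rle_trans; [apply cdot_abs|].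
      apply Rmult_le_compat_r; [apply Cmod_ge_0|apply Cmod_le_vmod].
    - apply fsum_cauchy_schwarz_le; auto; try (intros; lra); rewrite fsum_scal, !Rmult_1_l.
      + apply (HH t Ht), cube_NoDup.
      + fold D2. lra. }
  assert (E : energy_rate N t = 2 * (- X1 - nu * D ^ 2 + X3 + - X4)).
  { unfold energy_rate. rewrite fsum_combination, fsum_scal, fsum_opp. fold X1 X3 X4 D2.
    rewrite HD. ring. }
  rewrite E.
  replace (fsum (cube N) (fun k => dterm k t)) with (D ^ 2).
  2: { rewrite HD. apply fsum_ext. intros k _. symmetry. apply Vnorm_weight. }
  apply Rabs_le_between in B1. apply Rabs_le_between in B4.
  replace (kap / (INR N + 1)) with (4 / nu * (c2 * b) ^ 2 * delta) by (unfold kap, delta; field; lra).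
  apply (absorption nu c1 c2 c3 c4 a b m (W t) (H t) D Ce delta eps G (- X1) X3 (- X4)); auto.
  - unfold c1, c2. lra.
  - unfold c3, c4. lra.
Qed.

Let mode_cont k : cont_on T (fun t => dterm k t).
Proof.
  apply (dissipation_cont T nu be r k v1 v2 th1 th2 NB1 NB2); auto.
  - intros t Ht. exact (proj1 (proj2 (proj2 (Hin1 t Ht)))).
  - intros t Ht. exact (proj1 (proj2 (proj2 (Hin2 t Ht)))).
Qed.

Let dterm_ge0 k t : 0 <= dterm k t.
Proof. apply Rmult_le_pos; [apply kpow_ge0|apply vmod2_ge0]. Qed.

Let dissipation_ge0 k t : 0 <= t <= T -> 0 <= RInt (dterm k) 0 t.
Proof.
  intros Ht. apply RInt_ge_0; [lra| |intros; apply dterm_ge0].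
  now apply (cont_on_ex_RInt T).
Qed.

Let energy_truncated N P p : (forall t, is_derive P t (K * p t)) ->
  W 0 ^ 2 + H 0 ^ 2 <= P 0 ->
  (forall t, 0 <= t <= T -> W t ^ 2 + H t ^ 2 <= p t) ->
  forall t, 0 <= t <= T ->
  fsum (cube N) (fun k => vterm k t) + fsum (cube N) (fun k => tterm N k t)
    + nu * fsum (cube N) (fun k => RInt (dterm k) 0 t) <= P t + kap * T / (INR N + 1).
Proof.
  intros HP H0 Hp.
  assert (HN := pos_INR N).
  assert (Hkap : 0 <= kap).
  { assert (0 < 4 / nu) by (apply Rdiv_lt_0_compat; lra).
    unfold kap. apply Rmult_le_pos; [apply Rmult_le_pos; [lra|]|]; apply pow2_ge_0. }
  assert (Hq : 0 <= kap / (INR N + 1)) by (apply Rdiv_le_0_compat; lra).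
  assert (HI : deriv_on T (fun t => fsum (cube N) (fun k => RInt (dterm k) 0 t))
    (fun t => fsum (cube N) (fun k => dterm k t))).
  { apply (deriv_on_fsum T (cube N) (fun k t => RInt (dterm k) 0 t) dterm).
    intros k _. apply deriv_on_RInt, mode_cont. }
  assert (HL : deriv_on T (fun t => P t + kap / (INR N + 1) * t) (fun t => K * p t + kap / (INR N + 1))).
  { apply deriv_on_plus; [now apply deriv_on_of_is_derive|].
    apply deriv_on_of_is_derive. intros t. auto_derive; auto. ring. }
  (* Energy plus dissipated energy, minus P(t) + kap t / (N + 1), has nonpositive derivative. Here
     [p] is a known bound of the full energy, and P' = K p defines the improved one. *)
  assert (Hall := deriv_on_minus _ _ _ _ _
    (deriv_on_plus _ _ _ _ _ (energy_deriv N) (deriv_on_scal T nu _ _ HI)) HL).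
  intros t Ht.
  assert (Hd := deriv_on_nonpos _ _ _ Hall). cbv beta in Hd.
  specialize (Hd ltac:(clear t Ht; intros t Ht; assert (He := energy_rate_le N t Ht);
    assert (Hk := Rmult_le_compat_l K _ _ K_ge0 (Hp t Ht)); lra) t Ht).
  assert (I0 : fsum (cube N) (fun k => RInt (dterm k) 0 0) = 0).
  { rewrite <- (fsum_zero (cube N)). apply fsum_ext. intros k _. apply (RInt_point (V := R_CompleteNormedModule)). }
  rewrite I0 in Hd.
  assert (V0 : fsum (cube N) (fun k => vterm k 0) <= W 0 ^ 2).
  { eapply Rle_trans; [|apply (HW 0 ltac:(lra)), (cube_NoDup N)]. apply fsum_le. intros k _.
    right. apply Vnorm_weight. }
  assert (T0 : fsum (cube N) (fun k => tterm N k 0) <= H 0 ^ 2).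
  { eapply Rle_trans; [|apply (HH 0 ltac:(lra)), (cube_NoDup N)]. apply fsum_le. intros k _.
    unfold tterm. rewrite <- Rpow_mult_distr. apply pow_incr. split.
    - apply Rmult_le_pos; [apply cutoff_ge0|apply Cmod_ge_0].
    - apply Rmult_le_compat_r; [apply Cmod_ge_0|apply cutoff_le]. }
  assert (kap / (INR N + 1) * t <= kap * T / (INR N + 1)).
  { replace (kap * T / (INR N + 1)) with (kap / (INR N + 1) * T) by (field; lra).
    apply Rmult_le_compat_l; lra. }
  lra.
Qed.

(** Two truncations: [N0] is fixed and selects the modes that are kept, while [N] tends to infinity
    in the energy inequality. On finitely many modes the cutoff converges to the full weight and the
    error vanishes. *)
Let energy_limit N0 P p : (forall t, is_derive P t (K * p t)) ->
  W 0 ^ 2 + H 0 ^ 2 <= P 0 ->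
  (forall t, 0 <= t <= T -> W t ^ 2 + H t ^ 2 <= p t) ->
  forall t, 0 <= t <= T ->
  fsum (cube N0) (fun k => (kpow k (r - 1) * vmod (w t k)) ^ 2)
    + fsum (cube N0) (fun k => (kpow k (r - be - 1) * Cmod (et t k)) ^ 2)
    + nu * fsum (cube N0) (fun k => RInt (dterm k) 0 t) <= P t.
Proof.
  intros HP H0 Hp t Ht.
  set (u := fun N => fsum (cube N0) (fun k => (kpow k (r - 1) * vmod (w t k)) ^ 2)
    + fsum (cube N0) (fun k => (cutoff (r - be - 1) N k * Cmod (et t k))
        * (cutoff (r - be - 1) N k * Cmod (et t k)))
    + nu * fsum (cube N0) (fun k => RInt (dterm k) 0 t)).
  match goal with |- ?x <= _ =>
    apply (is_lim_seq_le_loc u (fun N => P t + kap * T / (INR N + 1)) x (P t)) end.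
  - exists N0. intros N HN.
    eapply Rle_trans; [|apply (energy_truncated N P p HP H0 Hp t Ht)]. unfold u.
    apply Rplus_le_compat; [apply Rplus_le_compat|].
    + rewrite (fsum_ext _ _ (fun k => vterm k t)) by (intros; symmetry; apply Vnorm_weight).
      apply fsum_incl; auto using cube_NoDup, cube_incl.
      intros k. apply Rmult_le_pos; [apply kpow_ge0|apply vmod2_ge0].
    + rewrite (fsum_ext _ _ (fun k => tterm N k t)) by (intros; unfold tterm; ring).
      apply fsum_incl; auto using cube_NoDup, cube_incl.
      intros k. apply Rmult_le_pos; apply pow2_ge_0.
    + apply Rmult_le_compat_l; [lra|]. apply fsum_incl; auto using cube_NoDup, cube_incl.
  - apply is_lim_seq_plus'; [apply is_lim_seq_plus'|]; try apply is_lim_seq_const.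
    apply (is_lim_seq_fsum (cube N0) (fun k N => (cutoff (r - be - 1) N k * Cmod (et t k))
        * (cutoff (r - be - 1) N k * Cmod (et t k)))).
    intros k _. simpl. rewrite Rmult_1_r.
    apply is_lim_seq_mult'; apply (is_lim_seq_scal_r _ (Cmod (et t k)) (Finite (kpow k (r - be - 1)))), cutoff_lim.
  - replace (Finite (P t)) with (Finite (P t + 0)) by (f_equal; ring).
    apply is_lim_seq_plus'; [apply is_lim_seq_const|apply lim_over_INR].
Qed.

Let energy_step P p : (forall t, is_derive P t (K * p t)) ->
  W 0 ^ 2 + H 0 ^ 2 <= P 0 ->
  (forall t, 0 <= t <= T -> W t ^ 2 + H t ^ 2 <= p t) ->
  forall t, 0 <= t <= T -> W t ^ 2 + H t ^ 2 <= P t.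
Proof.
  intros HP H0 Hp t Ht.
  apply (is_lim_seq_le (fun N => fsum (cube N) (fun k => (kpow k (r - 1) * vmod (w t k)) ^ 2)
    + fsum (cube N) (fun k => (kpow k (r - be - 1) * Cmod (et t k)) ^ 2)) (fun _ => P t)
    (W t ^ 2 + H t ^ 2) (P t)).
  - intros N. assert (Hl := energy_limit N P p HP H0 Hp t Ht).
    assert (0 <= nu * fsum (cube N) (fun k => RInt (dterm k) 0 t)); [|lra].
    apply Rmult_le_pos; [lra|]. apply fsum_ge0. auto.
  - apply is_lim_seq_plus'.
    + apply (weighted_norm_lim (r - 1) _ (fun k => kpow k (2 * (r - 1)) * vmod2 (w t k)) _
        (Vnorm_weight (r - 1) (w t)) (HW t Ht)).
    + apply (weighted_norm_lim (r - be - 1) _ (fun k => kpow k (2 * (r - be - 1)) * Cmod (et t k) ^ 2) _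
        (fun k => weight_sq k _ _) (HH t Ht)).
  - apply is_lim_seq_const.
Qed.

Lemma difference_energy_bound :
  (forall t, 0 <= t <= T -> W t ^ 2 + H t ^ 2 <= (W 0 ^ 2 + H 0 ^ 2) * exp (K * t)) /\
  forall N, nu * fsum (cube N) (fun k => RInt (dterm k) 0 T) <= (W 0 ^ 2 + H 0 ^ 2) * exp (K * T).
Proof.
  assert (HY0 : 0 <= W 0 ^ 2 + H 0 ^ 2) by (apply Rplus_le_le_0_compat; apply pow2_ge_0).
  assert (Hgr : forall t, 0 <= t <= T -> W t ^ 2 + H t ^ 2 <= (W 0 ^ 2 + H 0 ^ 2) * exp (K * t)).
  (* The bounds in V^r and H^(r - be) start the iteration and disappear in its limit, so that only
     the initial energy and [K] remain. *)
  { apply (gronwall_iterated (fun t => W t ^ 2 + H t ^ 2) (W 0 ^ 2 + H 0 ^ 2) K T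
      ((a + b) ^ 2 + (m + m2) ^ 2)); auto.
    - apply Rplus_le_le_0_compat; apply pow2_ge_0.
    - intros t Ht. apply Rplus_le_compat; apply pow_incr; split.
      + apply (HW t Ht).
      + apply (Vnorm_sobolev (r - 1) (w t)).
        apply (sobolev_le_lower (r - 1) r); auto using vmod_ge0. lra.
      + apply (HH t Ht).
      + apply (Hnorm_sobolev (r - be - 1) (et t)).
        apply (sobolev_le_lower (r - be - 1) (r - be)); auto using Cmod_ge_0; [lra|].
        apply sobolev_ssub; auto. }
  split; auto. intros N.
  (* The exponential satisfies P' = K P, so it may serve as both [p] and [P]; this time the
     dissipation is kept. *)
  assert (Hl := energy_limit N (fun t => (W 0 ^ 2 + H 0 ^ 2) * exp (K * t))
    (fun t => (W 0 ^ 2 + H 0 ^ 2) * exp (K * t))).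
  specialize (Hl ltac:(intros t; auto_derive; auto; ring) ltac:(cbv beta; rewrite Rmult_0_r, exp_0; lra) Hgr T ltac:(lra)).
  assert (0 <= fsum (cube N) (fun k => (kpow k (r - 1) * vmod (w T k)) ^ 2))
    by (apply fsum_ge0; intros; apply pow2_ge_0).
  assert (0 <= fsum (cube N) (fun k => (kpow k (r - be - 1) * Cmod (et T k)) ^ 2))
    by (apply fsum_ge0; intros; apply pow2_ge_0).
  cbv beta in Hl. lra.
Qed.
End Difference.

(** * From the energy bound to the norms of the theorem *)

Lemma norms_from_energy T nu (W H : R -> R) V0 H0 I J :
  0 <= T -> 0 < nu -> 0 <= V0 -> 0 <= H0 -> 0 <= J ->
  (forall t, 0 <= t <= T -> 0 <= W t) -> (forall t, 0 <= t <= T -> 0 <= H t) ->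
  (forall t, 0 <= t <= T -> W t ^ 2 + H t ^ 2 <= (V0 ^ 2 + H0 ^ 2) * J) ->
  I <= (V0 ^ 2 + H0 ^ 2) * J / nu ->
  (forall t, 0 <= t <= T -> W t <= sqrt J * (V0 + H0)) /\
  (forall t, 0 <= t <= T -> H t <= sqrt J * (V0 + H0)) /\
  sqrt I <= sqrt (1 / nu) * (sqrt J * (V0 + H0)).
Proof.
  intros HT Hnu HV HH HJ HW0 HH0 HY HI.
  assert (Hn : 0 <= 1 / nu) by (left; apply Rdiv_lt_0_compat; lra).
  (* The energy controls squares and the theorem a sum of norms; V0^2 + H0^2 <= (V0 + H0)^2 passes
     from one to the other. *)
  assert (Hsq : (V0 ^ 2 + H0 ^ 2) * J <= (sqrt J * (V0 + H0)) ^ 2).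
  { rewrite Rpow_mult_distr, <- (Rsqr_pow2 (sqrt J)), Rsqr_sqrt by auto.
    rewrite Rmult_comm. apply Rmult_le_compat_l; auto.
    assert (Hp := Rmult_le_pos _ _ HV HH). lra. }
  assert (Hr : 0 <= sqrt J * (V0 + H0)) by (apply Rmult_le_pos; [apply sqrt_pos|lra]).
  split; [|split].
  - intros t Ht. specialize (HY t Ht). assert (Hx := pow2_ge_0 (H t)).
    apply Rsqr_incr_0_var; auto. rewrite !Rsqr_pow2. lra.
  - intros t Ht. specialize (HY t Ht). assert (Hx := pow2_ge_0 (W t)).
    apply Rsqr_incr_0_var; auto. rewrite !Rsqr_pow2. lra.
  - rewrite <- (sqrt_pow2 (sqrt J * (V0 + H0))) by auto. rewrite <- sqrt_mult_alt by auto.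
    apply sqrt_le_1_alt. eapply Rle_trans; [apply HI|].
    unfold Rdiv. rewrite Rmult_1_l, Rmult_comm. apply Rmult_le_compat_l; auto.
    left. now apply Rinv_0_lt_compat.
Qed.

Theorem theorem12 (nu al be r : R)
  (Hnu : 0 < nu) (Hbe : 1 / 2 < be < 5 / 4) (Hab : al + be = 5 / 4)
  (Hr : be + 2 < r) :
  exists Cf : R -> R -> R -> R -> R -> R -> R,
  forall (T : R) (v10 v20 : vfield) (th10 th20 : sfield)
         (v1 v2 : R -> vfield) (th1 th2 : R -> sfield),
    0 < T ->
    in_V r v10 -> in_V r v20 -> in_H (r - be) th10 -> in_H (r - be) th20 ->
    is_solution nu al be T v10 th10 v1 th1 ->
    is_solution nu al be T v20 th20 v2 th2 ->
    in_CV T r v1 -> in_CV T r v2 ->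
    in_L2V T (r + be) v1 -> in_L2V T (r + be) v2 ->
    in_CH T (r - be) th1 -> in_CH T (r - be) th2 ->
    LinfV T (r - 1) (fun t => vsub (v1 t) (v2 t))
    + L2Vnorm T (r - 1 + be) (fun t => vsub (v1 t) (v2 t))
    + LinfH T (r - be - 1) (fun t => ssub (th1 t) (th2 t))
    <= Cf T (LinfH T (r - be) th1)
            (L2Vnorm T (r + be - 1) v1) (L2Vnorm T (r + be - 1) v2)
            (LinfV T r v1) (LinfV T r v2)
       * (Vnorm (r - 1) (vsub v10 v20) + Hnorm (r - be - 1) (ssub th10 th20)).
Proof.
  destruct (lattice_series (be + 1)) as (S & HS0 & HS); [lra|].
  (* Each of the two suprema contributes 1, and the dissipation, known after division by nu,
     contributes sqrt (1 / nu). The outer square root undoes the squaring in the energy. *)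
  exists (fun T m _ _ a b => (2 + sqrt (1 / nu)) * sqrt (exp (growth_rate nu be r S a b m * T))).
  intros T v10 v20 th10 th20 v1 v2 th1 th2 HT Hv10 Hv20 Hh10 Hh20 Hs1 Hs2 Hc1 Hc2 _ _ Hd1 Hd2.
  assert (HT0 : 0 <= T) by lra.
  set (a := LinfV T r v1). set (b := LinfV T r v2). set (m := LinfH T (r - be) th1).
  set (K := growth_rate nu be r S a b m).
  destruct (solution_modes nu al be r T v10 th10 v1 th1) as (NB1 & NT1 & HNB1 & HNT1 & Hm1 & Hm1'); auto; try lra.
  destruct (solution_modes nu al be r T v20 th20 v2 th2) as (NB2 & NT2 & HNB2 & HNT2 & Hm2 & Hm2'); auto; try lra.
  destruct (difference_energy_bound nu al be r T S v1 v2 th1 th2 NB1 NB2 NT1 NT2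
    a b m (LinfH T (r - be) th2)) as [HY HI]; auto; try lra.
  { apply Hc1. } { apply Hc2. } { intros t Ht. apply (proj1 Hd1 t Ht). } { intros t Ht. apply (proj1 Hd2 t Ht). }
  { now apply in_CV_bound. } { now apply in_CV_bound. } { now apply in_CH_bound. } { now apply in_CH_bound. }
  fold K in HY, HI.
  set (w := fun t => vsub (v1 t) (v2 t)) in *. set (et := fun t => ssub (th1 t) (th2 t)) in *.
  set (V0 := Vnorm (r - 1) (vsub v10 v20)). set (H0 := Hnorm (r - be - 1) (ssub th10 th20)).
  assert (HV0 : 0 <= V0) by apply Vnorm_ge0. assert (HH0 : 0 <= H0) by apply Hnorm_ge0.
  assert (HV : Vnorm (r - 1) (w 0) <= V0).
  { apply Vnorm_sobolev. apply (sobolev_le_ext (r - 1) (fun k => vmod (vsub v10 v20 k))).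
    - intros k. unfold vmod, vmod2, w, vsub. destruct Hs1 as (E1 & _). destruct Hs2 as (E2 & _).
      now rewrite !E1, !E2.
    - eapply Vnorm_sobolev. apply (sobolev_le_lower (r - 1) r); auto using vmod_ge0; [lra|].
      apply sobolev_vsub; now apply in_V_sobolev. }
  assert (HH : Hnorm (r - be - 1) (et 0) <= H0).
  { apply Hnorm_sobolev. apply (sobolev_le_ext (r - be - 1) (fun k => Cmod (ssub th10 th20 k))).
    - intros k. unfold et, ssub. destruct Hs1 as (_ & E1 & _). destruct Hs2 as (_ & E2 & _).
      now rewrite !E1, !E2.
    - eapply Hnorm_sobolev. apply (sobolev_le_lower (r - be - 1) (r - be)); auto using Cmod_ge_0; [lra|].
      apply sobolev_ssub; now apply in_H_sobolev. }
  assert (HY0 : Vnorm (r - 1) (w 0) ^ 2 + Hnorm (r - be - 1) (et 0) ^ 2 <= V0 ^ 2 + H0 ^ 2).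
  { apply Rplus_le_compat; apply pow_incr; split; auto using Vnorm_ge0, Hnorm_ge0. }
  assert (HKT : forall t, 0 <= t <= T -> exp (K * t) <= exp (K * T)).
  { assert (HK : 0 <= K).
    { apply growth_rate_ge0; auto; try lra.
      - apply (in_CV_bound T r v1 HT0 Hc1 0). lra.
      - apply (in_CV_bound T r v2 HT0 Hc2 0). lra.
      - apply (in_CH_bound T (r - be) th1 HT0 Hd1 0). lra. }
    intros t Ht. assert (K * t <= K * T) by (apply Rmult_le_compat_l; lra).
    destruct (Req_dec (K * t) (K * T)) as [->|]; [lra|]. left. apply exp_increasing. lra. }
  assert (HJ := exp_pos (K * T)).
  set (I := real (L2V2 T (r - 1 + be) w)).
  destruct (norms_from_energy T nu (fun t => Vnorm (r - 1) (w t)) (fun t => Hnorm (r - be - 1) (et t))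
    V0 H0 I (exp (K * T))) as (R1 & R2 & R3); auto using Vnorm_ge0, Hnorm_ge0; try lra.
  - intros t Ht. eapply Rle_trans; [apply (HY t Ht)|].
    apply Rmult_le_compat; auto; [|left; apply exp_pos].
    apply Rplus_le_le_0_compat; apply pow2_ge_0.
  - assert (HIN : forall N, fsum (cube N) (fun k =>
      RInt (fun t => kpow k (2 * (r - 1 + be)) * vmod2 (w t k)) 0 T)
      <= (V0 ^ 2 + H0 ^ 2) * exp (K * T) / nu).
    { intros N. apply Rle_div_r; [lra|]. rewrite Rmult_comm. eapply Rle_trans; [apply (HI N)|].
      apply Rmult_le_compat_r; [left; apply exp_pos|exact HY0]. }
    apply zsum3_bound; auto. intros k. apply RInt_ge_0; auto.
    + apply (cont_on_ex_RInt T); [|lra].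
      apply (dissipation_cont T nu be r k v1 v2 th1 th2 NB1 NB2); auto.
      * intros t Ht. exact (proj1 (proj2 (proj2 (proj1 Hc1 t Ht)))).
      * intros t Ht. exact (proj1 (proj2 (proj2 (proj1 Hc2 t Ht)))).
    + intros t _. apply Rmult_le_pos; [apply kpow_ge0|apply vmod2_ge0].
  - destruct (sup_on_correct T (fun t => Vnorm (r - 1) (w t)) _ HT0 R1) as [_ S1].
    destruct (sup_on_correct T (fun t => Hnorm (r - be - 1) (et t)) _ HT0 R2) as [_ S2].
    unfold LinfV, LinfH, L2Vnorm. fold I.
    set (X := sqrt (exp (K * T)) * (V0 + H0)) in *.
    replace ((2 + sqrt (1 / nu)) * sqrt (exp (K * T)) * (V0 + H0))
      with (X + sqrt (1 / nu) * X + X) by (unfold X; ring).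
    apply Rplus_le_compat; [apply Rplus_le_compat|]; auto.
Qed.
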